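(* $\mathrm{SOM}(Q^{\star}_{\mathrm{Grp}}) \equiv Q^{\star}_{\mathrm{Grp}}\mathrm{FO}$. That is, for every string signature $\tau$, every sentence of $\mathrm{SOM}(Q^{\star}_{\mathrm{Grp}})[\tau]$ is equivalent over all $\tau$-string structures to a sentence of $Q^{\star}_{\mathrm{Grp}}\mathrm{FO}[\tau]$, and conversely.
   Context: Strings as structures: an alphabet is a finite linearly ordered sequence $\Sigma=(a_1,\dots,a_s)$. A nonempty string $b_0\cdots b_{n-1}$ over $\Sigma$ is identified with the structure of signature $\tau=\langle P_{a_1},\dots,P_{a_s}\rangle$ with universe $\{0,\dots,n-1\}$, where $<$ is the natural order and $P_{a_i}=\{j : b_j=a_i\}$. First-order logic FO over such structures uses $=$, $<$, the unary predicates, constants $\min=0$ and $\max=n-1$, Boolean connectives and $\exists,\forall$; SOM (monadic second-order logic) additionally has unary second-order variables and $\exists,\forall$ over them. No other built-in relations are present. Monadic second-order Lindström quantifier $Q^{\star}_L$: let $L$ be a language over $(a_1,\dots,a_s)$ and $\overline X=(X_1,\dots,X_k)$ a tuple of distinct unary second-order variables. Over a structure with universe $\{0,\dots,n-1\}$, encode an assignment $(A_1,\dots,A_k)$ by the bit string $s^1_0\cdots s^1_{n-1}s^2_0\cdots s^2_{n-1}\cdots s^k_0\cdots s^k_{n-1}$ where $s^i_j=1$ iff $j\in A_i$, and order the $2^{nk}$ assignments $\overline{A}^{(0)}<\dots<\overline{A}^{(2^{nk}-1)}$ lexicographically by code. Then $\mathcal A\models Q^{\star}_L\overline X[\varphi_1,\dots,\varphi_{s-1}]$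 iff the word of length $2^{nk}$ whose $i$-th letter is $a_j$ for the least $j\le s-1$ with $\mathcal A\models\varphi_j(\overline A^{(i)})$, and $a_s$ if there is no such $j$, belongs to $L$. A groupoid is a finite set $G$ with a binary operation having an identity element. For $S\subseteq G$, the word-problem $\mathcal W(S,G)$ is the set of words over the alphabet $G$ (in some fixed order) that can be bracketed so that they multiply out to an element of $S$. A groupoidal quantifier is a quantifier defined by a word-problem of some finite groupoid. $Q^{\star}_{\mathrm{Grp}}\mathrm{FO}$ consists of all formulas $Q^{\star}_L\overline X[\varphi_1,\dots,\varphi_{s-1}]$ with $L$ a groupoid word-problem and $\varphi_i$ first-order formulas (which may contain the set variables $\overline X$). $\mathrm{SOM}(Q^{\star}_{\mathrm{Grp}})$ is SOM closed additionally under applying $Q^{\star}_L$ ($L$ a groupoid word-problem) to arbitrary formulas of the logic, with arbitrary nesting. For logics $\mathcal L,\mathcal L'$, $\mathcal L\equiv\mathcal L'$ means that over every string signature each sentence of either logic has an equivalent sentence in the other. *)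

(* Defs.v *)
From mathcomp Require Import all_boot.
Set Implicit Arguments. Unset Strict Implicit. Unset Printing Implicit Defensive.

(* A finite groupoid G together with a fixed linear order of its      *)
(* elements is represented (up to renaming) with carrier 'I_m.+1,     *)
(* ordered by the natural order of ordinals (G is nonempty since it   *)
(* has an identity).  A groupoidal quantifier is given by such a       *)
(* groupoid together with the accepting subset S.                      *)
Record gquant (m : nat) := GQuant {
  gop : 'I_m.+1 -> 'I_m.+1 -> 'I_m.+1;
  gid : 'I_m.+1;
  gidl : forall x, gop gid x = x;
  gidr : forall x, gop x gid = x;
  gS : {set 'I_m.+1}
}.

(* The set of all values that a word can multiply out to, over all    *)
(* bracketings (fuel-based recursion; fuel = size of the word, which  *)
(* is enough since both parts of a split are strictly shorter).       *)
Fixpoint bvals_aux (T : finType) (op : T -> T -> T) (f : nat) (w : seq T)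
  : {set T} :=
  match f with
  | 0 => set0
  | f'.+1 =>
    match w with
    | [:: x] => [set x]
    | _ => \bigcup_(i < size w | 0 < i)
             [set op a b | a in bvals_aux op f' (take i w),
                           b in bvals_aux op f' (drop i w)]
    end
  end.

Definition bvals (T : finType) (op : T -> T -> T) (w : seq T) : {set T} :=
  bvals_aux op (size w) w.

Definition in_word_problem m (G : gquant m) (w : seq 'I_m.+1) : bool :=
  [exists g in gS G, g \in bvals (@gop m G) w].

Inductive term := TVar of nat | TMin | TMax.

Inductive formula (s : nat) :=
| FP of 'I_s & term
| FEq of term & term
| FLt of term & term
| FIn of nat & term
| FNot of formula s
| FAnd of formula s & formula s
| FOr of formula s & formula s
| FEx of nat & formula s
| FAll of nat & formula s
| FExS of nat & formula s
| FAllS of nat & formula s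
| FQ (m : nat) of gquant m & seq nat & seq (formula s).
   (* Q*_L X1..Xk [phi_1, ..., phi_m], L = W(S,G), |G| = m+1 letters *)

Arguments FQ {s m}.

Section Semantics.
Variables (s n : nat) (w : 'I_n.+1 -> 'I_s).

Definition teval (fo : nat -> 'I_n.+1) (t : term) : 'I_n.+1 :=
  match t with TVar x => fo x | TMin => ord0 | TMax => ord_max end.

Definition fupd {T} (f : nat -> T) (x : nat) (v : T) : nat -> T :=
  fun y => if y == x then v else f y.

(* The i-th assignment (in lexicographic order of codes) to the      *)
(* distinct set variables Xs: the code of length N = (n+1)*k is the  *)
(* binary expansion of i, most significant bit first; bit number     *)
(* p = (index of X in Xs)*(n+1) + j says whether j belongs to X.     *)
Definition qassign (Xs : seq nat) (so : nat -> {set 'I_n.+1}) (i : nat)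
  : nat -> {set 'I_n.+1} :=
  let N := n.+1 * size Xs in
  fun X => if X \in Xs then
             [set j : 'I_n.+1 | odd (i %/ 2 ^ (N - (index X Xs * n.+1 + j)).-1)]
           else so X.

Definition qletter m (bs : seq bool) : 'I_m.+1 :=
  let j := find id bs in if j < m then inord j else ord_max.

Fixpoint sat (phi : formula s) (fo : nat -> 'I_n.+1)
    (so : nat -> {set 'I_n.+1}) {struct phi} : bool :=
  match phi with
  | FP a t => w (teval fo t) == a
  | FEq t1 t2 => teval fo t1 == teval fo t2
  | FLt t1 t2 => (teval fo t1 < teval fo t2)%N
  | FIn X t => teval fo t \in so X
  | FNot p => ~~ sat p fo so
  | FAnd p q => sat p fo so && sat q fo so
  | FOr p q => sat p fo so || sat q fo so
  | FEx x p => [exists v : 'I_n.+1, sat p (fupd fo x v) so]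
  | FAll x p => [forall v : 'I_n.+1, sat p (fupd fo x v) so]
  | FExS X p => [exists A : {set 'I_n.+1}, sat p fo (fupd so X A)]
  | FAllS X p => [forall A : {set 'I_n.+1}, sat p fo (fupd so X A)]
  | @FQ _ m G Xs ps =>
      in_word_problem G
        [seq qletter m [seq sat p fo (qassign Xs so i) | p <- ps]
        | i <- iota 0 (2 ^ (n.+1 * size Xs))]
  end.

(* Truth of a sentence (the default assignment is irrelevant for     *)
(* closed formulas). *)
Definition models (phi : formula s) : bool :=
  sat phi (fun _ => ord0) (fun _ => set0).

End Semantics.

Fixpoint wf s (phi : formula s) : bool :=
  match phi with
  | FNot p | FEx _ p | FAll _ p | FExS _ p | FAllS _ p => wf p
  | FAnd p q | FOr p q => wf p && wf q
  | @FQ _ m _ Xs ps => (size ps == m) && uniq Xs && all (@wf s) ps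
  | _ => true
  end.

Definition tvars (t : term) : seq nat :=
  if t is TVar x then [:: x] else [::].

Fixpoint fov s (phi : formula s) : seq nat :=
  match phi with
  | FP _ t | FIn _ t => tvars t
  | FEq t1 t2 | FLt t1 t2 => tvars t1 ++ tvars t2
  | FNot p | FExS _ p | FAllS _ p => fov p
  | FAnd p q | FOr p q => fov p ++ fov q
  | FEx x p | FAll x p => [seq y <- fov p | y != x]
  | FQ _ _ _ ps => flatten [seq fov p | p <- ps]
  end.

Fixpoint sov s (phi : formula s) : seq nat :=
  match phi with
  | FIn X _ => [:: X]
  | FNot p | FEx _ p | FAll _ p => sov p
  | FAnd p q | FOr p q => sov p ++ sov q
  | FExS X p | FAllS X p => [seq Y <- sov p | Y != X]
  | FQ _ _ Xs ps => [seq Y <- flatten [seq sov p | p <- ps] | Y \notin Xs]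
  | _ => [::]
  end.

Definition is_sentence s (phi : formula s) : bool :=
  (fov phi == [::]) && (sov phi == [::]).

(* First-order formulas (set variables may occur free). *)
Fixpoint is_FO s (phi : formula s) : bool :=
  match phi with
  | FNot p | FEx _ p | FAll _ p => is_FO p
  | FAnd p q | FOr p q => is_FO p && is_FO q
  | FExS _ _ | FAllS _ _ | FQ _ _ _ _ => false
  | _ => true
  end.

Definition is_QGrpFO s (phi : formula s) : bool :=
  if phi is FQ _ _ _ ps then all (@is_FO s) ps else false.

Definition equiv_sent s (phi psi : formula s) : Prop :=
  forall n (w : 'I_n.+1 -> 'I_s), models w phi = models w psi.

(* Main.v *)
From HB Require Import structures.
Require Import Defs.
From mathcomp Require Import all_boot.
From mathcomp Require Import zify.
From Stdlib Require Import FunctionalExtensionality.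
Set Implicit Arguments. Unset Strict Implicit. Unset Printing Implicit Defensive.

(** Call a relation grammar-definable if it holds exactly when a word belongs to a fixed context-free
    language, the letters of the word being given by first-order formulas at the assignments to some set
    variables, in lexicographic order, with blanks allowed. Blanks are the identity of the groupoid whose
    other elements are the sets of nonterminals, so that this is definability in Q*_Grp FO.

    Consider Horn clauses over numbers below 2^O(n), with grammar-definable side conditions and with
    derivations of size 2^O(n). Derivability is again grammar-definable, by the idea of the hardest
    context-free language: a stack of numbers in unary is handled by a Dyck word made of optional blocks,
    one for each instance of a clause, the whole list of blocks being repeated 2^O(n) times; the side
    condition is a word of its own language inside the block. CYK parsing is of this form, so a groupoidal
    quantifier applied to grammar-definable relations gives a grammar-definable relation, provided that their
    complements are grammar-definable too.

    Complements are obtained by inductive counting, as in the proof that LOGCFL is closed under complement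
    (Borodin, Cook, Dymond, Ruzzo, Tompa). Number the CYK items so that premises are smaller than
    conclusions. Knowing the number c of true items below x, one certifies that y < x is false by finding c
    true items below x other than y, hence also that x is false, and this yields the number of true items
    below x + 1. Thus, by induction on formulas, every formula and its negation are grammar-definable. *)

(** * Binary digits *)

(** Formulas see only the order of the string; no addition of positions is available. What
    first-order logic can read off binary codes is comparison, successor, the two ends of the range,
    and sums equal to the all-ones number or one less. The coding of CYK items is chosen so that
    these suffice: with the left end complemented, adjacency of two intervals becomes such a sum. On
    the stack a number is only ever pushed and matched, so unary suffices there; a word has 2^O(n)
    letters and can afford it. A run reads the blocks in the order of the word, while a derivation
    uses clauses in any order. Each derivation step may therefore consume a whole copy of the list
    of blocks, and this is why derivations must have size 2^O(n). Grammars certify positive facts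
    only, whereas the letter at an assignment is given by the first true formula, so the earlier
    ones must be certified false. Hence complements are carried through the whole induction. *)

Definition bit (i e : nat) : bool := odd (i %/ 2 ^ e).

Lemma bit0 i : bit i 0 = odd i.
Proof. by rewrite /bit expn0 divn1. Qed.

Lemma bitS i e : bit i e.+1 = bit i./2 e.
Proof. by rewrite /bit expnS divnMA divn2. Qed.

Lemma bit_inj N i j : i < 2 ^ N -> j < 2 ^ N ->
  (forall e, e < N -> bit i e = bit j e) -> i = j.
Proof.
elim: N i j => [|N IH] i j; first by rewrite expn0; lia.
rewrite expnS => ltiN ltjN eqb.
have eqh : i./2 = j./2.
  by apply: IH => [||e lteN]; [lia | lia | rewrite -!bitS eqb].
have := eqb 0 isT; rewrite !bit0 => eqo.
by rewrite -(odd_double_half i) -(odd_double_half j) eqo eqh.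
Qed.

Lemma ltn_bit N i j : i < 2 ^ N -> j < 2 ^ N ->
  i < j <-> exists2 e, e < N &
    [/\ ~~ bit i e, bit j e & forall e', e < e' -> e' < N -> bit i e' = bit j e'].
Proof.
elim: N i j => [|N IH] i j.
  by rewrite expn0 => ? ?; split=> [|[]//]; lia.
rewrite expnS => ltiN ltjN.
have {}IH := IH i./2 j./2 ltac:(lia) ltac:(lia).
split=> [ltij|[[|e] lteN [bi bj eqb]]].
- have [lth|geh] := ltnP i./2 j./2.
    have [e lteN [bi bj eqb]] := proj1 IH lth.
    exists e.+1; first by [].
    by split; rewrite ?bitS // => -[|e'] //; rewrite !bitS; apply: eqb.
  have eqh : i./2 = j./2 by lia.
  exists 0; first by [].
  split; rewrite ?bit0; [lia | lia |].
  by case=> // e' _ _; rewrite !bitS eqh.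
- have eqh : i./2 = j./2.
    apply: (@bit_inj N) => [||e lteN']; [lia | lia |].
    by rewrite -!bitS; apply: eqb.
  by move: bi bj; rewrite !bit0; lia.
- have : i./2 < j./2.
    apply/IH; exists e; first by [].
    rewrite -!bitS; split=> // e' lt1 lt2.
    by rewrite -!bitS; apply: eqb.
  by lia.
Qed.

(** Adding one turns the lowest zero, at [e], into a one and clears the ones below it. Only
    positions are quantified, so a first-order formula can copy the right-hand side. *)
Lemma succ_bit N i j : i < 2 ^ N -> j < 2 ^ N ->
  j = i.+1 <-> exists2 e, e < N &
    [/\ ~~ bit i e, bit j e, forall e', e < e' -> e' < N -> bit i e' = bit j e'
      & forall e', e' < e -> bit i e' && ~~ bit j e'].
Proof.
elim: N i j => [|N IH] i j.
  by rewrite expn0 => ? ?; split=> [|[]//]; lia.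
rewrite expnS => ltiN ltjN.
have {}IH := IH i./2 j./2 ltac:(lia) ltac:(lia).
split=> [eqij|[[|e] lteN [bi bj eqb eql]]].
- case: (boolP (odd i)) => oddi.
    have eqh : j./2 = i./2.+1 by lia.
    have [e lteN [bi bj eqb eql]] := proj1 IH eqh.
    exists e.+1; first by [].
    split; rewrite ?bitS //; first by case=> // e'; rewrite !bitS; apply: eqb.
    by case=> [|e'] lte; [rewrite !bit0; lia | rewrite !bitS; apply: eql].
  have eqh : i./2 = j./2 by lia.
  exists 0; first by [].
  split; rewrite ?bit0; [lia | lia | | by []].
  by case=> // e' _ _; rewrite !bitS eqh.
- have eqh : i./2 = j./2.
    apply: (@bit_inj N) => [||e lteN']; [lia | lia |].
    by rewrite -!bitS; apply: eqb.
  by move: bi bj; rewrite !bit0; lia.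
- have : j./2 = i./2.+1.
    apply/IH; exists e; first by [].
    rewrite -!bitS; split=> // e' lt1 => [lt2|]; rewrite -!bitS; first exact: eqb.
    exact: eql.
  by have := eql 0 isT; rewrite !bit0; lia.
Qed.

Lemma bit_compl N i e : i < 2 ^ N -> e < N ->
  bit ((2 ^ N).-1 - i) e = ~~ bit i e.
Proof.
elim: N i e => [|N IH] i e //; rewrite expnS => ltiN.
case: e => [_|e lteN]; first by rewrite !bit0; have := expn_gt0 2 N; lia.
rewrite !bitS -IH //; last by lia.
by congr bit; lia.
Qed.

(** A sum equal to the all-ones number has no carries, so it is decided bit by bit. *)
Lemma compl_bit N i j : i < 2 ^ N -> j < 2 ^ N ->
  i + j = (2 ^ N).-1 <-> forall e, e < N -> bit j e = ~~ bit i e.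
Proof.
move=> ltiN ltjN; split=> [eqij e lteN|eqb].
  by rewrite -(bit_compl ltiN lteN); congr bit; lia.
suff : j = (2 ^ N).-1 - i by lia.
by apply: (@bit_inj N) => [||e lteN]; [lia | lia | rewrite bit_compl // eqb].
Qed.

(** * Blocks of set variables as numbers *)

(** The exponent of the bit telling whether [j] lies in the [a]-th set of a block of [k] sets. Codes
    start with the most significant bit, whence the reversal. *)
Definition epos (n k a j : nat) : nat := (n.+1 * k - (a * n.+1 + j)).-1.

Lemma pos_lt n k a j : a < k -> j < n.+1 -> a * n.+1 + j < n.+1 * k.
Proof. by move=> ltak ltjn; apply: (@leq_trans (a.+1 * n.+1)); [lia | rewrite mulnC leq_mul2l ltak orbT]. Qed.

Lemma epos_lt n k a j : a < k -> j < n.+1 -> epos n k a j < n.+1 * k.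
Proof. by move=> ltak ltjn; have := pos_lt ltak ltjn; rewrite /epos; lia. Qed.

Lemma epos_surj n k e : e < n.+1 * k ->
  exists a (j : 'I_n.+1), a < k /\ e = epos n k a j.
Proof.
move=> lte; set p := (n.+1 * k - e).-1.
have ltj : p %% n.+1 < n.+1 by rewrite ltn_mod.
exists (p %/ n.+1), (Ordinal ltj); split.
  by rewrite ltn_divLR // mulnC /p; lia.
by rewrite /epos /= -divn_eq /p; lia.
Qed.

Lemma epos_ltn n k a (j : 'I_n.+1) b (u : 'I_n.+1) : a < k -> b < k ->
  (epos n k a j < epos n k b u) = (b < a) || (b == a) && (u < j).
Proof.
move=> ltak ltbk.
have la := pos_lt ltak (ltn_ord j); have lb := pos_lt ltbk (ltn_ord u).
have -> : (epos n k a j < epos n k b u) = (b * n.+1 + u < a * n.+1 + j).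
  by rewrite /epos; lia.
have lj := ltn_ord j; have lu := ltn_ord u.
have [lt|gt|->] := ltngtP b a; last by rewrite ltn_add2l.
- have : b.+1 * n.+1 <= a * n.+1 by rewrite leq_mul2r lt orbT.
  by lia.
- have : a.+1 * n.+1 <= b * n.+1 by rewrite leq_mul2r gt orbT.
  by lia.
Qed.

Section Blocks.
Variable n : nat.
Implicit Types (so : nat -> {set 'I_n.+1}) (K k i : nat).

Definition setnum K k i so : nat -> {set 'I_n.+1} := qassign (iota K k) so i.

Lemma setnumE K k i so X : setnum K k i so X =
  if K <= X < K + k then [set j : 'I_n.+1 | bit i (epos n k (X - K) j)]
  else so X.
Proof.
rewrite /setnum /qassign mem_iota size_iota; case: ifP => // /andP[leK ltX].
suff -> : index X (iota K k) = X - K by [].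
have nthX : nth 0 (iota K k) (X - K) = X by rewrite nth_iota; lia.
by rewrite -{1}nthX index_uniq ?size_iota ?iota_uniq //; lia.
Qed.

Lemma in_setnum K k i so a (j : 'I_n.+1) : a < k ->
  (j \in setnum K k i so (K + a)) = bit i (epos n k a j).
Proof. by move=> lta; rewrite setnumE leq_addr ltn_add2l lta inE addKn. Qed.

Lemma setnum_out K k i so X : ~~ (K <= X < K + k) -> setnum K k i so X = so X.
Proof. by rewrite setnumE => /negbTE ->. Qed.

Lemma setnum_inj K k i i' so so' : i < 2 ^ (n.+1 * k) -> i' < 2 ^ (n.+1 * k) ->
  (forall a, a < k -> setnum K k i so (K + a) = setnum K k i' so' (K + a)) -> i = i'.
Proof.
move=> lti lti' eqs; apply: (bit_inj lti lti') => e /epos_surj[a [j [lta ->]]].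
by rewrite -(in_setnum K i so _ lta) -(in_setnum K i' so' _ lta) eqs.
Qed.

Definition num K k so : nat :=
  find (fun i => [forall a : 'I_k, setnum K k i so (K + a) == so (K + a)])
       (iota 0 (2 ^ (n.+1 * k))).

(** By counting: distinct codes give distinct [k]-tuples of sets, and there are as many codes as
    tuples. *)
Lemma has_num K k so :
  has (fun i => [forall a : 'I_k, setnum K k i so (K + a) == so (K + a)])
      (iota 0 (2 ^ (n.+1 * k))).
Proof.
pose f (i : 'I_(2 ^ (n.+1 * k))) := [ffun a : 'I_k => setnum K k i so (K + a)].
have f_inj : injective f.
  move=> i i' /ffunP eqf; apply/val_inj/(@setnum_inj K k _ _ so so); try exact: ltn_ord.
  move=> a lta.
  by have := eqf (Ordinal lta); rewrite !ffunE.
have : [ffun a : 'I_k => so (K + a)] \in codom f.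
  apply: inj_card_onto => //.
  by rewrite card_ffun !card_ord -cardsT -powersetT card_powerset cardsT card_ord expnM.
case/codomP=> i /ffunP eqi; apply/hasP; exists (val i); first by rewrite mem_iota /=.
by apply/forallP=> a; have := eqi a; rewrite !ffunE => ->.
Qed.

Lemma num_lt K k so : num K k so < 2 ^ (n.+1 * k).
Proof. by have := has_num K k so; rewrite has_find size_iota. Qed.

Lemma setnum_num K k so : setnum K k (num K k so) so = so.
Proof.
apply: functional_extensionality => X.
have [/andP[leK ltX]|out] := boolP (K <= X < K + k); last by rewrite setnum_out.
have ltk : X - K < k by lia.
have := nth_find 0 (has_num K k so); rewrite -/(num K k so) nth_iota ?num_lt //.
by move=> /forallP/(_ (Ordinal ltk))/eqP /=; rewrite add0n subnKC.
Qed.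

Lemma num_bit K k so a (j : 'I_n.+1) : a < k ->
  (j \in so (K + a)) = bit (num K k so) (epos n k a j).
Proof. by move=> lta; rewrite -{1}(setnum_num K k so) in_setnum. Qed.

Lemma num_uniq K k so i : i < 2 ^ (n.+1 * k) ->
  (forall a (j : 'I_n.+1), a < k -> (j \in so (K + a)) = bit i (epos n k a j)) ->
  num K k so = i.
Proof.
move=> lti eqb; apply: (bit_inj (num_lt K k so) lti) => e /epos_surj[a [j [lta ->]]].
by rewrite -num_bit // eqb.
Qed.

Lemma num_setnum K k i so : i < 2 ^ (n.+1 * k) -> num K k (setnum K k i so) = i.
Proof. by move=> lti; apply: num_uniq => // a j lta; rewrite in_setnum. Qed.

Lemma num_eq K K' k so so' :
  (forall a, a < k -> so (K + a) = so' (K' + a)) -> num K k so = num K' k so'.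
Proof.
move=> eqs; apply: num_uniq; first exact: num_lt.
by move=> a j lta; rewrite eqs // (num_bit K' so' _ lta).
Qed.

Lemma num_setnum_out K k K' k' i so : K + k <= K' \/ K' + k' <= K ->
  num K k (setnum K' k' i so) = num K k so.
Proof. by move=> out; apply: num_eq => a lta; rewrite setnum_out //; lia. Qed.

Lemma bit_mulD b i1 i2 e : i2 < 2 ^ b ->
  bit (i1 * 2 ^ b + i2) e = if e < b then bit i2 e else bit i1 (e - b).
Proof.
elim: b i2 e => [|b IH] i2 e; first by rewrite expn0 muln1 subn0; case: i2 => //; rewrite addn0.
rewrite expnS => lti2.
have eqh : (i1 * (2 * 2 ^ b) + i2)./2 = i1 * 2 ^ b + i2./2.
  rewrite mulnCA; move: (i1 * 2 ^ b) => Q; lia.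
case: e => [|e]; first by rewrite /= !bit0 oddD !oddM andbF.
rewrite bitS eqh IH; last by lia.
by rewrite ltnS subSS; case: ifP => //; rewrite bitS.
Qed.

(** Positional notation in base [2 ^ (n.+1 * b)]: one lexicographic loop over [a + b] variables is a
    loop over [a] variables around a loop over [b] variables. *)
Lemma setnum_cat K a b i1 i2 so : i2 < 2 ^ (n.+1 * b) ->
  setnum K (a + b) (i1 * 2 ^ (n.+1 * b) + i2) so
  = setnum (K + a) b i2 (setnum K a i1 so).
Proof.
move=> lti2; apply: functional_extensionality => X.
rewrite setnumE (setnumE (K + a)); case: (boolP (K + a <= X < K + a + b)) => inb.
  have -> : K <= X < K + (a + b) by lia.
  apply/setP=> j; rewrite !inE bit_mulD //.
  have ltb : X - (K + a) < b by lia.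
  have -> : epos n (a + b) (X - K) j = epos n b (X - (K + a)) j.
    have -> : X - K = a + (X - (K + a)) by lia.
    by rewrite /epos mulnDr mulnDl; lia.
  by rewrite epos_lt.
rewrite setnumE; case: ifP => ina; last by case: ifP => //; lia.
have -> : K <= X < K + a by lia.
apply/setP=> j; rewrite !inE bit_mulD //.
have lta : X - K < a by lia.
have lt := pos_lt lta (ltn_ord j).
have -> : epos n (a + b) (X - K) j = epos n a (X - K) j + n.+1 * b.
  by rewrite /epos mulnDr; lia.
by rewrite ifF ?addnK //; lia.
Qed.

Lemma num_cat K a b so :
  num K (a + b) so = num K a so * 2 ^ (n.+1 * b) + num (K + a) b so.
Proof.
have lt2 := num_lt (K + a) b so; have lt1 := num_lt K a so.
pose i := num K a so * 2 ^ (n.+1 * b) + num (K + a) b so.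
have eqso : setnum K (a + b) i so = so by rewrite /i setnum_cat // !setnum_num.
rewrite -{1}eqso num_setnum // /i mulnDr expnD.
apply: (@leq_trans ((num K a so).+1 * 2 ^ (n.+1 * b))); first by rewrite [_.+1 * 2 ^ _]mulSn; lia.
by rewrite leq_mul2r lt1 orbT.
Qed.

Lemma num1_set0 K so : (num K 1 so == 0) = (so K == set0).
Proof.
apply/eqP/eqP => [n0|s0].
  apply/setP=> j; have := num_bit K so j (ltnSn 0).
  by rewrite addn0 n0 inE /bit div0n.
by apply: num_uniq; rewrite ?expn_gt0 // => -[] // j _; rewrite addn0 s0 inE /bit div0n.
Qed.

Lemma num1_setT K so : (num K 1 so == (2 ^ n.+1).-1) = (so K == setT).
Proof.
have bitT e : e < n.+1 -> bit (2 ^ n.+1).-1 e.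
  by move=> lte; have := @bit_compl n.+1 0 e; rewrite subn0 expn_gt0 => -> //; rewrite /bit div0n.
have lte (j : 'I_n.+1) : epos n 1 0 j < n.+1.
  by have := epos_lt (ltnSn 0) (ltn_ord j); rewrite muln1.
apply/eqP/eqP => [nT|sT].
  apply/setP=> j; have := num_bit K so j (ltnSn 0).
  by rewrite addn0 nT inE bitT.
apply: num_uniq; first by rewrite muln1; have := expn_gt0 2 n.+1; lia.
by case=> // j _; rewrite addn0 sT inE bitT.
Qed.

End Blocks.

(** * Words definable by first-order formulas *)

Lemma map_iota_mul (T : Type) (f : nat -> T) a b :
  [seq f i | i <- iota 0 (a * b)]
  = flatten [seq [seq f (i * b + j) | j <- iota 0 b] | i <- iota 0 a].
Proof.
elim: a => [|a IH] //; rewrite mulSnr iotaD map_cat IH -addn1 iotaD map_cat flatten_cat /= cats0 add0n.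
congr cat; rewrite -{1}[a * b]addn0 iotaDl -map_comp.
by apply: eq_map.
Qed.

Lemma flatten_iota1 (T : Type) (f : nat -> seq T) c n : c < n ->
  (forall i, i < n -> i != c -> f i = [::]) ->
  flatten [seq f i | i <- iota 0 n] = f c.
Proof.
move=> ltcn f0.
have nil0 m1 m2 : (forall i, m1 <= i < m1 + m2 -> f i = [::]) ->
    flatten [seq f i | i <- iota m1 m2] = [::].
  elim: m2 m1 => [|m2 IH] m1 // fn; rewrite /= IH ?fn //; first by lia.
  by move=> i ini; apply: fn; lia.
rewrite -(subnKC (ltnW ltcn)) iotaD map_cat flatten_cat nil0; last by move=> i ini; apply: f0; lia.
have -> : n - c = (n - c.+1).+1 by lia.
rewrite /= add0n nil0 ?cats0 //.
by move=> i ini; apply: f0; lia.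
Qed.

Section Definability.
Variable s : nat.

(** The first-order assignment is part of the structure, so words may depend on it freely; only the
    set variables are tracked as parameters. *)
Record str := Str {
  sn : nat;
  sw : 'I_sn.+1 -> 'I_s;
  sfo : nat -> 'I_sn.+1
}.

Notation sets A := (nat -> {set 'I_(sn A).+1}).

Definition ssat (A : str) (so : sets A) (p : formula s) : bool :=
  sat (@sw A) p (@sfo A) so.

Definition cap (A : str) (k : nat) : nat := 2 ^ ((sn A).+1 * k).

Lemma cap_gt0 A k : 0 < cap A k. Proof. by rewrite expn_gt0. Qed.

Lemma capD A a b : cap A (a + b) = cap A a * cap A b.
Proof. by rewrite /cap mulnDr expnD. Qed.

Lemma cap1 A : cap A 1 = 2 ^ (sn A).+1. Proof. by rewrite /cap muln1. Qed.

Definition agree (A : str) (K : nat) (so so' : sets A) : Prop :=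
  forall X, X < K -> so X = so' X.

Definition dep (T : Type) (K : nat) (F : forall A : str, sets A -> T) : Prop :=
  forall A so so', agree K so so' -> F A so = F A so'.

Lemma agree_setnum (A : str) K k i (so so' : sets A) :
  agree K so so' -> agree (K + k) (setnum K k i so) (setnum K k i so').
Proof. by move=> eqs X ltX; rewrite !setnumE; case: ifP => // out; apply: eqs; lia. Qed.

Lemma agree_setnumr (A : str) K K' k i (so : sets A) : K <= K' ->
  agree K (setnum K' k i so) so.
Proof. by move=> leK X ltX; rewrite setnum_out //; lia. Qed.

(** Meant for first-order formulas, where no set quantifier can capture a renamed variable. *)
Fixpoint sren (f : nat -> nat) (p : formula s) : formula s :=
  match p with
  | FIn X t => FIn s (f X) t
  | FNot p => FNot (sren f p)
  | FAnd p q => FAnd (sren f p) (sren f q)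
  | FOr p q => FOr (sren f p) (sren f q)
  | FEx x p => FEx x (sren f p)
  | FAll x p => FAll x (sren f p)
  | _ => p
  end.

Lemma sren_FO f p : is_FO p -> is_FO (sren f p).
Proof. by elim: p => //= p IHp q IHq /andP[/IHp -> /IHq ->]. Qed.

Lemma sat_sren n (w : 'I_n.+1 -> 'I_s) f p fo so : is_FO p ->
  sat w (sren f p) fo so = sat w p fo (so \o f).
Proof.
elim: p fo => //=.
- by move=> p IH fo FOp; rewrite IH.
- by move=> p IHp q IHq fo /andP[FOp FOq]; rewrite IHp // IHq.
- by move=> p IHp q IHq fo /andP[FOp FOq]; rewrite IHp // IHq.
- by move=> x p IH fo FOp; apply: eq_existsb => v; rewrite IH.
- by move=> x p IH fo FOp; apply: eq_forallb => v; rewrite IH.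
Qed.

Definition FOdef (K : nat) (D : forall A : str, sets A -> Prop) : Prop :=
  exists p, [/\ is_FO p, dep K (fun A so => ssat so p) &
                forall A so, @ssat A so p <-> D A so].

Section Words.
Variable L : Type.
Implicit Types (lf : seq (L * formula s)) (W : forall A : str, sets A -> seq L).

(** At most one letter, that of the first true formula, as in the semantics of the quantifier; the
    empty list is a blank. *)
Definition letter lf (A : str) (so : sets A) : seq L :=
  take 1 [seq x.1 | x <- lf & ssat so x.2].

Definition wordf K k lf (A : str) (so : sets A) : seq L :=
  flatten [seq letter lf (setnum K k i so) | i <- iota 0 (cap A k)].

(* Set variables below [K] are parameters of the word; [K], ..., [K + k - 1] are the ones quantified by the letters' positions.
   Positions where no formula of the decision list [lf] holds contribute nothing. *)
Definition defwk (K k : nat) W : Prop :=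
  exists lf, [/\ all (fun x => is_FO x.2) lf, dep (K + k) (letter lf) &
                 forall A so, W A so = wordf K k lf so].

Definition defw K W : Prop := exists k, defwk K k W.

Lemma dep_wordf K k lf : dep (K + k) (letter lf) -> dep K (@wordf K k lf).
Proof.
move=> dl A so so' eqs; congr flatten; apply: eq_map => i.
by apply: dl; apply: agree_setnum.
Qed.

Lemma defw_dep K W : defw K W -> dep K W.
Proof.
by move=> [k [lf [_ dl eqW]]] A so so' eqs; rewrite !eqW; apply: dep_wordf eqs.
Qed.

Lemma defw_ext K W W' : (forall A so, W A so = W' A so) -> defw K W -> defw K W'.
Proof. by move=> eqW [k [lf [? ? eqf]]]; exists k, lf; split=> // A so; rewrite -eqW. Qed.

Lemma letter_map (f : formula s -> formula s) lf A so (b : bool) so' :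
  (forall x, List.In x lf -> @ssat A so (f x.2) = b && @ssat A so' x.2) ->
  letter [seq (x.1, f x.2) | x <- lf] so = if b then letter lf so' else [::].
Proof.
move=> eqf; rewrite /letter.
suff -> : [seq x.1 | x <- [seq (x.1, f x.2) | x <- lf] & ssat so x.2]
    = if b then [seq x.1 | x <- lf & @ssat A so' x.2] else [::] by case: (b).
elim: lf eqf => [|x lf IH] eqf; first by case: (b).
rewrite /= eqf; last by left.
have := IH (fun y iny => eqf y (or_intror iny)).
by case: (b) => /= eqx; first case: ifP => _; rewrite /= eqx.
Qed.

Lemma all_In (T : Type) (a : pred T) (l : seq T) x : all a l -> List.In x l -> a x.
Proof. by elim: l => //= y l IH /andP[ay al] [<-|/IH]//; apply. Qed.

Lemma defwk_ren K k K' W (f : nat -> nat) : (forall X, X < K -> f X < K') ->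
  defwk K k W -> defwk K' k (fun A so => W A (so \o f)).
Proof.
move=> fK [lf [FOl dl eqW]].
(* Parameters follow [f], and the loop block moves from [K] to [K']. *)
pose g X := if X < K then f X else X - K + K'.
have eql A so : letter [seq (x.1, sren g x.2) | x <- lf] so = letter lf (so \o g : sets A).
  apply: (@letter_map (sren g) lf A so true) => x inx.
  by rewrite /ssat sat_sren //; exact: (all_In FOl inx).
exists [seq (x.1, sren g x.2) | x <- lf]; split.
- by rewrite all_map; apply: sub_all FOl => x; apply: sren_FO.
- move=> A so so' eqs; rewrite !eql; apply: dl => X ltX /=; apply: eqs.
  by rewrite /g; case: ifP => [/fK|]; lia.
- move=> A so; rewrite eqW; congr flatten; apply: eq_map => i.
  rewrite eql; apply: dl => X ltX; rewrite /= !setnumE /g.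
  have [ltXK|leKX] := ltnP X K.
    by have := fK _ ltXK => ltf; rewrite !ifF //; lia.
  rewrite ltX ifT; last by lia.
  by apply/setP=> j; rewrite !inE; do 2!f_equal; lia.
Qed.

Lemma defw_ren K K' W (f : nat -> nat) : (forall X, X < K -> f X < K') ->
  defw K W -> defw K' (fun A so => W A (so \o f)).
Proof. by move=> fK [k dW]; exists k; apply: defwk_ren dW. Qed.

Lemma defw_leq K K' W : K <= K' -> defw K W -> defw K' W.
Proof.
by move=> leK /(@defw_ren K K' W id); apply=> X; lia.
Qed.

(** The [r] variables become the most significant part of the loop block of the word. *)
Lemma defwk_loop K r k W : defwk (K + r) k W ->
  defwk K (r + k) (fun A so => flatten [seq W A (setnum K r i so) | i <- iota 0 (cap A r)]).
Proof.
move=> [lf [FOl dl eqW]]; exists lf; split=> //; first by rewrite addnA.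
move=> A so; rewrite /wordf capD map_iota_mul.
set F := fun i => [seq _ | j <- _].
have -> : flatten (flatten [seq F i | i <- iota 0 (cap A r)])
   = flatten [seq flatten (F i) | i <- iota 0 (cap A r)].
  by elim: (iota 0 _) => //= i l IH; rewrite flatten_cat IH.
congr flatten; apply: eq_map => i; rewrite eqW /F; congr flatten.
apply/eq_in_map => j; rewrite mem_iota => /andP[_ ltj].
by rewrite setnum_cat.
Qed.

Lemma defw_loop K r W : defw (K + r) W ->
  defw K (fun A so => flatten [seq W A (setnum K r i so) | i <- iota 0 (cap A r)]).
Proof. by move=> [k dW]; exists (r + k); apply: defwk_loop. Qed.

Definition Fempty (X : nat) : formula s := FAll 0 (FNot (FIn s X (TVar 0))).
Definition Ffull (X : nat) : formula s := FAll 0 (FIn s X (TVar 0)).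

Lemma sat_Fempty A so X : @ssat A so (Fempty X) = (so X == set0).
Proof.
apply/forallP/eqP => [H|-> j]; last by rewrite inE.
by apply/setP=> j; have /negbTE := H j; rewrite inE.
Qed.

Lemma sat_Ffull A so X : @ssat A so (Ffull X) = (so X == setT).
Proof.
apply/forallP/eqP => [H|-> j]; last by rewrite inE.
by apply/setP=> j; rewrite inE; apply: H.
Qed.

(** The new variable is the innermost one and is required to be empty, so every old letter occurs
    once, followed by blanks. *)
Lemma defwk_pad K k W : defwk K k W -> defwk K k.+1 W.
Proof.
move=> [lf [FOl dl eqW]].
pose f p : formula s := FAnd (Fempty (K + k)) p.
have eql A so : letter [seq (x.1, f x.2) | x <- lf] so
    = if so (K + k) == set0 then letter lf (so : sets A) else [::].
  by apply: letter_map => x _; rewrite -sat_Fempty.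
exists [seq (x.1, f x.2) | x <- lf]; split.
- by rewrite all_map; apply: sub_all FOl => x /= ->.
- move=> A so so' eqs; rewrite !eql eqs; last by lia.
  by rewrite (dl A so so') // => X ltX; apply: eqs; lia.
move=> A so; rewrite eqW /wordf -addn1 capD map_iota_mul.
set F := fun i => [seq _ | j <- _].
have -> : flatten (flatten [seq F i | i <- iota 0 (cap A k)])
   = flatten [seq flatten (F i) | i <- iota 0 (cap A k)].
  by elim: (iota 0 _) => //= i l IH; rewrite flatten_cat IH.
congr flatten; apply: eq_map => i; rewrite /F.
rewrite (@flatten_iota1 _ _ 0) ?cap_gt0 //.
- rewrite setnum_cat ?cap_gt0 // eql.
  rewrite -num1_set0 num_setnum ?cap_gt0 //=.
  by apply: dl => X ltX; rewrite [RHS]setnum_out //; lia.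
- move=> j ltj nzj; rewrite setnum_cat // eql -num1_set0 num_setnum //.
  by rewrite (negbTE nzj).
Qed.

Lemma defwk_leq K k k' W : k <= k' -> defwk K k W -> defwk K k' W.
Proof.
by move=> /subnKC <-; elim: (_ - k) => [|d IH] dW; rewrite ?addn0 // addnS; apply/defwk_pad/IH.
Qed.

Lemma letter_cat lf1 lf2 A so : @letter (lf1 ++ lf2) A so =
  if @letter lf1 A so is [::] then letter lf2 so else letter lf1 so.
Proof.
rewrite /letter filter_cat map_cat.
by case: [seq x.1 | x <- lf1 & _] => //= x l; rewrite !take0.
Qed.

(* A new outermost variable selects the summand: its first value is the empty set, its last one the full set. *)
Lemma defw_cat K W1 W2 : defw K W1 -> defw K W2 ->
  defw K (fun A so => W1 A so ++ W2 A so).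
Proof.
move=> dW1 dW2; have dep1 := defw_dep dW1; have dep2 := defw_dep dW2.
have [k1 dk1] := defw_leq (leq_addr 1 K) dW1.
have [k2 dk2] := defw_leq (leq_addr 1 K) dW2.
have {dk1} [lf1 [FO1 dl1 eqW1]] := defwk_leq (leq_maxl k1 k2) dk1.
have {dk2} [lf2 [FO2 dl2 eqW2]] := defwk_leq (leq_maxr k1 k2) dk2.
set k := maxn k1 k2 in dl1 eqW1 dl2 eqW2.
pose W A (so : sets A) := if so K == set0 then W1 A so
  else if so K == setT then W2 A so else [::].
have dW : defwk (K + 1) k W.
  pose lf := [seq (x.1, FAnd (Fempty K) x.2) | x <- lf1] ++
             [seq (x.1, FAnd (Ffull K) x.2) | x <- lf2].
  have neT A : [set: 'I_(sn A).+1] != set0 by apply/set0Pn; exists ord0.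
  have eql A (so : sets A) : letter lf so = if so K == set0 then letter lf1 so
      else if so K == setT then letter lf2 so else [::].
    rewrite letter_cat.
    rewrite (@letter_map _ lf1 _ _ (so K == set0) so) => [|x _]; last by rewrite -sat_Fempty.
    rewrite (@letter_map _ lf2 _ _ (so K == setT) so) => [|x _]; last by rewrite -sat_Ffull.
    case: eqP => [->|//]; rewrite eq_sym (negbTE (neT A)).
    by case: (letter lf1 so).
  exists lf; split.
  - by rewrite all_cat !all_map; apply/andP; split; [apply: sub_all FO1 | apply: sub_all FO2] => x /= ->.
  - move=> A so so' eqs; rewrite !eql eqs; last by lia.
    by rewrite (dl1 A so so') // (dl2 A so so').
  - move=> A so; rewrite /W eqW1 eqW2 /wordf.
    under [in RHS]eq_map => i.
      rewrite eql setnum_out; last by lia.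
      over.
    case: eqP => [//|_]; case: eqP => [//|_].
    by elim: (iota 0 _).
apply: defw_ext (defw_loop (ex_intro _ k dW)) => A so.
(* [cap A 1] is at least 2, so the first and the last value differ and the range splits into first,
   middle and last. *)
have capE : cap A 1 = ((cap A 1).-2 + 1).+1.
  by have : 2 ^ 1 <= cap A 1 by [rewrite /cap leq_exp2l // muln1]; rewrite expn1; lia.
have -> : iota 0 (cap A 1) = 0 :: iota 1 (cap A 1).-2 ++ [:: (cap A 1).-1].
  rewrite {1}capE -[_.+1]add1n iotaD /= iotaD; congr (_ :: _ ++ [:: _]); lia.
rewrite map_cons map_cat /= flatten_cat /= cats0.
have Wi i : i < cap A 1 -> W A (setnum K 1 i so) =
    if i == 0 then W1 A so else if i == (cap A 1).-1 then W2 A so else [::].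
  move=> lti; rewrite /W -num1_set0 -num1_setT num_setnum // cap1.
  have ag : agree K (setnum K 1 i so) so by apply: agree_setnumr.
  by rewrite (dep1 _ _ _ ag) (dep2 _ _ _ ag).
rewrite Wi ?cap_gt0 //= Wi; last by lia.
rewrite ifF; last by lia.
rewrite ifT; last by apply/eqP; lia.
congr cat; rewrite -[RHS]cat0s; congr cat.
set l := iota 1 _; have : all (fun i => 0 < i < (cap A 1).-1) l.
  by apply/allP=> i; rewrite mem_iota; lia.
elim: l => //= i l IH /andP[ini /IH ->]; rewrite Wi ?ifF //; lia.
Qed.

Lemma defw_letter K D a : FOdef K D ->
  exists2 p, (forall A so, @ssat A so p <-> D A so) &
             defw K (fun A so => if ssat so p then [:: a] else [::]).
Proof.
move=> [p [FOp dp eqp]]; exists p => //; exists 0, [:: (a, p)]; split; first by rewrite /= FOp.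
  by move=> A so so'; rewrite addn0 /letter /= => /dp ->.
move=> A so; rewrite /wordf /cap muln0 /= cats0 /letter /=.
have -> : setnum K 0 0 so = so by apply: functional_extensionality => X; rewrite setnum_out //; lia.
by case: ifP.
Qed.

Lemma defw_nil K : defw K (fun A so => [::]).
Proof.
exists 0, [::]; split=> // A so; rewrite /wordf.
by elim: (iota _ _).
Qed.

Lemma defw_letter1 K a : defw K (fun A so => [:: a]).
Proof.
have [|p pE dW] := @defw_letter K (fun _ _ => True) a.
  by exists (FEq s TMin TMin); split=> // A so; rewrite /ssat /= eqxx.
by apply: defw_ext dW => A so; rewrite (proj2 (pE _ _)).
Qed.

Lemma defw_cst K w : defw K (fun A so => w).
Proof.
elim: w => [|a w IH]; first exact: defw_nil.
exact: (defw_cat (defw_letter1 K a) IH).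
Qed.

End Words.

Lemma defw_map (L L' : Type) (f : L -> L') K W :
  defw K W -> defw K (fun A so => map f (W A so)).
Proof.
move=> [k [lf [FOl dl eqW]]].
have eql A so : letter [seq (f x.1, x.2) | x <- lf] so = map f (letter lf (so : sets A)).
  by rewrite /letter map_take filter_map -!map_comp.
exists k, [seq (f x.1, x.2) | x <- lf]; split; first by rewrite all_map.
  by move=> A so so' eqs; rewrite !eql (dl _ _ _ eqs).
move=> A so; rewrite eqW /wordf map_flatten -map_comp; congr flatten.
by apply: eq_map => i /=; rewrite eql.
Qed.

End Definability.

Notation sets A := (nat -> {set 'I_(sn A).+1}).

(** * Grammars, and a Dyck language with optional blocks and oracle words *)

(** Chomsky normal form: terminal rules [glex], binary rules [grule], start symbols [gst]. Only the
    nonterminals need to be finite, as sets of them become groupoid elements; letters may form any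
    type. *)
Record cfg := Cfg {
  gL : Type;
  gV : finType;
  glex : gV -> gL -> bool;
  grule : gV -> gV -> gV -> bool;
  gst : pred gV
}.

Inductive der (g : cfg) : gV g -> seq (gL g) -> Prop :=
| der_lex X a : glex X a -> der X [:: a]
| der_rule X Y Z u v : grule X Y Z -> der Y u -> der Z v -> der X (u ++ v).

Definition lang (g : cfg) (w : seq (gL g)) : Prop := exists2 X, gst X & der X w.

Section Sum.
Variables g1 g2 : cfg.

(** Disjoint union over disjoint alphabets. The oracle brackets below refer to a single grammar, so
    conditions with different grammars must first be brought together. *)
Definition gsum : cfg := {|
  gL := (gL g1 + gL g2)%type;
  gV := (gV g1 + gV g2)%type;
  glex X a := match X, a with
    | inl X, inl a => glex X a | inr X, inr a => glex X a | _, _ => false end;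
  grule X Y Z := match X, Y, Z with
    | inl X, inl Y, inl Z => grule X Y Z
    | inr X, inr Y, inr Z => grule X Y Z
    | _, _, _ => false end;
  gst X := match X with inl X => gst X | inr X => gst X end |}.

Lemma der_sum (X : gV gsum) (u : seq (gL gsum)) : der X u ->
  match X with
  | inl Y => exists2 v, u = map inl v & der Y v
  | inr Y => exists2 v, u = map inr v & der Y v
  end.
Proof.
elim=> {X u}.
  case=> X [] a //= lexX; exists [:: a] => //; exact: der_lex.
move=> [] X [] Y [] Z u v //= rXYZ _ [u' -> dY] _ [v' -> dZ];
  by exists (u' ++ v'); rewrite ?map_cat //; apply: der_rule dY dZ.
Qed.

Lemma der_suml X u : @der g1 X u -> @der gsum (inl X) (map inl u).
Proof.
elim=> {X u} [X a lexX|X Y Z u v rXYZ _ IHY _ IHZ]; first exact: der_lex.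
by rewrite map_cat; apply: der_rule IHY IHZ.
Qed.

Lemma der_sumr X u : @der g2 X u -> @der gsum (inr X) (map inr u).
Proof.
elim=> {X u} [X a lexX|X Y Z u v rXYZ _ IHY _ IHZ]; first exact: der_lex.
by rewrite map_cat; apply: der_rule IHY IHZ.
Qed.

Lemma der_nonnil (g : cfg) X u : @der g X u -> u <> [::].
Proof. by elim=> // {X}X Y Z {}u v _ _ + _ _; case: u. Qed.

Lemma lang_suml u : @lang gsum (map inl u) <-> @lang g1 u.
Proof.
split=> [[[] X stX dX]|[X stX dX]]; last by exists (inl X) => //; apply: der_suml.
- have [v eqv dv] := der_sum dX; exists X => //.
  by have -> : u = v by apply: inj_map eqv => x y [].
- have [v eqv dv] := der_sum dX.
  by have := der_nonnil dX; case: u v eqv {dX dv} => [|x u] [|y v].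
Qed.

Lemma lang_sumr u : @lang gsum (map inr u) <-> @lang g2 u.
Proof.
split=> [[[] X stX dX]|[X stX dX]]; last by exists (inr X) => //; apply: der_sumr.
- have [v eqv dv] := der_sum dX.
  by have := der_nonnil dX; case: u v eqv {dX dv} => [|x u] [|y v].
- have [v eqv dv] := der_sum dX; exists X => //.
  by have -> : u = v by apply: inj_map eqv => x y [].
Qed.

End Sum.

(* Besides stack operations: brackets [Br true] ... [Br false] of a block that may be skipped,
   and brackets [Orc true] ... [Orc false] around a word that must belong to the given language. *)
Inductive blet := Push of bool | Pop of bool | Br of bool | Orc of bool.

(* [ND]: no net effect on the stack; [NY b]: pops [b]; [NP b]: pushes [b]; [NSk]: the rest of a skipped block;
   [NNB]: any letter but a block bracket; [NOY]: the rest of an oracle word; the others are single letters. *)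
Inductive bnt := ND | NY of bool | NP of bool | NLB | NSk | NNB | NLT | NGT | NOY.

Definition bnt_enc (x : bnt) : 'I_9 * bool :=
  match x with
  | ND => (inord 0, true) | NY b => (inord 1, b) | NP b => (inord 2, b)
  | NLB => (inord 3, true) | NSk => (inord 4, true) | NNB => (inord 5, true)
  | NLT => (inord 6, true) | NGT => (inord 7, true) | NOY => (inord 8, true)
  end.

Definition bnt_dec (x : 'I_9 * bool) : bnt :=
  match val x.1 with
  | 0 => ND | 1 => NY x.2 | 2 => NP x.2 | 3 => NLB | 4 => NSk | 5 => NNB
  | 6 => NLT | 7 => NGT | _ => NOY
  end.

Lemma bnt_encK : cancel bnt_enc bnt_dec.
Proof. by case=> * ; rewrite /bnt_dec /= inordK. Qed.

HB.instance Definition _ := Finite.copy bnt (can_type bnt_encK).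

Section Ext.
Variable g : cfg.
Notation L' := (gL g + blet)%type.

(** [ND] derives a lone block bracket, so the brackets of an entered block have no effect. [NNB]
    derives no block bracket, so a skip stops at the first closing one. *)
Definition gext : cfg := {|
  gL := L';
  gV := (gV g + bnt)%type;
  glex X a := match X, a with
    | inl X, inl a => glex X a
    | inr ND, inr (Br _) => true
    | inr (NY b), inr (Pop c) => b == c
    | inr (NP b), inr (Push c) => b == c
    | inr NLB, inr (Br true) => true
    | inr NSk, inr (Br false) => true
    | inr NNB, inr (Br _) => false
    | inr NNB, _ => true
    | inr NLT, inr (Orc true) => true
    | inr NGT, inr (Orc false) => true
    | _, _ => false
    end;
  grule X Y Z := match X, Y, Z with
    | inl X, inl Y, inl Z => grule X Y Z
    | inr ND, inr ND, inr ND => true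
    | inr ND, inr (NP b), inr (NY c) => b == c
    | inr (NY b), inr ND, inr (NY c) => b == c
    | inr ND, inr NLB, inr NSk => true
    | inr NSk, inr NNB, inr NSk => true
    | inr ND, inr NLT, inr NOY => true
    | inr NOY, inl X, inr NGT => gst X
    | _, _, _ => false
    end;
  gst X := match X with inr ND => true | _ => false end |}.

Definition nobr (a : L') : bool := if a is inr (Br _) then false else true.

(** A nondeterministic pushdown automaton for the same language, with the stack before and after. At
    an opening bracket it enters the block or jumps behind it; an oracle word is read in one
    step. *)
Inductive run : seq L' -> seq bool -> seq bool -> Prop :=
| run_nil st : run [::] st st
| run_push b u st st' : run u (b :: st) st' -> run (inr (Push b) :: u) st st'
| run_pop b u st st' : run u st st' -> run (inr (Pop b) :: u) (b :: st) st'
| run_br b u st st' : run u st st' -> run (inr (Br b) :: u) st st'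
| run_skip x u st st' : all nobr x -> run u st st' ->
    run (inr (Br true) :: x ++ inr (Br false) :: u) st st'
| run_orc c u st st' : lang c -> run u st st' ->
    run (inr (Orc true) :: map inl c ++ inr (Orc false) :: u) st st'.

Lemma run_cat u v st1 st2 st3 : run u st1 st2 -> run v st2 st3 -> run (u ++ v) st1 st3.
Proof.
move=> ru; elim: ru v st3 => {u st1 st2} //=
  [b u st st' _ IH|b u st st' _ IH|b u st st' _ IH|x u st st' nx _ IH|c u st st' lc _ IH] v st3 rv.
- exact/run_push/IH.
- exact/run_pop/IH.
- exact/run_br/IH.
- by rewrite -catA; apply: run_skip (IH _ _ rv).
- by rewrite -catA; apply: run_orc (IH _ _ rv).
Qed.

(** The soundness invariant of each nonterminal. Runs are asked for over every stack below, so that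
    they can be composed. *)
Definition sem (X : gV gext) (u : seq L') : Prop :=
  match X with
  | inl X => exists2 c, u = map inl c & der X c
  | inr ND => forall st, run u st st
  | inr (NY b) => forall st, run u (b :: st) st
  | inr (NP b) => u = [:: inr (Push b)]
  | inr NLB => u = [:: inr (Br true)]
  | inr NSk => exists2 x, u = x ++ [:: inr (Br false)] & all nobr x
  | inr NNB => exists2 a, u = [:: a] & nobr a
  | inr NLT => u = [:: inr (Orc true)]
  | inr NGT => u = [:: inr (Orc false)]
  | inr NOY => exists2 c, u = map inl c ++ [:: inr (Orc false)] & lang c
  end.

Lemma der_sem X u : @der gext X u -> sem X u.
Proof.
elim=> {X u}.
- case=> [X|[|b|b||||||]] [a|[c|c|c|c]] //=; try by case: c.
  + by move=> lexX; exists [:: a] => //; apply: der_lex.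
  + by move=> _ st; apply/run_br/run_nil.
  + by move=> /eqP <- st; apply/run_pop/run_nil.
  + by move=> /eqP <-.
  + by case: c => // _; exists [::].
  + by move=> _; exists (inl a).
  + by move=> _; exists (inr (Push c)).
  + by move=> _; exists (inr (Pop c)).
  + by move=> _; exists (inr (Orc c)).
- case=> [X|[|b|b||||||]] [Y|[|c|c||||||]] [Z|[|d|d||||||]] //= u v.
  + move=> rXYZ _ [cu -> dY] _ [cv -> dZ]; exists (cu ++ cv); rewrite ?map_cat //.
    exact: der_rule dY dZ.
  + by move=> _ _ ru _ rv st; apply: run_cat (ru st) (rv st).
  + by move=> /eqP <- _ -> _ rv st; apply/run_push/rv.
  + move=> _ _ -> _ [x -> nx] st; rewrite /= -[x ++ _]cats0 -catA.
    exact/run_skip/run_nil.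
  + move=> _ _ -> _ [x -> lx] st; rewrite /= -[_ ++ _]cats0 -catA.
    exact/run_orc/run_nil.
  + by move=> /eqP <- _ ru _ rv st; apply: run_cat (ru _) (rv st).
  + by move=> _ _ [a -> na] _ [x -> nx]; exists (a :: x) => //=; rewrite na.
  + move=> stX _ [c -> dY] _ ->; exists c => //; by exists Y.
Qed.

Lemma der_inl X u : @der g X u -> @der gext (inl X) (map inl u).
Proof.
elim=> {X u} [X a lexX|X Y Z u v rXYZ _ IHY _ IHZ]; first exact: der_lex.
by rewrite map_cat; apply: der_rule IHY IHZ.
Qed.

(* A run emptying the stack [b1 :: b2 :: ...] splits into segments, the i-th of which ends by popping [bi]. *)
Fixpoint pops (st : seq bool) (u : seq L') : Prop :=
  match st with
  | [::] => u = [::] \/ @der gext (inr ND) u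
  | b :: st' => exists u1 u2, [/\ u = u1 ++ u2, @der gext (inr (NY b)) u1 & pops st' u2]
  end.

Lemma pops_ND st d u : @der gext (inr ND) d -> pops st u -> pops st (d ++ u).
Proof.
case: st => [|b st] /= dd.
  by case=> [->|du]; right; rewrite ?cats0 //; apply: (der_rule _ dd du).
case=> u1 [u2 [-> d1 d2]]; exists (d ++ u1), u2; split; rewrite ?catA //.
by apply: der_rule dd d1; rewrite /= eqxx.
Qed.

(** Induction on the run: a pushed symbol pairs with the segment popping it to form a word of [ND],
    and words of [ND] are absorbed by the segment that follows. *)
Lemma run_pops u st st' : run u st st' -> st' = [::] -> pops st u.
Proof.
elim=> {u st st'} [st|b u st st' _ IH|b u st st' _ IH|b u st st' _ IH|x u st st' nx _ IH|c u st st' lc _ IH] eq0.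
- by rewrite eq0; left.
- have [u1 [u2 [-> d1 d2]]] := IH eq0.
  rewrite -cat_cons; apply: pops_ND d2.
  by rewrite -cat1s; apply: (@der_rule gext _ (inr (NP b)) (inr (NY b))) d1; rewrite /= ?eqxx //;
     apply: der_lex => /=.
- exists [:: inr (Pop b)], u; split; [by [] | by apply: der_lex => /= | exact: IH].
- by rewrite -cat1s; apply: pops_ND (IH eq0); apply: der_lex.
- rewrite -[_ :: u]cat1s catA -cat_cons; apply: pops_ND (IH eq0).
  rewrite -cat1s; apply: (@der_rule gext _ (inr NLB) (inr NSk)) => //; first exact: der_lex.
  elim: x nx => [_|a x IHx /= /andP[na /IHx dx]]; first exact: der_lex.
  rewrite -cat1s; apply: (@der_rule gext _ (inr NNB) (inr NSk)) => //.
  by apply: der_lex; case: a na => // -[].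
- rewrite -[_ :: u]cat1s catA -cat_cons; apply: pops_ND (IH eq0).
  rewrite -cat1s; apply: (@der_rule gext _ (inr NLT) (inr NOY)) => //; first exact: der_lex.
  case: lc => X stX dX; apply: (@der_rule gext _ (inl X) (inr NGT)) => //; first exact: der_inl.
  exact: der_lex.
Qed.

Lemma lang_run u : u <> [::] -> @lang gext u <-> run u [::] [::].
Proof.
move=> nz; split=> [[[//|[]] //= _ /der_sem/(_ [::])]//|/run_pops/(_ erefl)[//|du]].
by exists (inr ND).
Qed.

Lemma run_inv u st st' : run u st st' ->
  match u with
  | [::] => st = st'
  | inl _ :: _ => False
  | inr (Push b) :: u' => run u' (b :: st) st'
  | inr (Pop b) :: u' => exists2 st1, st = b :: st1 & run u' st1 st'
  | inr (Br b) :: u' => run u' st st' \/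
      exists x u1, [/\ b, u' = x ++ inr (Br false) :: u1, all nobr x & run u1 st st']
  | inr (Orc b) :: u' => exists c u1, [/\ b, u' = map inl c ++ inr (Orc false) :: u1, lang c & run u1 st st']
  end.
Proof.
case=> {u st st'} [st|b u st st'|b u st st' ru|b u st st'|x u st st'|c u st st'] //=.
- by exists st.
- by left.
- by right; exists x, u.
- by exists c, u.
Qed.

End Ext.

(** * Horn clauses as words *)

(* Leftmost derivations of a list of goals; a body is pushed from left to right, so its last element is treated first. *)
Inductive hders (rule : nat -> seq nat -> Prop) : nat -> seq nat -> Prop :=
| hders_nil : hders rule 0 [::]
| hders_cons t x ys xs : rule x ys -> hders rule t (catrev ys xs) ->
    hders rule t.+1 (x :: xs).

Lemma hders_inv rule t x xs : hders rule t (x :: xs) ->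
  exists ys t', [/\ t = t'.+1, rule x ys & hders rule t' (catrev ys xs)].
Proof.
move: {-1}(x :: xs) (erefl (x :: xs)) => xs0 eqx h.
case: h eqx => // t' x' ys xs' rx ht [eqx eqxs]; exists ys, t'; split=> //.
  by rewrite eqx.
by rewrite eqxs.
Qed.

Section Pieces.
Variable g : cfg.
Notation L' := (gL g + blet)%type.
Notation run := (@run g).

(* Stack symbol [true] is the bottom marker of an item, followed by the item in unary. *)
Definition pushw (x : nat) : seq L' := inr (Push true) :: nseq x (inr (Push false)).
Definition popw (x : nat) : seq L' := nseq x (inr (Pop false)) ++ [:: inr (Pop true)].
Definition condw (c : seq (gL g)) : seq L' :=
  inr (Orc true) :: map inl c ++ [:: inr (Orc false)].

(** An instance of a clause: its head, the words that must belong to the language, and its body. *)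
Definition piece := (nat * seq (seq (gL g)) * seq nat)%type.
Implicit Type p : piece.

Definition piecew p : seq L' :=
  inr (Br true) :: popw p.1.1 ++ flatten (map condw p.1.2) ++
  flatten (map pushw p.2) ++ [:: inr (Br false)].

Definition prule (ps : seq piece) (x : nat) (ys : seq nat) : Prop :=
  exists2 cs, List.In (x, cs, ys) ps & forall c, List.In c cs -> lang c.

Definition enc (xs : seq nat) : seq bool := flatten [seq nseq x false ++ [:: true] | x <- xs].

Lemma nseq_cons_cat (T : Type) (a : T) x s : nseq x a ++ a :: s = nseq x.+1 a ++ s.
Proof. by elim: x => //= x ->. Qed.

Lemma run_pushw x u st st' : run (pushw x ++ u) st st' <-> run u (nseq x false ++ true :: st) st'.
Proof.
have pushn y st1 : run (nseq y (inr (Push false)) ++ u) st1 st' <-> run u (nseq y false ++ st1) st'.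
  elim: y st1 => //= y IH st1; rewrite -[false :: _](nseq_cons_cat _ y) -IH.
  by split=> [/run_inv|]; last exact: run_push.
rewrite -pushn; split=> [/run_inv//|]; exact: run_push.
Qed.

Lemma run_pushws ys u xs st' :
  run (flatten (map pushw ys) ++ u) (enc xs) st' <-> run u (enc (catrev ys xs)) st'.
Proof.
elim: ys xs => //= y ys IH xs; rewrite -catA run_pushw -IH.
by rewrite /enc /= -catA.
Qed.

Lemma run_popw x u st st' : run (popw x ++ u) st st' <->
  exists2 st1, st = nseq x false ++ true :: st1 & run u st1 st'.
Proof.
elim: x st => [|x IH] st.
  split=> [/run_inv//|[st1 -> ru]]; exact: run_pop.
split=> [/run_inv[st1 -> /IH[st2 -> ru]]|[st1 -> ru]]; first by exists st2.
by apply: run_pop; apply/IH; exists st1.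
Qed.

(** The marker below each item makes the unary code self-delimiting, so popping [x] succeeds only if
    the top goal is exactly [x]. *)
Lemma enc_pop xs x st : enc xs = nseq x false ++ true :: st ->
  exists2 xs', xs = x :: xs' & st = enc xs'.
Proof.
case: xs => [|y xs]; first by case: x.
rewrite /enc /= -catA /= -/(enc xs) => eqs; exists xs; last first.
  by elim: y x eqs => [|y IH] [|x] //= [] // /IH.
by congr (_ :: xs); elim: y x eqs => [|y IH] [|x] //= [] // /IH ->.
Qed.

Lemma cat_inl_inj (T U : Type) (c c' : seq T) (b : U) r r' :
  map inl c ++ inr b :: r = map inl c' ++ inr b :: r' -> c = c' /\ r = r'.
Proof.
elim: c c' => [|a c IH] [|a' c'] //= []; first by move=> ->.
by move=> -> /IH[-> ->].
Qed.

(** Blocks do not nest: neither word has a block bracket before the displayed one, so a skip always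
    ends where its block does. *)
Lemma cat_nobr_inj (p x r r' : seq L') : all (@nobr g) p -> all (@nobr g) x ->
  p ++ inr (Br false) :: r = x ++ inr (Br false) :: r' -> r = r'.
Proof.
elim: p x => [|a p IH] [|b x] //=; first by move=> _ _ [].
- by move=> _ /andP[nb _] [eqb _]; rewrite -eqb in nb.
- by move=> /andP[nb _] _ [eqb _]; rewrite eqb in nb.
- by move=> /andP[_ np] /andP[_ nx] [_]; apply: IH.
Qed.

Lemma run_condws cs u st st' :
  run (flatten (map condw cs) ++ u) st st' <->
  (forall c, List.In c cs -> lang c) /\ run u st st'.
Proof.
elim: cs => [|c cs IH] /=; first by split=> [//|[]].
rewrite -!catA /=; split.
  move=> /run_inv[c' [u1 [_ eqc lc ru1]]]; have [eqc1 equ1] := cat_inl_inj eqc; subst c' u1.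
  have [lcs ru] := proj1 IH ru1.
  by split=> // d [<-|/lcs].
case=> lcs ru; apply: run_orc; first by apply: lcs; left.
by apply/IH; split=> // d ind; apply: lcs; right.
Qed.

Lemma all_nobr_piece p :
  all (@nobr g) (popw p.1.1 ++ flatten (map condw p.1.2) ++ flatten (map pushw p.2)).
Proof.
rewrite /popw !all_cat all_nseq orbT /=; apply/andP; split.
  elim: p.1.2 => //= c cs IH; rewrite !all_cat /= IH !andbT.
  by elim: c.
by elim: p.2 => //= y ys IH; rewrite all_cat all_nseq orbT.
Qed.

Lemma piecew_cat p u : piecew p ++ u =
  inr (Br true) :: popw p.1.1 ++ (flatten (map condw p.1.2) ++
  (flatten (map pushw p.2) ++ inr (Br false) :: u)).
Proof. by rewrite /piecew /= -!catA. Qed.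

(** A block offers one choice: leave the goals alone, or resolve the top goal with this clause after
    checking its conditions. *)
Lemma run_piece p u xs st' : run (piecew p ++ u) (enc xs) st' <->
  run u (enc xs) st' \/
  exists xs', [/\ xs = p.1.1 :: xs', forall c, List.In c p.1.2 -> lang c &
                  run u (enc (catrev p.2 xs')) st'].
Proof.
rewrite piecew_cat; split.
  move=> /run_inv[|[x [u1 [_ eqx nx ru]]]].
    move=> /run_popw[st1 /enc_pop[xs' -> ->]] /run_condws[lcs].
    (* The letter left over is the closing bracket, which cannot start a skip. *)
    rewrite run_pushws => /run_inv[ru|[x [u1 []]]//].
    by right; exists xs'.
  left; suff -> : u = u1 by [].
  apply: (@cat_nobr_inj _ _ _ _ (all_nobr_piece p) nx).
  by rewrite -eqx -!catA.
case=> [ru|[xs' [-> lcs ru]]].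
  have := run_skip (all_nobr_piece p) ru; by rewrite -!catA.
apply: run_br; apply/run_popw; exists (enc xs').
  by rewrite /enc /= -catA.
by apply/run_condws; split=> //; apply/run_pushws/run_br.
Qed.

Lemma run_hders ps ps0 xs : (forall p, List.In p ps -> List.In p ps0) ->
  run (flatten (map piecew ps)) (enc xs) [::] -> exists t, hders (prule ps0) t xs.
Proof.
elim: ps xs => [|p ps IH] xs sub.
  move=> /run_inv; case: xs => [_|x xs]; first by exists 0; apply: hders_nil.
  by case: x.
have subs q : List.In q ps -> List.In q ps0 by move=> inq; apply: sub; right.
move=> /run_piece[/IH|[xs' [-> lcs /IH]]]; first by apply.
case=> // t ht; exists t.+1; apply: hders_cons ht; exists p.1.2 => //.
by apply: sub; left; case: (p) => [[]].
Qed.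

Lemma run_skips ps u xs st' : run u (enc xs) st' ->
  run (flatten (map piecew ps) ++ u) (enc xs) st'.
Proof.
by elim: ps => //= p ps IH ru; rewrite -catA; apply/run_piece; left; apply: IH.
Qed.

Lemma hders_run ps t xs T : hders (prule ps) t xs -> t <= T ->
  run (flatten (map piecew (flatten (nseq T ps)))) (enc xs) [::].
Proof.
move=> ht; elim: ht T => {t xs} [|t x ys xs [cs inp lcs] _ IH] T leT.
  by rewrite -[flatten _]cats0; apply: run_skips; apply: run_nil.
case: T leT => // T leT; rewrite /= map_cat flatten_cat.
have [ps1 [ps2 eqps]] := List.in_split _ _ inp.
rewrite {1}eqps -[(_ ++ _)%list]/(ps1 ++ _) map_cat flatten_cat -catA.
apply: run_skips; rewrite -[flatten _]/(piecew (x, cs, ys) ++ _) -catA; apply/run_piece; right; exists xs; split=> //.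
by apply: run_skips; apply: IH.
Qed.

Lemma flatten_nseq_map (T U : Type) (f : T -> U) n (s : seq T) :
  map f (flatten (nseq n s)) = flatten (nseq n (map f s)).
Proof. by elim: n => //= n IH; rewrite map_cat IH. Qed.

Lemma flatten_flatten_nseq (T : Type) n (s : seq (seq T)) :
  flatten (flatten (nseq n s)) = flatten (nseq n (flatten s)).
Proof. by elim: n => //= n IH; rewrite flatten_cat IH. Qed.

Definition hornw (ps : seq piece) (x0 T : nat) : seq L' :=
  pushw x0 ++ flatten (nseq T (flatten (map piecew ps))).

Lemma hornwE ps x0 T : hornw ps x0 T = pushw x0 ++ flatten (map piecew (flatten (nseq T ps))).
Proof. by rewrite flatten_nseq_map flatten_flatten_nseq. Qed.

Lemma enc1 x : enc [:: x] = nseq x false ++ [:: true].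
Proof. by rewrite /enc /= cats0. Qed.

Lemma lang_hornw ps x0 T :
  lang (g := gext g) (hornw ps x0 T) -> exists t, hders (prule ps) t [:: x0].
Proof.
move/lang_run; rewrite hornwE => /(_ ltac:(done))/run_pushw; rewrite -enc1.
apply: run_hders => p; elim: T => //= T IH inp.
by have [//|/IH] := List.in_app_or _ _ _ inp.
Qed.

Lemma hornw_lang ps x0 T t : hders (prule ps) t [:: x0] -> t <= T ->
  lang (g := gext g) (hornw ps x0 T).
Proof.
move=> ht leT; apply/lang_run; rewrite hornwE //.
by apply/run_pushw; rewrite -enc1; apply: hders_run leT.
Qed.

End Pieces.

(** * First-order arithmetic on blocks *)

Section FO.
Variable s : nat.
Implicit Types (D : forall A : str s, sets A -> Prop) (K J r : nat).

Lemma FOdef_intro K D (p : formula s) (b : forall A : str s, sets A -> bool) :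
  is_FO p -> dep K b -> (forall A so, @ssat s A so p = b A so) ->
  (forall A so, b A so <-> D A so) -> FOdef K D.
Proof.
move=> FOp db pb bD; exists p; split=> // [A so so' eqs|A so]; first by rewrite !pb; apply: db.
by rewrite pb.
Qed.

Lemma FOdef_ext K D D' : (forall A so, D A so <-> D' A so) -> FOdef K D -> FOdef K D'.
Proof. by move=> eqD [p [FOp dp pD]]; exists p; split=> // A so; rewrite pD. Qed.

Lemma FOdef_not K D : FOdef K D -> FOdef K (fun A so => ~ D A so).
Proof.
move=> [p [FOp dp pD]]; exists (FNot p); split=> // [A so so' eqs|A so].
  by congr negb; apply: dp.
by rewrite -pD; split=> /negP.
Qed.

Lemma FOdef_and K D1 D2 : FOdef K D1 -> FOdef K D2 -> FOdef K (fun A so => D1 A so /\ D2 A so).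
Proof.
move=> [p [FOp dp pD]] [q [FOq dq qD]]; exists (FAnd p q); split=> [|A so so' eqs|A so].
- by rewrite /= FOp.
- by congr andb; [apply: dp | apply: dq].
- by rewrite -pD -qD; split=> /andP.
Qed.

Lemma FOdef_or K D1 D2 : FOdef K D1 -> FOdef K D2 -> FOdef K (fun A so => D1 A so \/ D2 A so).
Proof.
move=> [p [FOp dp pD]] [q [FOq dq qD]]; exists (FOr p q); split=> [|A so so' eqs|A so].
- by rewrite /= FOp.
- by congr orb; [apply: dp | apply: dq].
- by rewrite -pD -qD; split=> /orP.
Qed.

Lemma FOdef_cst K (P : bool) : @FOdef s K (fun _ _ => P).
Proof.
apply: (@FOdef_intro K _ (if P then FEq s TMin TMin else FNot (FEq s TMin TMin)) (fun _ _ => P)) => //.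
  by case: P.
by move=> A so; rewrite /ssat; case: P; rewrite /= ?eqxx.
Qed.

Lemma FOdef_empty K X : X < K -> @FOdef s K (fun A so => so X = set0).
Proof.
move=> ltX; apply: (@FOdef_intro K _ (Fempty s X) (fun A so => so X == set0)) => //.
- by move=> A so so' eqs; rewrite eqs.
- by move=> A so; apply: sat_Fempty.
- by move=> A so; split=> /eqP.
Qed.

Definition Fors (l : seq (formula s)) := foldr (@FOr s) (FNot (FEq s TMin TMin)) l.
Definition Fands (l : seq (formula s)) := foldr (@FAnd s) (FEq s TMin TMin) l.

Lemma sat_Fors n (w : 'I_n.+1 -> 'I_s) fo so l : sat w (Fors l) fo so = has (fun p => sat w p fo so) l.
Proof. by elim: l => [|p l /= <-] //=; rewrite eqxx. Qed.

Lemma sat_Fands n (w : 'I_n.+1 -> 'I_s) fo so l : sat w (Fands l) fo so = all (fun p => sat w p fo so) l.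
Proof. by elim: l => [|p l /= <-] //=; rewrite eqxx. Qed.

Lemma Fors_FO l : all (@is_FO s) l -> is_FO (Fors l).
Proof. by elim: l => //= p l IH /andP[-> /IH]. Qed.

Lemma Fands_FO l : all (@is_FO s) l -> is_FO (Fands l).
Proof. by elim: l => //= p l IH /andP[-> /IH]. Qed.

Implicit Types (E B C : nat -> nat -> formula s).

(* [C a x] speaks about the bit of a block given by its [a]-th set at the element [x]; positions are ordered by decreasing weight. *)
Definition allF r C : formula s := Fands [seq FAll 0 (C a 0) | a <- iota 0 r].

Definition beforeF r B a : formula s :=
  Fands [seq if b < a then FAll 1 (B b 1)
             else if b == a then FAll 1 (FOr (FNot (FLt s (TVar 1) (TVar 0))) (B b 1))
             else FEq s TMin TMin | b <- iota 0 r].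

Definition afterF r C a : formula s :=
  Fands [seq if a < b then FAll 1 (C b 1)
             else if b == a then FAll 1 (FOr (FNot (FLt s (TVar 0) (TVar 1))) (C b 1))
             else FEq s TMin TMin | b <- iota 0 r].

(** The common shape of comparison and successor: some position satisfies [E], all heavier ones
    satisfy [B], all lighter ones [C]. First-order variable 0 holds the chosen position and 1 ranges
    over the others. *)
Definition cmpF r E B C : formula s :=
  Fors [seq FEx 0 (FAnd (E a 0) (FAnd (beforeF r B a) (afterF r C a))) | a <- iota 0 r].

Definition bitF n (w : 'I_n.+1 -> 'I_s) so r C (pc : pred nat) :=
  forall a x fo, a < r -> sat w (C a x) fo so = pc (epos n r a (fo x)).

Lemma sat_allF n (w : 'I_n.+1 -> 'I_s) r C fo so pc : bitF w so r C pc ->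
  sat w (allF r C) fo so <-> forall e, e < n.+1 * r -> pc e.
Proof.
move=> bC; rewrite sat_Fands all_map; split=> [/allP H e /epos_surj[a [j [lta ->]]]|H].
  have := H a; rewrite mem_iota add0n lta => /(_ isT) /= /forallP/(_ j).
  by rewrite bC.
apply/allP=> a; rewrite mem_iota add0n => /andP[_ lta] /=; apply/forallP=> j.
by rewrite bC // H // epos_lt.
Qed.

Lemma sat_beforeF n (w : 'I_n.+1 -> 'I_s) r B a fo so pc : bitF w so r B pc -> a < r ->
  sat w (beforeF r B a) fo so <->
  forall e, epos n r a (fo 0) < e -> e < n.+1 * r -> pc e.
Proof.
move=> bC lta; rewrite sat_Fands all_map; split=> [/allP H e + /epos_surj[b [u [ltb eqe]]]|H].
  rewrite eqe epos_ltn // => ltab.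
  have := H b; rewrite mem_iota add0n ltb => /(_ isT) /=; case/orP: ltab => [-> /=|/andP[/eqP -> ltu]].
    by move=> /forallP/(_ u); rewrite bC.
  by rewrite ltnn eqxx /= => /forallP/(_ u); rewrite /fupd /= ltu bC.
apply/allP=> b; rewrite mem_iota add0n => /andP[_ ltb] /=.
case: ifP => [ltba|_] /=.
  by apply/forallP=> u; rewrite bC //; apply: H; rewrite ?epos_ltn ?ltba // epos_lt.
case: ifP => [/eqP ->|_] /=; last by rewrite eqxx.
apply/forallP=> u; rewrite /fupd /=; case: (boolP (u < fo 0)) => //= ltu.
by rewrite bC //; apply: H; rewrite ?epos_ltn ?eqxx ?ltu ?orbT // epos_lt.
Qed.

Lemma sat_afterF n (w : 'I_n.+1 -> 'I_s) r C a fo so pc : bitF w so r C pc -> a < r ->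
  sat w (afterF r C a) fo so <-> forall e, e < epos n r a (fo 0) -> pc e.
Proof.
move=> bC lta; rewrite sat_Fands all_map; split=> [/allP H e lte|H].
  have [b [u [ltb eqe]]] := epos_surj (ltn_trans lte (epos_lt lta (ltn_ord _))).
  move: lte; rewrite eqe epos_ltn // => ltab.
  have := H b; rewrite mem_iota add0n ltb => /(_ isT) /=; case/orP: ltab => [-> /=|/andP[/eqP -> ltu]].
    by move=> /forallP/(_ u); rewrite bC.
  by rewrite ltnn eqxx /= => /forallP/(_ u); rewrite /fupd /= ltu bC.
apply/allP=> b; rewrite mem_iota add0n => /andP[_ ltb] /=.
case: ifP => [ltba|_] /=.
  by apply/forallP=> u; rewrite bC //; apply: H; rewrite ?epos_ltn ?ltba // epos_lt.
case: ifP => [/eqP ->|_] /=; last by rewrite eqxx.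
apply/forallP=> u; rewrite /fupd /=; case: (boolP (fo 0 < u)) => //= ltu.
by rewrite bC //; apply: H; rewrite ?epos_ltn ?eqxx ?ltu ?orbT // epos_lt.
Qed.

Lemma sat_cmpF n (w : 'I_n.+1 -> 'I_s) r E B C fo so pe pb pc :
  bitF w so r E pe -> bitF w so r B pb -> bitF w so r C pc ->
  sat w (cmpF r E B C) fo so <->
  exists2 e, e < n.+1 * r &
    [/\ pe e, forall e', e < e' -> e' < n.+1 * r -> pb e' & forall e', e' < e -> pc e'].
Proof.
move=> bE bB bC; rewrite sat_Fors has_map; split.
  move=> /hasP[a]; rewrite mem_iota add0n => /andP[_ lta] /= /existsP[j].
  rewrite bE // => /and3P[ej /(sat_beforeF _ bB lta) Hb /(sat_afterF _ bC lta) Hc].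
  by exists (epos n r a j); [rewrite epos_lt | split].
move=> [e /epos_surj[a [j [lta ->]]] [ej Hb Hc]]; apply/hasP; exists a; first by rewrite mem_iota.
rewrite /=; apply/existsP; exists j; rewrite bE //; apply/and3P; split=> //.
  by apply/(sat_beforeF _ bB lta).
by apply/(sat_afterF _ bC lta).
Qed.

Definition Fin J a x : formula s := FIn s (J + a) (TVar x).
Definition Fxor (p q : formula s) := FOr (FAnd p (FNot q)) (FAnd (FNot p) q).

Lemma bitF_in n (w : 'I_n.+1 -> 'I_s) so r J : bitF w so r (Fin J) (bit (num J r so)).
Proof. by move=> a x fo lta /=; rewrite (num_bit _ _ _ lta). Qed.

Lemma bitF_not n (w : 'I_n.+1 -> 'I_s) so r C pc : bitF w so r C pc ->
  bitF w so r (fun a x => FNot (C a x)) (fun e => ~~ pc e).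
Proof. by move=> bC a x fo lta /=; rewrite bC. Qed.

Lemma bitF_and n (w : 'I_n.+1 -> 'I_s) so r B C pb pc : bitF w so r B pb -> bitF w so r C pc ->
  bitF w so r (fun a x => FAnd (B a x) (C a x)) (fun e => pb e && pc e).
Proof. by move=> bB bC a x fo lta /=; rewrite bB // bC. Qed.

Lemma bitF_xor n (w : 'I_n.+1 -> 'I_s) so r B C pb pc : bitF w so r B pb -> bitF w so r C pc ->
  bitF w so r (fun a x => Fxor (B a x) (C a x)) (fun e => pb e (+) pc e).
Proof. by move=> bB bC a x fo lta /=; rewrite bB // bC //; case: (pb _); case: (pc _). Qed.

Lemma bitF_true n (w : 'I_n.+1 -> 'I_s) so r : bitF w so r (fun _ _ => FEq s TMin TMin) predT.
Proof. by move=> a x fo lta /=; rewrite eqxx. Qed.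

Lemma allF_FO r C : (forall a x, is_FO (C a x)) -> is_FO (allF r C).
Proof. by move=> FOC; apply: Fands_FO; rewrite all_map; apply/allP=> a _ /=. Qed.

Lemma cmpF_FO r E B C : (forall a x, is_FO (E a x)) -> (forall a x, is_FO (B a x)) ->
  (forall a x, is_FO (C a x)) -> is_FO (cmpF r E B C).
Proof.
move=> FOE FOB FOC; apply: Fors_FO; rewrite all_map; apply/allP=> a _ /=; rewrite FOE /=.
by apply/andP; split; apply: Fands_FO; rewrite all_map; apply/allP=> b _ /=;
  do 2?[case: ifP => _ //=].
Qed.

Lemma FOdef_num2 K J1 J2 r (R : forall A : str s, rel nat) p :
  J1 + r <= K -> J2 + r <= K -> is_FO p ->
  (forall A so, @ssat s A so p <-> R A (num J1 r so) (num J2 r so)) ->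
  FOdef K (fun A so => R A (num J1 r so) (num J2 r so)).
Proof.
move=> le1 le2 FOp pR.
apply: (@FOdef_intro _ _ p (fun A so => R A (num J1 r so) (num J2 r so))) => //.
  by move=> A so so' eqs; congr R; apply: num_eq => a lta; apply: eqs; lia.
by move=> A so; apply/idP/idP => /pR.
Qed.

Lemma FOdef_lt K J1 J2 r : J1 + r <= K -> J2 + r <= K ->
  @FOdef s K (fun A so => num J1 r so < num J2 r so).
Proof.
move=> le1 le2.
apply: (@FOdef_num2 _ _ _ _ (fun _ i j => i < j)
  (cmpF r (fun a x => FAnd (FNot (Fin J1 a x)) (Fin J2 a x))
          (fun a x => FNot (Fxor (Fin J1 a x) (Fin J2 a x)))
          (fun _ _ => FEq s TMin TMin)) le1 le2).
  exact: cmpF_FO.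
move=> A so; rewrite (ltn_bit (num_lt _ _ _) (num_lt _ _ _)) /ssat sat_cmpF;
  [| exact: bitF_and (bitF_not (@bitF_in _ (@sw s A) so r J1)) (@bitF_in _ (@sw s A) so r J2)
   | exact: bitF_not (bitF_xor (@bitF_in _ (@sw s A) so r J1) (@bitF_in _ (@sw s A) so r J2)) | exact: bitF_true].
split=> [[e lte [/andP[b1 b2] eqb _]]|[e lte [b1 b2 eqb]]]; exists e => //; split=> //.
- by move=> e' l1 l2; have := eqb _ l1 l2; case: bit; case: bit.
- by rewrite b1.
- by move=> e' l1 l2; rewrite (eqb _ l1 l2) addbb.
Qed.

Lemma FOdef_succ K J1 J2 r : J1 + r <= K -> J2 + r <= K ->
  @FOdef s K (fun A so => num J2 r so == (num J1 r so).+1).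
Proof.
move=> le1 le2.
apply: (@FOdef_num2 _ _ _ _ (fun _ i j => j == i.+1)
  (cmpF r (fun a x => FAnd (FNot (Fin J1 a x)) (Fin J2 a x))
          (fun a x => FNot (Fxor (Fin J1 a x) (Fin J2 a x)))
          (fun a x => FAnd (Fin J1 a x) (FNot (Fin J2 a x)))) le1 le2).
  exact: cmpF_FO.
move=> A so; have eqI := succ_bit (num_lt J1 r so) (num_lt J2 r so).
rewrite /ssat sat_cmpF;
  [| exact: bitF_and (bitF_not (@bitF_in _ (@sw s A) so r J1)) (@bitF_in _ (@sw s A) so r J2)
   | exact: bitF_not (bitF_xor (@bitF_in _ (@sw s A) so r J1) (@bitF_in _ (@sw s A) so r J2))
   | exact: bitF_and (@bitF_in _ (@sw s A) so r J1) (bitF_not (@bitF_in _ (@sw s A) so r J2))].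
split=> [[e lte [/andP[b1 b2] eqb eql]]|/eqP/eqI[e lte [b1 b2 eqb eql]]].
  apply/eqP/eqI; exists e => //; split=> // e' l1 l2.
  by have := eqb _ l1 l2; case: bit; case: bit.
exists e => //; split=> //; first by rewrite b1.
by move=> e' l1 l2; rewrite (eqb _ l1 l2) addbb.
Qed.

Lemma FOdef_compl K J1 J2 r : J1 + r <= K -> J2 + r <= K ->
  @FOdef s K (fun A so => num J1 r so + num J2 r so == (cap A r).-1).
Proof.
move=> le1 le2.
apply: (@FOdef_num2 _ _ _ _ (fun A i j => i + j == (cap A r).-1)
  (allF r (fun a x => Fxor (Fin J1 a x) (Fin J2 a x))) le1 le2); first exact: allF_FO.
move=> A so; have eqI := compl_bit (num_lt J1 r so) (num_lt J2 r so).
rewrite /ssat sat_allF; last by exact: bitF_xor (@bitF_in _ (@sw s A) so r J1) (@bitF_in _ (@sw s A) so r J2).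
split=> [H|/eqP/eqI H e lte]; last by rewrite H //; case: bit.
by apply/eqP/eqI => e lte; have := H _ lte; case: bit; case: bit.
Qed.

(** The equation says that the complement of the second number is the successor of the first. *)
Lemma FOdef_compl2 K J1 J2 r : J1 + r <= K -> J2 + r <= K ->
  @FOdef s K (fun A so => (num J1 r so + num J2 r so).+1 == (cap A r).-1).
Proof.
move=> le1 le2.
apply: (@FOdef_num2 _ _ _ _ (fun A i j => (i + j).+1 == (cap A r).-1)
  (cmpF r (fun a x => FAnd (FNot (Fin J1 a x)) (FNot (Fin J2 a x)))
          (fun a x => Fxor (Fin J1 a x) (Fin J2 a x))
          (fun a x => FAnd (Fin J1 a x) (Fin J2 a x))) le1 le2).
  exact: cmpF_FO.
move=> A so; have lt1 := num_lt J1 r so; have lt2 := num_lt J2 r so.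
have lt2' : (cap A r).-1 - num J2 r so < 2 ^ ((sn A).+1 * r).
  by have := cap_gt0 A r; rewrite /cap; lia.
have eqI := succ_bit lt1 lt2'.
have bc e : e < (sn A).+1 * r -> bit ((cap A r).-1 - num J2 r so) e = ~~ bit (num J2 r so) e.
  exact: bit_compl.
rewrite /ssat sat_cmpF;
  [| exact: bitF_and (bitF_not (@bitF_in _ (@sw s A) so r J1)) (bitF_not (@bitF_in _ (@sw s A) so r J2))
   | exact: bitF_xor (@bitF_in _ (@sw s A) so r J1) (@bitF_in _ (@sw s A) so r J2)
   | exact: bitF_and (@bitF_in _ (@sw s A) so r J1) (@bitF_in _ (@sw s A) so r J2)].
have -> : (num J1 r so + num J2 r so).+1 == (cap A r).-1 <->
    (cap A r).-1 - num J2 r so = (num J1 r so).+1.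
  by have := cap_gt0 A r; rewrite /cap in lt1 lt2 *; split=> [/eqP|?]; [lia | apply/eqP; lia].
split=> [[e lte [/andP[b1 b2] eqb eql]]|/eqI[e lte [b1 b2 eqb eql]]].
  apply/eqI; exists e => //; split; rewrite ?bc // => e' l1.
    by move=> l2; rewrite bc //; have := eqb _ l1 l2; case: bit; case: bit.
  by rewrite bc ?negbK; [apply: eql | apply: ltn_trans lte].
exists e => //; split; rewrite ?b1 -?bc // => e' l1.
  by move=> l2; rewrite (eqb _ l1 l2) bc //; case: bit.
by have := eql _ l1; rewrite bc ?negbK //; apply: ltn_trans lte.
Qed.

Lemma FOdef_eq K J1 J2 r : J1 + r <= K -> J2 + r <= K ->
  @FOdef s K (fun A so => num J1 r so == num J2 r so).
Proof.
move=> le1 le2; have dlt := FOdef_lt le1 le2; have dgt := FOdef_lt le2 le1.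
apply: FOdef_ext (FOdef_and (FOdef_not dlt) (FOdef_not dgt)) => A so.
by case: (ltngtP (num J1 r so) (num J2 r so)) => cmp; split=> // -[].
Qed.

Lemma FOdef_0 K J r : J + r <= K -> @FOdef s K (fun A so => num J r so == 0).
Proof.
move=> le1.
apply: (@FOdef_num2 _ J J r (fun A i j => i == 0)
  (allF r (fun a x => FNot (Fin J a x))) le1 le1); first exact: allF_FO.
move=> A so; have lt0 : 0 < 2 ^ ((sn A).+1 * r) by rewrite expn_gt0.
rewrite /ssat sat_allF; last by exact: bitF_not (@bitF_in _ (@sw s A) so r J).
have bit00 e : bit 0 e = false by rewrite /bit div0n.
split=> [H|/eqP -> e _]; last by rewrite bit00.
apply/eqP; apply: (bit_inj (num_lt J r so) lt0) => e lte.
by rewrite bit00; apply/negbTE/H.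
Qed.

Lemma FOdef_max K J r : J + r <= K -> @FOdef s K (fun A so => num J r so == (cap A r).-1).
Proof.
move=> le1.
apply: (@FOdef_num2 _ J J r (fun A i j => i == (cap A r).-1)
  (allF r (Fin J)) le1 le1); first exact: allF_FO.
move=> A so; have lt0 : 0 < 2 ^ ((sn A).+1 * r) by rewrite expn_gt0.
rewrite /ssat sat_allF; last by apply: bitF_in.
have bit00 e : bit 0 e = false by rewrite /bit div0n.
have eqI := compl_bit lt0 (num_lt J r so); rewrite add0n in eqI.
split=> [H|/eqP/eqI H e /H ->]; last by rewrite bit00.
by apply/eqP/eqI => e lte; rewrite bit00 H.
Qed.

End FO.

(** * Relations definable by a grammar and a definable word *)

Lemma In_flatten_iota (T : Type) (F : nat -> seq T) p m :
  List.In p (flatten [seq F i | i <- iota 0 m]) <-> exists2 i, i < m & List.In p (F i).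
Proof.
have H l : List.In p (flatten [seq F i | i <- l]) <-> exists2 i, i \in l & List.In p (F i).
  elim: l => [|i l IH] /=; first by split=> [//|[]].
  split=> [inp|[j]].
    have [inFi|/IH[j inj inFj]] := List.in_app_or _ _ _ inp; first by exists i; rewrite ?mem_head.
    by exists j; rewrite // in_cons inj orbT.
  rewrite in_cons => /orP[/eqP ->|inj] inp; apply: List.in_or_app; first by left.
    by right; apply/IH; exists j.
by rewrite H; split=> [][i]; rewrite ?mem_iota => lti inp; exists i; rewrite ?mem_iota.
Qed.

Lemma In_map (T U : Type) (f : T -> U) p (l : seq T) :
  List.In p [seq f i | i <- l] <-> exists2 i, List.In i l & p = f i.
Proof.
elim: l => [|i l IH] /=; first by split=> [//|[]].
split=> [[<-|/IH[j inj ->]]|[j [<-|inj] eqp]].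
- by exists i => //; left.
- by exists j => //; right.
- by left.
- by right; apply/IH; exists j.
Qed.

Lemma hders_sub (rule rule' : nat -> seq nat -> Prop) t xs :
  (forall x ys, rule x ys -> rule' x ys) -> hders rule t xs -> hders rule' t xs.
Proof.
move=> sub; elim=> {t xs} [|t x ys xs rx _ IH]; first exact: hders_nil.
exact: hders_cons (sub _ _ rx) IH.
Qed.

Section Definable.
Variable s : nat.
Implicit Types (D : forall A : str s, sets A -> Prop) (K J r : nat).

Definition Gdef_in (g : cfg) K D : Prop :=
  exists2 W : forall A : str s, sets A -> seq (gL g),
    defw K W & forall A so, D A so <-> lang (W A so).

Definition Gdef K D : Prop := exists g, Gdef_in g K D.

Lemma Gdef_ext K D D' : (forall A so, D A so <-> D' A so) -> Gdef K D -> Gdef K D'.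
Proof. by move=> eqD [g [W dW WE]]; exists g, W => // A so; rewrite -eqD. Qed.

Lemma Gdef_ren K K' D f : (forall X, X < K -> f X < K') ->
  Gdef K D -> Gdef K' (fun A so => D A (so \o f)).
Proof.
move=> fK [g [W dW WE]]; exists g, (fun A so => W A (so \o f)) => [|A so]; last exact: WE.
exact: defw_ren dW.
Qed.

Lemma Gdef_leq K K' D : K <= K' -> Gdef K D -> Gdef K' D.
Proof. by move=> leK [g [W dW WE]]; exists g, W => //; apply: defw_leq dW. Qed.

Lemma Gdef_dep K D A so so' : Gdef K D -> agree K so so' -> D A so -> D A so'.
Proof. by move=> [g [W dW WE]] eqs; rewrite !WE (defw_dep dW eqs). Qed.

Lemma Gdef_inl g1 g2 K D : Gdef_in g1 K D -> Gdef_in (gsum g1 g2) K D.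
Proof.
move=> [W dW WE]; exists (fun A so => map inl (W A so)); first exact: defw_map.
by move=> A so; rewrite WE lang_suml.
Qed.

Lemma Gdef_inr g1 g2 K D : Gdef_in g2 K D -> Gdef_in (gsum g1 g2) K D.
Proof.
move=> [W dW WE]; exists (fun A so => map inr (W A so)); first exact: defw_map.
by move=> A so; rewrite WE lang_sumr.
Qed.

Lemma lang_nil g : ~ @lang g [::].
Proof. by case=> X _ /der_nonnil; apply. Qed.

Lemma FO_Gdef K D : FOdef K D -> Gdef K D.
Proof.
move=> dD; pose g := Cfg (fun (_ : unit) (_ : unit) => true) (fun _ _ _ => false) predT.
have [p pD dW] := defw_letter (tt : gL g) dD.
exists g, (fun A so => if ssat so p then [:: tt] else [::]) => // A so.
rewrite -pD; case: ifP => _; split=> //; last by move/lang_nil.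
by exists tt => //; apply: der_lex.
Qed.

Section Words.
Variable g : cfg.
Notation L' := (gL g + blet)%type.

(** Unary from binary: a fresh block runs through all values, and the letter is written at those
    below the given number. *)
Lemma defw_nseq (L : Type) (a : L) K J r : J + r <= K ->
  defw K (fun (A : str s) so => nseq (num J r so) a).
Proof.
move=> leK; have dlt : FOdef (K + r) (fun (A : str s) so => num K r so < num J r so).
  by apply: FOdef_lt; lia.
have [p pE dW] := defw_letter a dlt.
apply: defw_ext (defw_loop dW) => A so.
have := num_lt J r so; rewrite -/(cap A r); set c := num J r so => ltc.
have -> : [seq (if ssat (setnum K r i so) p then [:: a] else [::]) | i <- iota 0 (cap A r)]
    = [seq (if i < c then [:: a] else [::]) | i <- iota 0 (cap A r)].
  apply/eq_in_map => i; rewrite mem_iota => /andP[_ lti].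
  suff -> : ssat (setnum K r i so) p = (i < c) by [].
  have := pE A (setnum K r i so); rewrite num_setnum // num_setnum_out; last by left.
  by rewrite -/c => pc; apply/idP/idP => /pc.
have -> : cap A r = c + (cap A r - c) by lia.
rewrite iotaD map_cat flatten_cat.
have -> : flatten [seq (if i < c then [:: a] else [::]) | i <- iota (0 + c) (cap A r - c)] = [::].
  set l := iota _ _; have : all (fun i => c <= i) l by apply/allP => i; rewrite mem_iota; lia.
  by elim: l => //= i l IH /andP[lei /IH ->]; rewrite ltnNge lei.
rewrite cats0; have : all (fun i => i < c) (iota 0 c) by apply/allP => i; rewrite mem_iota; lia.
rewrite -[X in nseq X a](size_iota 0 c).
by elim: (iota 0 c) => //= i l IH /andP[-> /IH ->].
Qed.

Lemma defw_pushw K J r : J + r <= K -> defw K (fun (A : str s) so => pushw g (num J r so)).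
Proof.
move=> leK; apply: (defw_cat (defw_letter1 s K (inr (Push true) : L'))).
exact: defw_nseq.
Qed.

Lemma defw_popw K J r : J + r <= K -> defw K (fun (A : str s) so => popw g (num J r so)).
Proof.
move=> leK; apply: defw_cat; first exact: defw_nseq.
exact: defw_letter1.
Qed.

Lemma defw_condw K (W : forall A : str s, sets A -> seq (gL g)) :
  defw K W -> defw K (fun A so => condw (W A so)).
Proof.
move=> dW; apply: (defw_cat (defw_letter1 s K (inr (Orc true) : L'))).
by apply: defw_cat; [apply: defw_map | apply: defw_letter1].
Qed.

Lemma defw_piecew K (x : forall A : str s, sets A -> nat)
    (cs : seq (forall A : str s, sets A -> seq (gL g))) ys :
  defw K (fun A so => popw g (x A so)) ->
  (forall W, List.In W cs -> defw K W) ->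
  (forall y : forall A : str s, sets A -> nat, List.In y ys -> defw K (fun A so => pushw g (y A so))) ->
  defw K (fun A so => piecew (x A so, [seq W A so | W <- cs], [seq y A so | y <- ys])).
Proof.
move=> dx dcs dys; apply: (defw_cat (defw_letter1 s K (inr (Br true) : L'))).
apply: (defw_cat dx); apply: defw_cat; last apply: defw_cat; last exact: defw_letter1.
  elim: cs dcs => [|W cs IH] dcs; first exact: defw_nil.
  apply: (@defw_cat _ _ _ (fun A so => condw (W A so))).
    by apply/defw_condw/dcs; left.
  by apply: IH => V inV; apply: dcs; right.
elim: ys dys => [|y ys IH] dys; first exact: defw_nil.
apply: (@defw_cat _ _ _ (fun A so => pushw g (y A so))).
  by apply: dys; left.
by apply: IH => V inV; apply: dys; right.
Qed.

(* A closed alternative: item [0] has an axiom for each possible list of conditions. *)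
Lemma Gdef_goal K D (ps : forall A : str s, sets A -> seq (seq (seq (gL g)))) :
  defw K (fun A so => flatten [seq piecew (0, cs, [::]) | cs <- ps A so]) ->
  (forall A so, D A so <-> exists2 cs, List.In cs (ps A so) & forall c, List.In c cs -> lang c) ->
  Gdef K D.
Proof.
move=> dW DE; pose pps A so := [seq ((0, cs, [::]) : piece g) | cs <- ps A so].
exists (gext g), (fun A so => hornw (pps A so) 0 1).
  apply: defw_cat; first exact: defw_cst.
  by apply: defw_ext dW => A so; rewrite /= cats0 /pps -map_comp.
move=> A so; rewrite DE; split=> [[cs incs lcs]|/lang_hornw[t]].
  apply: (@hornw_lang _ _ _ _ 1) => //; apply: (@hders_cons _ _ _ [::]); last exact: hders_nil.
  by exists cs => //; apply/In_map; exists cs.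
move=> /hders_inv[ys [t' [_ [cs /In_map[cs' incs [eqc _]] lcs] _]]].
by exists cs' => //; rewrite -eqc.
Qed.

End Words.

Lemma Gdef_common2 K1 D1 K2 D2 : Gdef K1 D1 -> Gdef K2 D2 ->
  exists g, Gdef_in g K1 D1 /\ Gdef_in g K2 D2.
Proof.
move=> [g1 d1] [g2 d2]; exists (gsum g1 g2); split.
  exact: Gdef_inl.
exact: Gdef_inr.
Qed.

Lemma Gdef_common3 K1 D1 K2 D2 K3 D3 : Gdef K1 D1 -> Gdef K2 D2 -> Gdef K3 D3 ->
  exists g, [/\ Gdef_in g K1 D1, Gdef_in g K2 D2 & Gdef_in g K3 D3].
Proof.
move=> d1 d2 [g3 d3]; have [g [d1' d2']] := Gdef_common2 d1 d2.
by exists (gsum g g3); split; [apply: Gdef_inl | apply: Gdef_inl | apply: Gdef_inr].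
Qed.

Lemma defw_piece0 g K (cs : seq (forall A : str s, sets A -> seq (gL g))) :
  (forall W, List.In W cs -> defw K W) ->
  defw K (fun A so => piecew (0, [seq W A so | W <- cs], [::])).
Proof.
move=> dcs; apply: (@defw_piecew g K (fun _ _ => 0) cs [::]) => //.
exact: defw_cst.
Qed.

Lemma Gdef_and K D1 D2 : Gdef K D1 -> Gdef K D2 -> Gdef K (fun A so => D1 A so /\ D2 A so).
Proof.
move=> d1 d2; have [g [[W1 dW1 E1] [W2 dW2 E2]]] := Gdef_common2 d1 d2.
apply: (@Gdef_goal g _ _ (fun A so => [:: [:: W1 A so; W2 A so]])) => [|A so].
  apply: (defw_cat (@defw_piece0 g K [:: W1; W2] _) (@defw_nil _ _ _)).
  by move=> W [<-|[<-|[]]].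
rewrite E1 E2; split=> [[l1 l2]|[_ [<-|[]] lcs]].
  by exists [:: W1 A so; W2 A so]; [left | move=> c [<-|[<-|[]]]].
by split; apply: lcs; [left | right; left].
Qed.

Lemma Gdef_or K D1 D2 : Gdef K D1 -> Gdef K D2 -> Gdef K (fun A so => D1 A so \/ D2 A so).
Proof.
move=> d1 d2; have [g [[W1 dW1 E1] [W2 dW2 E2]]] := Gdef_common2 d1 d2.
apply: (@Gdef_goal g _ _ (fun A so => [:: [:: W1 A so]; [:: W2 A so]])) => [|A so].
  apply: (defw_cat (@defw_piece0 g K [:: W1] _)).
    by move=> W [<-|[]].
  apply: (defw_cat (@defw_piece0 g K [:: W2] _) (@defw_nil _ _ _)).
  by move=> W [<-|[]].
rewrite E1 E2; split=> [[l|l]|[cs [<-|[<-|[]]] lcs]].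
- by exists [:: W1 A so]; [left | move=> c [<-|[]]].
- by exists [:: W2 A so]; [right; left | move=> c [<-|[]]].
- by left; apply: lcs; left.
- by right; apply: lcs; left.
Qed.

(** One optional block per value of the quantified variables; a run enters the block of a
    witness. *)
Lemma Gdef_ex K r D : Gdef (K + r) D ->
  Gdef K (fun A so => exists2 i, i < cap A r & D A (setnum K r i so)).
Proof.
move=> [g [W dW WE]].
apply: (@Gdef_goal g _ _ (fun A so => flatten [seq [:: [:: W A (setnum K r i so)]] | i <- iota 0 (cap A r)])).
  apply: defw_ext (defw_loop (@defw_piece0 g (K + r) [:: W] _)) => [A so|V [<-|[]]//].
  by elim: (iota 0 _) => //= i l ->.
move=> A so; split=> [[i lti]|[cs /In_flatten_iota[i lti [<-|[]]] lcs]].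
  rewrite WE => li; exists [:: W A (setnum K r i so)]; last by move=> c [<-|[]].
  by apply/In_flatten_iota; exists i => //; left.
by exists i => //; apply/WE/lcs; left.
Qed.

(** Clauses have at most two premises. A body is in push order, so in [[:: z; y]] the goal [y] is
    treated first; the blocks above the parameters hold [x], [y], [z] in this order. *)
Definition hrule K r (R0 R1 R2 : forall A : str s, sets A -> Prop) (A : str s) (so : sets A)
    (x : nat) (ys : seq nat) : Prop :=
  let so1 := setnum K r x so in
  x < cap A r /\
  match ys with
  | [::] => R0 A so1
  | [:: y] => y < cap A r /\ R1 A (setnum (K + r) r y so1)
  | [:: z; y] => [/\ y < cap A r, z < cap A r &
       R2 A (setnum (K + r + r) r z (setnum (K + r) r y so1))]
  | _ => False
  end.

(* Horn clauses whose bodies are definable: the word for [x] pushes [x], then offers [2 ^ (n+1)t] times the list of all clause instances. *)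
Lemma Gdef_horn K r t R0 R1 R2 :
  Gdef (K + r) R0 -> Gdef (K + r + r) R1 -> Gdef (K + r + r + r) R2 ->
  (forall A (so : sets A) x m, hders (hrule K r R0 R1 R2 so) m [:: x] ->
     exists2 m', m' <= cap A t & hders (hrule K r R0 R1 R2 so) m' [:: x]) ->
  Gdef (K + r) (fun A so => exists m, hders (hrule K r R0 R1 R2 so) m [:: num K r so]).
Proof.
move=> d0 d1 d2 bounded.
have [g [[W0 dW0 E0] [W1 dW1 E1] [W2 dW2 E2]]] := Gdef_common3 d0 d1 d2.
pose V0 A (so : sets A) x := W0 A (setnum K r x so).
pose V1 A (so : sets A) x y := W1 A (setnum (K + r) r y (setnum K r x so)).
pose V2 A (so : sets A) x y z :=
  W2 A (setnum (K + r + r) r z (setnum (K + r) r y (setnum K r x so))).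
pose ps A (so : sets A) : seq (piece g) := flatten [seq
   (x, [:: V0 A so x], [::]) :: flatten [seq
     (x, [:: V1 A so x y], [:: y]) :: flatten [seq
        [:: (x, [:: V2 A so x y z], [:: z; y])]
     | z <- iota 0 (cap A r)] | y <- iota 0 (cap A r)] | x <- iota 0 (cap A r)].
have pruleE A (so : sets A) x ys : prule (ps A so) x ys <-> hrule K r R0 R1 R2 so x ys.
  split.
    case=> cs /In_flatten_iota[x' ltx' inx] lcs.
    case: inx => [[eqx eqc eqy]|/In_flatten_iota[y lty inp]].
      by subst x' cs ys; split=> //; apply/E0/lcs; left.
    case: inp => [[eqx eqc eqy]|/In_flatten_iota[z ltz [[eqx eqc eqy]|[]]]]; subst x' cs ys.
      by split=> //; split=> //; apply/E1/lcs; left.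
    by split=> //; split=> //; apply/E2/lcs; left.
  case=> ltx; case: ys => [|y [|z [|? ?]]] //.
  - move=> /E0 l0; exists [:: V0 A so x]; last by move=> c [<-|[]].
    by apply/In_flatten_iota; exists x => //; left.
  - case=> lty /E1 l1; exists [:: V1 A so x y]; last by move=> c [<-|[]].
    apply/In_flatten_iota; exists x => //; right.
    by apply/In_flatten_iota; exists y => //; left.
  - case=> lty ltz /E2 l2; exists [:: V2 A so x z y]; last by move=> c [<-|[]].
    apply/In_flatten_iota; exists x => //; right.
    apply/In_flatten_iota; exists z => //; right.
    by apply/In_flatten_iota; exists y => //; left.
(* Variables from [K] on hold the initial goal ([r] of them), then the counter of copies ([t]); the
   clause variables are shifted beyond both and start at [Kt]. *)
pose f X := if X < K then X else X + (r + t).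
pose Kt := K + r + t.
have fK j X : X < K + j -> f X < Kt + j by rewrite /f /Kt; case: ifP; lia.
(* Agreement between shifted and original assignments survives one more loop block. *)
have sim (A : str s) a b i (so1 so2 : sets A) : b = a + (r + t) -> K <= a ->
    (forall X, X < a -> so1 (f X) = so2 X) ->
    forall X, X < a + r -> setnum b r i so1 (f X) = setnum a r i so2 X.
  move=> -> leKa eqs X ltX; rewrite !setnumE ltX andbT /f; case: (ltnP X a) => [ltXa|leaX] /=.
    by rewrite -(eqs X ltXa) ifF // /f; case: ifP; lia.
  have -> : (X < K) = false by lia.
  rewrite ifT; last by lia.
  by apply/setP=> u; rewrite !inE; do 2!f_equal; lia.
exists (gext g), (fun A so => hornw (ps A so) (num K r so) (cap A t)); last first.
  move=> A so; split=> [[m /bounded[m' lem hm]]|/lang_hornw[m hm]].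
    apply: (hornw_lang _ lem); apply: hders_sub hm => x ys; exact: (proj2 (pruleE _ _ _ _)).
  by exists m; apply: hders_sub hm => x ys /pruleE.
apply: defw_cat; first exact: defw_pushw.
pose U0 A (so : sets A) := W0 A (so \o f).
pose U1 A (so : sets A) := W1 A (so \o f).
pose U2 A (so : sets A) := W2 A (so \o f).
have dU0 : defw (Kt + r) U0 by apply: (defw_ren _ dW0) => X; apply: fK.
have dU1 : defw (Kt + r + r) U1.
  by apply: (defw_ren _ dW1) => X; have := fK (r + r) X; rewrite !addnA.
have dU2 : defw (Kt + r + r + r) U2.
  by apply: (defw_ren _ dW2) => X; have := fK (r + r + r) X; rewrite !addnA.
pose P0 A (so : sets A) := piecew (num Kt r so, [seq W A so | W <- [:: U0]], [seq y A so | y <- [::] : seq (forall A : str s, sets A -> nat)]).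
pose P1 A (so : sets A) := piecew (num Kt r so, [seq W A so | W <- [:: U1]], [seq y A so | y <- [:: (fun A so => num (Kt + r) r so)]]).
pose P2 A (so : sets A) := piecew (num Kt r so, [seq W A so | W <- [:: U2]],
   [seq y A so | y <- [:: (fun A so => num (Kt + r + r) r so); (fun A so => num (Kt + r) r so)]]).
have P0E A (so : sets A) : P0 A so = piecew (num Kt r so, [:: U0 A so], [::]) by [].
have P1E A (so : sets A) :
  P1 A so = piecew (num Kt r so, [:: U1 A so], [:: num (Kt + r) r so]) by [].
have P2E A (so : sets A) : P2 A so =
  piecew (num Kt r so, [:: U2 A so], [:: num (Kt + r + r) r so; num (Kt + r) r so]) by [].
have dP0 : defw (Kt + r) P0.
  apply: (@defw_piecew _ _ (fun A so => num Kt r so)) => [|W [<-|[]]//|y []].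
  by apply: defw_popw.
have dP1 : defw (Kt + r + r) P1.
  apply: (@defw_piecew _ _ (fun A so => num Kt r so)) => [|W [<-|[]]//|y [<-|[]]].
    by apply: defw_popw; lia.
  by apply: defw_pushw; lia.
have dP2 : defw (Kt + r + r + r) P2.
  apply: (@defw_piecew _ _ (fun A so => num Kt r so)) => [|W [<-|[]]//|y [<-|[<-|[]]]].
  - by apply: defw_popw; lia.
  - by apply: defw_pushw; lia.
  - by apply: defw_pushw; lia.
(* The loops are, from outside: the copies, [x], [y], [z]. Clauses with fewer premises are written
   before the next inner loop. *)
have dall := defw_loop (defw_loop (defw_cat dP0 (defw_loop (defw_cat dP1 (defw_loop dP2))))).
apply: defw_ext dall => A so.
have -> : flatten (nseq (cap A t) (flatten [seq piecew p | p <- ps A so]))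
   = flatten [seq flatten [seq piecew p | p <- ps A so] | i <- iota 0 (cap A t)].
  by rewrite -map_nseq; congr flatten; rewrite -{1}[cap A t](size_iota 0); elim: (iota 0 _) => //= ? ? ->.
congr flatten; apply: eq_map => i.
have flmap (F : nat -> seq (piece g)) l : flatten [seq piecew p | p <- flatten [seq F x | x <- l]]
    = flatten [seq flatten [seq piecew p | p <- F x] | x <- l].
  by elim: l => //= x l IH; rewrite map_cat flatten_cat IH.
have sim0 x : forall X, X < K + r ->
    setnum Kt r x (setnum (K + r) t i so) (f X) = setnum K r x so X.
  apply: sim => // [|X ltX]; first by rewrite /Kt addnA.
  by rewrite /f ltX setnum_out //; lia.
rewrite /ps flmap; congr flatten; apply/eq_in_map => x; rewrite mem_iota => /andP[_ ltx].
have numx so' : num Kt r (setnum Kt r x (so' : sets A)) = x by rewrite num_setnum.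
rewrite map_cons -[flatten (_ :: _)]/(piecew _ ++ flatten _) flmap; congr (_ ++ _).
  rewrite P0E numx; congr (piecew (_, [:: _], _)).
  by apply: (defw_dep dW0); apply: sim0.
congr flatten; apply/eq_in_map => y; rewrite mem_iota => /andP[_ lty].
have sim1 := sim A (K + r) (Kt + r) y _ _ ltac:(rewrite /Kt; lia) (leq_addr _ _) (sim0 x).
rewrite map_cons -[flatten (_ :: _)]/(piecew _ ++ flatten _) flmap; congr (_ ++ _).
  rewrite P1E num_setnum_out; last by left.
  rewrite numx num_setnum //; congr (piecew (_, [:: _], _)).
  by apply: (defw_dep dW1); apply: sim1.
congr flatten; apply/eq_in_map => z; rewrite mem_iota => /andP[_ ltz].
have sim2 := sim A (K + r + r) (Kt + r + r) z _ _ ltac:(rewrite /Kt; lia) ltac:(lia) sim1.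
rewrite -[flatten _]/(piecew _ ++ [::]) cats0 P2E (@num_setnum _ (Kt + r + r)) //.
rewrite !(num_setnum_out (K' := Kt + r + r)); [|lia|lia].
rewrite (num_setnum_out (K' := Kt + r)); last by left.
rewrite numx !num_setnum //; congr (piecew (_, [:: _], _)).
by apply: (defw_dep dW2); apply: sim2.
Qed.

End Definable.

(** * Relations between numbers and chains *)

(** A sequence of values below [M], one for each of [0], ..., [x], starting in [B], linked by [St]
    and ending in [c]. The sequence is guessed, so a chain is a nondeterministic computation of
    exponential length. *)
Inductive chain (M : nat) (B : nat -> Prop) (St : nat -> nat -> nat -> Prop) : nat -> nat -> Prop :=
| chain0 c : c < M -> B c -> chain M B St 0 c
| chainS x c c' : chain M B St x c -> x.+1 < M -> c' < M -> St x c c' -> chain M B St x.+1 c'.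

Definition upd (v : nat -> nat) (q i : nat) : nat -> nat := fun a => if a == q then i else v a.
Definition res (q : nat) (v : nat -> nat) : nat -> nat := fun a => if a < q then v a else 0.

Section Numbers.
Variables s K r : nat.
Implicit Types (P : forall A : str s, sets A -> (nat -> nat) -> Prop).

(** Erasing everything above the parameters lets a predicate use them only through [so] and the
    numbers only through [v]. Likewise [nv] is 0 from [q] on. *)
Definition trunc (A : str s) (so : sets A) : sets A := fun X => if X < K then so X else set0.

Definition nv (q : nat) (A : str s) (so : sets A) : nat -> nat :=
  res q (fun a => num (K + a * r) r so).

(* Blocks [0], ..., [q - 1] of width [r] above the parameters are read as numbers. *)
Definition Gnum q P : Prop := Gdef (K + q * r) (fun A so => P A (trunc so) (nv q so)).
Definition FOnum q P : Prop := FOdef (K + q * r) (fun A so => P A (trunc so) (nv q so)).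

Lemma nvE q A (so : sets A) a : a < q -> nv q so a = num (K + a * r) r so.
Proof. by rewrite /nv /res => ->. Qed.

Lemma nv_lt q A (so : sets A) a : nv q so a < cap A r.
Proof. by rewrite /nv /res; case: ifP; rewrite ?num_lt ?cap_gt0. Qed.

Lemma trunc_set J k i A (so : sets A) : K <= J -> trunc (setnum J k i so) = trunc so.
Proof.
move=> leK; apply: functional_extensionality => X; rewrite /trunc; case: ifP => // ltX.
by rewrite setnum_out //; lia.
Qed.

Lemma nv_set q A (so : sets A) i : i < cap A r ->
  nv q.+1 (setnum (K + q * r) r i so) = upd (nv q so) q i.
Proof.
move=> lti; apply: functional_extensionality => a; rewrite /nv /res /upd.
have [->|neq] := eqVneq a q; first by rewrite ltnSn num_setnum.
rewrite ltnS leq_eqVlt (negbTE neq) /=; case: ifP => // ltaq.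
rewrite num_setnum_out //; left.
by rewrite -addnA leq_add2l -mulSnr leq_mul2r ltaq orbT.
Qed.

Lemma Gnum_ext q P P' : (forall A so v, (forall a, v a < cap A r) -> P A so v <-> P' A so v) ->
  Gnum q P -> Gnum q P'.
Proof. by move=> eqP; apply: Gdef_ext => A so; apply: eqP; apply: nv_lt. Qed.

Lemma FOnum_ext q P P' : (forall A so v, (forall a, v a < cap A r) -> P A so v <-> P' A so v) ->
  FOnum q P -> FOnum q P'.
Proof. by move=> eqP; apply: FOdef_ext => A so; apply: eqP; apply: nv_lt. Qed.

Lemma FOnum_Gnum q P : FOnum q P -> Gnum q P.
Proof. exact: FO_Gdef. Qed.

Lemma Gnum_and q P P' : Gnum q P -> Gnum q P' -> Gnum q (fun A so v => P A so v /\ P' A so v).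
Proof. exact: Gdef_and. Qed.

Lemma Gnum_or q P P' : Gnum q P -> Gnum q P' -> Gnum q (fun A so v => P A so v \/ P' A so v).
Proof. exact: Gdef_or. Qed.

Lemma FOnum_and q P P' : FOnum q P -> FOnum q P' -> FOnum q (fun A so v => P A so v /\ P' A so v).
Proof. exact: FOdef_and. Qed.

Lemma FOnum_not q P : FOnum q P -> FOnum q (fun A so v => ~ P A so v).
Proof. exact: FOdef_not. Qed.

Lemma block_le q a : a < q -> K + a * r + r <= K + q * r.
Proof. by move=> lta; rewrite -addnA leq_add2l -mulSnr leq_mul2r lta orbT. Qed.

Lemma FOnum_eq q a b : a < q -> b < q -> FOnum q (fun A so v => v a = v b).
Proof.
move=> lta ltb; apply: FOdef_ext (FOdef_eq s (block_le lta) (block_le ltb)) => A so.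
by rewrite !nvE //; split=> /eqP.
Qed.

Lemma FOnum_succ q a b : a < q -> b < q -> FOnum q (fun A so v => v b = (v a).+1).
Proof.
move=> lta ltb; apply: FOdef_ext (FOdef_succ s (block_le lta) (block_le ltb)) => A so.
by rewrite !nvE //; split=> /eqP.
Qed.

Lemma FOnum_0 q a : a < q -> FOnum q (fun A so v => v a = 0).
Proof.
move=> lta; apply: FOdef_ext (FOdef_0 s (block_le lta)) => A so.
by rewrite !nvE //; split=> /eqP.
Qed.

Lemma FOnum_max q a : a < q -> FOnum q (fun A so v => v a = (cap A r).-1).
Proof.
move=> lta; apply: FOdef_ext (FOdef_max s (block_le lta)) => A so.
by rewrite !nvE //; split=> /eqP.
Qed.

(** Substituting numbers for numbers amounts to renaming set variables block by block. *)
Lemma Gnum_subst q q' P (f : nat -> nat) : (forall a, a < q -> f a < q') ->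
  Gnum q P -> Gnum q' (fun A so v => P A so (res q (v \o f))).
Proof.
move=> fq dP.
pose h X := if X < K then X else K + f ((X - K) %/ r) * r + (X - K) %% r.
have r_gt0 X : X < K + q * r -> K <= X -> 0 < r by case: (r) => //; lia.
apply: Gdef_ext (Gdef_ren (K' := K + q' * r) (f := h) _ dP) => [A so|X ltX]; last first.
  rewrite /h; case: (ltnP X K) => [|leK]; first by lia.
  have rp := r_gt0 _ ltX leK.
  have lt1 : (X - K) %/ r < q by rewrite ltn_divLR //; lia.
  apply: leq_trans (block_le (fq _ lt1)); rewrite ltn_add2l.
  by rewrite ltn_mod.
have -> : trunc (so \o h) = trunc so.
  by apply: functional_extensionality => X; rewrite /trunc /=; case: ifP => // ltX; rewrite /h ltX.
suff -> : nv q (so \o h) = res q (nv q' so \o f) by [].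
apply: functional_extensionality => a; rewrite /nv {1 2}/res; case: ifP => // lta /=.
rewrite /res fq //; apply: num_eq => b ltb /=; congr so.
rewrite /h ifF; last by lia.
have -> : K + a * r + b - K = a * r + b by lia.
have rp : 0 < r by lia.
by rewrite divnMDl // modnMDl divn_small // modn_small // addn0.
Qed.

Lemma res_nv q A (so : sets A) : res q (nv q so) = nv q so.
Proof. by apply: functional_extensionality => a; rewrite /nv /res; case: (a < q). Qed.

Lemma Gnum_ex q P : Gnum q.+1 P ->
  Gnum q (fun A so v => exists2 i, i < cap A r & P A so (upd (res q v) q i)).
Proof.
rewrite /Gnum mulSn [r + _]addnC addnA => /Gdef_ex; apply: Gdef_ext => A so.
by split=> [][i lti Di]; exists i => //; move: Di; rewrite trunc_set ?leq_addr // nv_set // res_nv.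
Qed.

Definition chain_of q (B St : forall A : str s, sets A -> (nat -> nat) -> Prop)
    (A : str s) (so : sets A) (v : nat -> nat) : nat -> nat -> Prop :=
  chain (cap A r) (fun c => B A so (upd (res q v) q c))
    (fun x c c' => St A so (upd (upd (upd (res q v) q x) q.+1 c) q.+2 c')).

(** A Horn program whose items are pairs, coded as [x * cap A r + c] in a block of width [r + r].
    Every clause has at most one premise, which steps [x] down by one, so a derivation has [x.+1]
    steps and [cap A r] copies suffice. *)
Lemma Gnum_chain q B St : Gnum q.+1 B -> Gnum q.+3 St ->
  Gnum q.+2 (fun A so v => chain_of q B St so v (v q) (v q.+1)).
Proof.
move=> dB dSt; set K1 := K + q * r.
(* An item occupies the numbers [q] (position) and [q.+1] (value); [B] expects the value at [q]. *)
pose f0 a := if a == q then q.+1 else a.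
(* In a step the conclusion sits at [q], [q.+1] and the premise at [q.+2], [q.+3]; [St] expects the
   old position, the old value and the new value, in this order. *)
pose f1 a := if a == q then q.+2 else if a == q.+1 then q.+3 else if a == q.+2 then q.+1 else a.
have d0 : Gnum q.+2 (fun A so v => v q = 0 /\ B A so (res q.+1 (v \o f0))).
  apply: Gnum_and; first by apply: FOnum_Gnum; apply: FOnum_0.
  by apply: Gnum_subst dB => a; rewrite /f0; case: (eqVneq a q); lia.
have d1 : Gnum q.+4 (fun A so v => v q = (v q.+2).+1 /\ St A so (res q.+3 (v \o f1))).
  apply: Gnum_and; first by apply: FOnum_Gnum; apply: FOnum_succ; lia.
  by apply: Gnum_subst dSt => a; rewrite /f1; case: (eqVneq a q); case: (eqVneq a q.+1); case: (eqVneq a q.+2); lia.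
have e2 : K + q.+2 * r = K1 + (r + r) by rewrite /K1 !mulSn; lia.
have e4 : K + q.+4 * r = K1 + (r + r) + (r + r) by rewrite /K1 !mulSn; lia.
rewrite /Gnum e2 in d0; rewrite /Gnum e4 in d1.
have d2 : Gdef (K1 + (r + r) + (r + r) + (r + r)) (fun (A : str s) (so : sets A) => false).
  exact/FO_Gdef/FOdef_cst.
set R0 := (fun A so => _) in d0; set R1 := (fun A so => _) in d1; set R2 := (fun A so => _) in d2.
have leK : K <= K1 by rewrite leq_addr.
have capM (A : str s) : cap A (r + r) = cap A r * cap A r by rewrite capD.
have decode (A : str s) X : X < cap A (r + r) -> exists x c, [/\ x < cap A r, c < cap A r & X = x * cap A r + c].
  rewrite capM => ltX; exists (X %/ cap A r), (X %% cap A r).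
  by rewrite ltn_divLR ?cap_gt0 // ltn_mod cap_gt0 -divn_eq.
have encode (A : str s) x c : x < cap A r -> c < cap A r -> x * cap A r + c < cap A (r + r).
  rewrite capM => ltx ltc; apply: (@leq_trans (x.+1 * cap A r)); first by rewrite mulSn; lia.
  by rewrite leq_mul2r ltx orbT.
have set2 A (so : sets A) p x c : x < cap A r -> c < cap A r ->
    nv p.+2 (setnum (K + p * r) (r + r) (x * cap A r + c) so) = upd (upd (nv p so) p x) p.+1 c.
  move=> ltx ltc; rewrite setnum_cat //.
  have -> : K + p * r + r = K + p.+1 * r by rewrite mulSn; lia.
  by rewrite nv_set // nv_set.
have R0E A (so : sets A) x c : x < cap A r -> c < cap A r ->
    R0 A (setnum K1 (r + r) (x * cap A r + c) so) <->
    x = 0 /\ B A (trunc so) (upd (nv q so) q c).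
  move=> ltx ltc; rewrite /R0 trunc_set // set2 // {1 2}/upd eqxx ltn_eqF //.
  suff -> : res q.+1 (upd (upd (nv q so) q x) q.+1 c \o f0) = upd (nv q so) q c by [].
  apply: functional_extensionality => a; rewrite /res /upd /f0 /=.
  have [->|neq] := eqVneq a q; first by rewrite ltnSn eqxx.
  case: ltnP => [lta|lea]; first by rewrite ?(negbTE neq) (_ : (a == q.+1) = false); [|lia].
  by rewrite /nv /res ltnNge ltnW.
have R1E A (so : sets A) x c y d : x < cap A r -> c < cap A r -> y < cap A r -> d < cap A r ->
    R1 A (setnum (K1 + (r + r)) (r + r) (y * cap A r + d)
            (setnum K1 (r + r) (x * cap A r + c) so)) <->
    x = y.+1 /\ St A (trunc so) (upd (upd (upd (nv q so) q y) q.+1 d) q.+2 c).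
  move=> ltx ltc lty ltd; rewrite /R1 !trunc_set //; last by lia.
  rewrite -e2 set2 // set2 // {1 2 3 4 5 6 7}/upd !eqxx.
  have -> : q == q.+3 = false by lia.
  have -> : q == q.+2 = false by lia.
  have -> : q == q.+1 = false by lia.
  have -> : q.+2 == q.+3 = false by lia.
  set v1 := res _ _; set v2 := upd _ q.+2 c; suff -> : v1 = v2 by [].
  apply: functional_extensionality => a; rewrite /v1 /v2 /res /upd /=.
  have f1q : f1 q = q.+2 by rewrite /f1 eqxx.
  have f1q1 : f1 q.+1 = q.+3 by rewrite /f1 eqxx gtn_eqF.
  have f1q2 : f1 q.+2 = q.+1 by rewrite /f1 eqxx !gtn_eqF.
  have [->|n0] := eqVneq a q; first by rewrite f1q; do ![case: ifP => //]; lia.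
  have [->|n1] := eqVneq a q.+1; first by rewrite f1q1; do ![case: ifP => //]; lia.
  have [->|n2] := eqVneq a q.+2; first by rewrite f1q2; do ![case: ifP => //]; lia.
  have -> : f1 a = a by rewrite /f1 !ifF //; lia.
  by rewrite /nv /res; do ![case: ifP => //]; lia.
have sound A (so : sets A) m x c : x < cap A r -> c < cap A r ->
    hders (hrule K1 (r + r) R0 R1 R2 so) m [:: x * cap A r + c] ->
    chain_of q B St (trunc so) (nv q so) x c.
  elim: m x c => [|m IH] x c ltx ltc /hders_inv[ys [m' [//= em [_ rx] hm]]].
  case: em hm => <-; case: ys rx => [|Y [|Z [|? ?]]] //=.
  - move=> R0x _; have [-> Bc] := proj1 (R0E _ _ _ _ ltx ltc) R0x.
    by apply: chain0; rewrite ?res_nv.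
  - case=> ltY R1Y hY; have [y [d [lty ltd eqY]]] := decode _ _ ltY; subst Y.
    have [eqx Sc] := proj1 (R1E _ _ _ _ _ _ ltx ltc lty ltd) R1Y; subst x.
    by apply: (chainS (IH _ _ lty ltd hY)) => //; rewrite res_nv.
  - by case.
have complete A (so : sets A) x c : chain_of q B St (trunc so) (nv q so) x c ->
    [/\ x < cap A r, c < cap A r & hders (hrule K1 (r + r) R0 R1 R2 so) x.+1 [:: x * cap A r + c]].
  elim=> {x c} [c ltc Bc|y d c _ [lty ltd hy] ltx ltc Sc].
    split; rewrite ?cap_gt0 //; apply: (@hders_cons _ _ _ [::]); last exact: hders_nil.
    split; first by rewrite encode ?cap_gt0.
    by apply/R0E; rewrite ?cap_gt0 //; split=> //; rewrite res_nv in Bc.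
  split=> //; apply: (@hders_cons _ _ _ [:: y * cap A r + d]) => //.
  split; first by rewrite encode.
  split; first by rewrite encode.
  by apply/R1E => //; split=> //; rewrite res_nv in Sc.
have bounded A (so : sets A) X m : hders (hrule K1 (r + r) R0 R1 R2 so) m [:: X] ->
    exists2 m', m' <= cap A r & hders (hrule K1 (r + r) R0 R1 R2 so) m' [:: X].
  move=> hX; have [ys [m' [_ [ltX _] _]]] := hders_inv hX.
  have [x [c [ltx ltc eqX]]] := decode _ _ ltX; subst X.
  by have [_ _ hx] := complete _ _ _ _ (sound _ _ _ _ _ ltx ltc hX); exists x.+1.
have := Gdef_horn d0 d1 d2 bounded; rewrite /Gnum -e2; apply: Gdef_ext => A so.
have -> : num K1 (r + r) so = nv q.+2 so q * cap A r + nv q.+2 so q.+1.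
  rewrite num_cat -[2 ^ _]/(cap A r) !nvE //.
  by have -> : K + q.+1 * r = K1 + r by rewrite /K1 mulSn; lia.
rewrite /chain_of.
have resE : res q (nv q.+2 so) = res q (nv q so).
  by apply: functional_extensionality => a; rewrite /nv /res; case: ltnP => // lta; rewrite ifT //; lia.
rewrite resE; split=> [[m hm]|ch].
  exact: (sound _ _ _ _ _ (nv_lt _ _ _) (nv_lt _ _ _) hm).
by have [_ _ hx] := complete _ _ _ _ ch; exists (nv q.+2 so q).+1.
Qed.

(* The chain that can advance past [x] only if [P] holds at [x] reaches the largest number iff [P] holds below it. *)
Lemma Gnum_all q P : Gnum q.+1 P ->
  Gnum q (fun A so v => forall i, i < cap A r -> P A so (upd (res q v) q i)).
Proof.
move=> dP.
have dB : Gnum q.+1 (fun A so v => v q = 0) by apply/FOnum_Gnum/FOnum_0.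
have dSt : Gnum q.+3 (fun A so v => v q.+2 = 0 /\ P A so (res q.+1 (v \o id))).
  apply: Gnum_and; first by apply/FOnum_Gnum/FOnum_0.
  by apply: Gnum_subst dP => a; lia.
have dC := Gnum_chain dB dSt.
(* A step tests [P] at the position that it leaves, so the largest number has to be tested
   separately. *)
have dP2 : Gnum q.+2 (fun A so v => P A so (res q.+1 (v \o id))).
  by apply: Gnum_subst dP => a; lia.
have dm : Gnum q.+2 (fun A so v => v q = (cap A r).-1) by apply/FOnum_Gnum/FOnum_max.
apply: Gnum_ext (Gnum_ex (Gnum_ex (Gnum_and dm (Gnum_and dC dP2)))) => A so v ltv.
set M := cap A r; have M_gt0 : 0 < M := cap_gt0 A r.
have res1 x c : res q.+1 (upd (res q.+1 (upd (res q v) q x)) q.+1 c \o id) = upd (res q v) q x.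
  by apply: functional_extensionality => a; rewrite /res /upd /=; do ![case: ifP => //]; lia.
have res2 x c : res q (upd (res q.+1 (upd (res q v) q x)) q.+1 c) = res q v.
  by apply: functional_extensionality => a; rewrite /res /upd /=; do ![case: ifP => //]; lia.
have res3 x c d : res q.+1 (upd (upd (upd (res q v) q x) q.+1 c) q.+2 d \o id) = upd (res q v) q x.
  by apply: functional_extensionality => a; rewrite /res /upd /=; do ![case: ifP => //]; lia.
have updq x c : upd (res q.+1 (upd (res q v) q x)) q.+1 c q = x.
  by rewrite /upd /res ltnSn eqxx ltn_eqF.
have updq1 x c : upd (res q.+1 (upd (res q v) q x)) q.+1 c q.+1 = c.
  by rewrite /upd eqxx.
split=> [[x ltx [c ltc]]|allP].
  rewrite updq updq1 res1 /chain_of res2 => -[eqx [ch Px]].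
  have Pbelow : forall i, i < x -> P A so (upd (res q v) q i).
    elim: {eqx Px} ch => {x ltx c ltc} [c //|x c c' _ IH ltx ltc' [_ Px]] i.
    rewrite ltnS leq_eqVlt => /orP[/eqP ->|/IH//].
    by move: Px; rewrite res3.
  move=> i lti; have [->//|neq] := eqVneq i x.
  by apply: Pbelow; rewrite eqx in neq *; lia.
exists M.-1; first by lia.
exists 0 => //; rewrite updq updq1 res1 /chain_of res2; split=> //; split; last by apply: allP; lia.
have : M.-1 < M by lia.
elim: M.-1 => [|x IH] ltx; first by apply: chain0 => //; rewrite /upd eqxx.
apply: (chainS (IH _)) => //; first by lia.
split; first by rewrite /upd eqxx.
by rewrite res3; apply: allP; lia.
Qed.

End Numbers.

(** * Complementation by inductive counting *)

Section Counting.
Variables s K r : nat.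
Variables (item_true item_axiom : forall A : str s, sets A -> nat -> bool).
Variable (item_rule : forall A : str s, sets A -> nat -> nat -> nat -> bool).
Hypothesis dTr : Gnum K r 1 (fun A so v => item_true so (v 0)).
Hypothesis dNAx : Gnum K r 1 (fun A so v => ~~ item_axiom so (v 0)).
Hypothesis dRl : FOnum K r 3 (fun A so v => item_rule so (v 0) (v 1) (v 2)).
Hypothesis item_rule_lt : forall A so x y z, x < cap A r -> y < cap A r -> z < cap A r ->
  @item_rule A so x y z -> y < x /\ z < x.
Hypothesis item_trueE : forall A so x, x < cap A r -> @item_true A so x <->
  item_axiom so x \/ exists y z, [/\ y < cap A r, z < cap A r, item_rule so x y z, item_true so y & item_true so z].

Definition cnt (A : str s) (so : sets A) (x : nat) := count (item_true so) (iota 0 x).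
Definition cnt_but (A : str s) (so : sets A) (x0 x : nat) :=
  count (fun y => item_true so y && (y != x0)) (iota 0 x).

Lemma cntS (A : str s) (so : sets A) x : cnt so x.+1 = cnt so x + item_true so x.
Proof. by rewrite /cnt -addn1 iotaD count_cat /= addn0. Qed.

Lemma cnt_butS (A : str s) (so : sets A) x0 x : cnt_but so x0 x.+1 = cnt_but so x0 x + (item_true so x && (x != x0)).
Proof. by rewrite /cnt_but -addn1 iotaD count_cat /= addn0. Qed.

Lemma cnt_le (A : str s) (so : sets A) x : cnt so x <= x.
Proof. by rewrite -{2}(size_iota 0 x) count_size. Qed.

Lemma cnt_butE (A : str s) (so : sets A) x0 x : cnt_but so x0 x + (item_true so x0 && (x0 < x)) = cnt so x.
Proof.
elim: x => [|x IH]; first by rewrite ltn0 andbF.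
rewrite cntS cnt_butS -IH ltnS leq_eqVlt.
by have [->|] := eqVneq x0 x; rewrite ?ltnn ?orbT /=; case: (item_true _ _) => /=; lia.
Qed.

(** A step may keep the value, or raise it at a true item other than [v 0]. The reachable values are
    those up to the real count: a lower bound is certified by true items alone. *)
Lemma Gnum_cnt_but : Gnum K r 3 (fun A so v => v 2 <= cnt_but so (v 0) (v 1)).
Proof.
have dB : Gnum K r 2 (fun (A : str s) (so : sets A) v => v 1 = 0) by apply/FOnum_Gnum/FOnum_0.
have dS : Gnum K r 4 (fun (A : str s) (so : sets A) v => v 3 = v 2 \/
    v 3 = (v 2).+1 /\ (item_true so (v 1) /\ ~ v 1 = v 0)).
  apply: Gnum_or; first by apply/FOnum_Gnum/FOnum_eq.
  apply: Gnum_and; first by apply/FOnum_Gnum/FOnum_succ.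
  apply: Gnum_and; last by apply/FOnum_Gnum/FOnum_not/FOnum_eq.
  exact: (Gnum_subst (f := fun _ => 1) _ dTr).
apply: Gnum_ext (Gnum_chain dB dS) => A so v ltv.
have {}ltv a := ltv a; rewrite /chain_of /upd /res /=.
split=> [|]; last first.
  move: (v 1) (v 2) (ltv 1) (ltv 2) => x; elim: x => [|x IH] c ltx ltc.
    by rewrite leqn0 => /eqP ->; apply: chain0.
  rewrite cnt_butS; case: (boolP (_ && _)) => [/andP[Trx nex]|_] lec; last first.
    by apply: (@chainS _ _ _ _ c) => //; [apply: IH; lia | left].
  case: c ltc lec => [|c] ltc lec.
    by apply: (@chainS _ _ _ _ 0) => //; [apply: IH; lia | left].
  by apply: (@chainS _ _ _ _ c) => //; [apply: IH; lia | right; split=> //; split=> //; apply/eqP].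
elim=> {ltv} [c _ -> //|x c c' _ IH _ _ [->|[-> [Trx nex]]]]; rewrite cnt_butS; first by lia.
by rewrite Trx (introN eqP nex); lia.
Qed.

(* Holds for the right count [c] of true items below [x] iff [x] is false: an item [y] below [x] is false
   iff [c] true items below [x] can be found without it. *)
Definition refuted (A : str s) (so : sets A) (x c : nat) : Prop :=
  ~~ item_axiom so x /\ forall y, y < cap A r -> forall z, z < cap A r ->
  ~ item_rule so x y z \/ c <= cnt_but so y x \/ c <= cnt_but so z x.

Lemma Gnum_refuted : Gnum K r 2 (fun A so v => refuted so (v 0) (v 1)).
Proof.
have d4 : Gnum K r 4 (fun A so v => ~ item_rule so (v 0) (v 2) (v 3) \/
    (v 1 <= cnt_but so (v 2) (v 0) \/ v 1 <= cnt_but so (v 3) (v 0))).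
  apply: Gnum_or.
    have dN : Gnum K r 3 (fun A so v => ~ item_rule so (v 0) (v 1) (v 2)) by apply/FOnum_Gnum/FOnum_not.
    by apply: (Gnum_subst (f := nth 0 [:: 0; 2; 3]) _ dN) => -[|[|[|]]].
  apply: Gnum_or.
    by apply: (Gnum_subst (f := nth 0 [:: 2; 0; 1]) _ Gnum_cnt_but) => -[|[|[|]]].
  by apply: (Gnum_subst (f := nth 0 [:: 3; 0; 1]) _ Gnum_cnt_but) => -[|[|[|]]].
apply: Gnum_and; first exact: (Gnum_subst (f := fun _ => 0) _ dNAx).
exact: (Gnum_all (Gnum_all d4)).
Qed.

(** For [y] below [x], leaving [y] out keeps the exact count iff [y] is false. Premises are below
    their conclusion, so this decides every clause for [x]. *)
Lemma refuted_cnt (A : str s) (so : sets A) x : x < cap A r -> refuted so x (cnt so x) <-> ~~ item_true so x.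
Proof.
move=> ltx; have cntF y : y < x -> (cnt so x <= cnt_but so y x) = ~~ item_true so y.
  by move=> lty; rewrite -(cnt_butE so y x) lty andbT; case: (item_true so y); lia.
split=> [[nAx H]|/negP nTr].
  apply/negP => /(item_trueE so ltx)[|[y [z [lty ltz Rxyz Ty Tz]]]]; first exact/negP.
  have [ltyx ltzx] := item_rule_lt ltx lty ltz Rxyz.
  by case: (H y lty z ltz) => //; rewrite !cntF // Ty Tz => -[].
split=> [|y lty z ltz]; first by apply/negP => Axx; apply/nTr/item_trueE => //; left.
case: (boolP (item_rule so x y z)) => Rxyz; last by left.
have [ltyx ltzx] := item_rule_lt ltx lty ltz Rxyz.
rewrite !cntF //; case: (boolP (item_true so y)) => Ty; last by right; left.
right; right; apply/negP => Tz; apply/nTr/item_trueE => //; right.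
by exists y, z.
Qed.

(** The chain runs through the exact counts. As long as the current one is exact, [refuted] is
    correct at the next item, so either kind of step keeps it exact. *)
Lemma Gnum_cnt : Gnum K r 2 (fun A so v => v 1 = cnt so (v 0)).
Proof.
have dB : Gnum K r 1 (fun (A : str s) (so : sets A) v => v 0 = 0) by apply/FOnum_Gnum/FOnum_0.
have dS : Gnum K r 3 (fun (A : str s) (so : sets A) v =>
    v 2 = (v 1).+1 /\ item_true so (v 0) \/ v 2 = v 1 /\ refuted so (v 0) (v 1)).
  apply: Gnum_or; apply: Gnum_and.
  - exact/FOnum_Gnum/FOnum_succ.
  - exact: (Gnum_subst (f := fun _ => 0) _ dTr).
  - exact/FOnum_Gnum/FOnum_eq.
  - by apply: (Gnum_subst (f := id) _ Gnum_refuted) => a; lia.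
apply: Gnum_ext (Gnum_chain dB dS) => A so v ltv.
rewrite /chain_of /upd /res /=; split=> [|->].
  elim=> {v ltv} [c _ -> //|x c c' ch -> ltx _ H].
  have ltx' : x < cap A r by lia.
  rewrite cntS; case: H => [[-> ->]|[-> /(refuted_cnt so ltx')/negbTE ->]]; first by rewrite addn1.
  by rewrite addn0.
elim: (v 0) (ltv 0) => [|x IH] ltx; first by apply: chain0 => //; rewrite cap_gt0.
have ltx' : x < cap A r by lia.
have lec := cnt_le so x.+1.
apply: (chainS (IH ltx')) => //; first by lia.
rewrite cntS; case: (boolP (item_true so x)) => Trx; first by left; rewrite addn1.
by right; rewrite addn0; split=> //; apply/refuted_cnt.
Qed.

Lemma Gnum_compl : Gnum K r 1 (fun A so v => ~~ item_true so (v 0)).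
Proof.
apply: Gnum_ext (Gnum_ex (Gnum_and Gnum_cnt Gnum_refuted)) => A so v ltv.
rewrite /upd /res /=; split=> [[c _ [-> /refuted_cnt]]|nTr]; first exact.
exists (cnt so (v 0)); first by have := cnt_le so (v 0); have := ltv 0; lia.
by split=> //; apply/refuted_cnt.
Qed.

End Counting.

(** * The word problem of a groupoid *)

Section Truth.
Variables s K r t : nat.
Variables (item_true item_axiom : forall A : str s, sets A -> nat -> bool).
Variable (item_rule : forall A : str s, sets A -> nat -> nat -> nat -> bool).
Variable wt : str s -> nat -> nat.
Hypothesis dAx : Gnum K r 1 (fun A so v => item_axiom so (v 0)).
Hypothesis dRl : FOnum K r 3 (fun A so v => item_rule so (v 0) (v 1) (v 2)).
Hypothesis item_trueE : forall A so x, x < cap A r -> @item_true A so x <->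
  item_axiom so x \/ exists y z, [/\ y < cap A r, z < cap A r, item_rule so x y z, item_true so y & item_true so z].
Hypothesis wt_cap : forall A x, x < cap A r -> 0 < wt A x <= cap A t.
Hypothesis wt_rule : forall A so x y z, x < cap A r -> y < cap A r -> z < cap A r ->
  @item_rule A so x y z -> item_true so y -> item_true so z -> wt A y + wt A z < wt A x.

(** A true item has a derivation of size at most its weight, since the weights of two premises add
    up to less than that of the conclusion. This is the bound required by [Gdef_horn]. *)
Lemma Gnum_true : Gnum K r 1 (fun A so v => item_true so (v 0)).
Proof.
have e1 : K + 1 * r = K + r by rewrite mul1n.
have e3 : K + 3 * r = K + r + r + r by rewrite !mulSn; lia.
have d0 := dAx; have d2 : Gnum K r 3 (fun A so v => item_rule so (v 0) (v 1) (v 2)) by apply: FOnum_Gnum.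
rewrite /Gnum e1 in d0; rewrite /Gnum e3 in d2.
have d1 : Gdef (K + r + r) (fun (A : str s) (so : sets A) => false) by exact/FO_Gdef/FOdef_cst.
set R0 := (fun A so => _) in d0; set R2 := (fun A so => _) in d2; set R1 := (fun A so => _) in d1.
have e2 : K + 2 * r = K + r + r by rewrite !mulSn; lia.
have e0 : K + 0 * r = K by rewrite mul0n addn0.
have set0 A (so : sets A) x : x < cap A r -> nv K r 1 (setnum K r x so) = upd (nv K r 0 so) 0 x.
  by move=> ltx; rewrite -(nv_set K) // e0.
have set1 A (so : sets A) x : x < cap A r -> nv K r 2 (setnum (K + r) r x so) = upd (nv K r 1 so) 1 x.
  by move=> ltx; rewrite -(nv_set K) // e1.
have set2 A (so : sets A) x : x < cap A r -> nv K r 3 (setnum (K + r + r) r x so) = upd (nv K r 2 so) 2 x.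
  by move=> ltx; rewrite -(nv_set K) // e2.
have R0E A (so : sets A) x : x < cap A r -> R0 A (setnum K r x so) <-> item_axiom (trunc K so) x.
  move=> ltx; by rewrite /R0 trunc_set // set0.
have R2E A (so : sets A) x y z : x < cap A r -> y < cap A r -> z < cap A r ->
    R2 A (setnum (K + r + r) r z (setnum (K + r) r y (setnum K r x so)))
    <-> item_rule (trunc K so) x y z.
  move=> ltx lty ltz; rewrite /R2 !trunc_set //; [|lia|lia].
  by rewrite set2 // set1 // set0.
have sound A (so : sets A) m xs : hders (hrule K r R0 R1 R2 so) m xs -> all (item_true (trunc K so)) xs.
  elim=> {m xs} [//|m x ys xs [ltx rx] _ IH] /=.
  case: ys rx IH => [|y [|z [|? ?]]] //=.
  - move=> R0x ->; rewrite andbT; apply/item_trueE => //; left; exact: (proj1 (R0E _ _ _ ltx) R0x).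
  - by case.
  - case=> ltz lty R2x /and3P[Tz Ty ->]; rewrite andbT; apply/item_trueE => //; right.
    by exists z, y; split=> //; exact: (proj1 (R2E _ _ _ _ _ ltx ltz lty) R2x).
(* Stated for an item on top of other goals, so that the derivations of two premises can be
   stacked. *)
have complete A (so : sets A) w : forall x m xs, wt A x <= w -> x < cap A r ->
    item_true (trunc K so) x -> hders (hrule K r R0 R1 R2 so) m xs ->
    exists2 m', m' <= wt A x + m & hders (hrule K r R0 R1 R2 so) m' (x :: xs).
  elim: w => [|w IH] x m xs lew ltx Trx hxs; first by have := wt_cap ltx; lia.
  have wtx := wt_cap ltx.
  case/item_trueE: (Trx) => // [Axx|[y [z [lty ltz Rx Ty Tz]]]].
    exists m.+1; first by lia.
    by apply: (@hders_cons _ _ _ [::]) => //; split=> //; apply/R0E.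
  have lt := wt_rule ltx lty ltz Rx Ty Tz.
  have wty := wt_cap lty; have wtz := wt_cap ltz.
  have [m1 le1 h1] := IH z m xs ltac:(lia) ltz Tz hxs.
  have [m2 le2 h2] := IH y m1 _ ltac:(lia) lty Ty h1.
  exists m2.+1; first by lia.
  by apply: (@hders_cons _ _ _ [:: z; y]) => //; split=> //; split=> //; apply/R2E.
have bounded A (so : sets A) x m : hders (hrule K r R0 R1 R2 so) m [:: x] ->
    exists2 m', m' <= cap A t & hders (hrule K r R0 R1 R2 so) m' [:: x].
  move=> hx; have [ys [m1 [_ [ltx _] _]]] := hders_inv hx.
  have := sound _ _ _ _ hx; rewrite /= andbT => Trx.
  have [m' lem hm] := complete _ _ _ _ _ _ (leqnn _) ltx Trx (hders_nil _).
  by exists m' => //; have := wt_cap ltx; lia.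
have := Gdef_horn d0 d1 d2 bounded; rewrite /Gnum e1; apply: Gdef_ext => A so.
have -> : nv K r 1 so 0 = num K r so by rewrite nvE // mul0n addn0.
split=> [[m /sound]|Trx]; first by rewrite /= andbT.
by have [m' _ hm] := complete _ _ _ _ _ _ (leqnn _) (num_lt _ _ _) Trx (hders_nil _); exists m'.
Qed.

End Truth.

Inductive bval (T : Type) (op : T -> T -> T) : seq T -> T -> Prop :=
| bval1 x : bval op [:: x] x
| bval2 u v a b : bval op u a -> bval op v b -> bval op (u ++ v) (op a b).

Lemma bval_size (T : Type) (op : T -> T -> T) u a : bval op u a -> 0 < size u.
Proof. by elim=> // {}u v b c _ IH _ _; rewrite size_cat; lia. Qed.

Lemma bvalsP (T : finType) (op : T -> T -> T) w g : g \in bvals op w <-> bval op w g.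
Proof.
rewrite /bvals; suff H f : forall w g, size w <= f -> g \in bvals_aux op f w <-> bval op w g by apply: H.
elim: f => [|f IH] {}w {}g lef.
  by case: w lef => //= _; rewrite inE; split=> // H; have := bval_size H.
have bigE (w' : seq T) : size w' <= f.+1 -> size w' != 1 ->
    g \in \bigcup_(i < size w' | 0 < i) [set op a b | a in bvals_aux op f (take i w'), b in bvals_aux op f (drop i w')]
    <-> bval op w' g.
  move=> le1 n1; split=> [/bigcupP[i i_gt0 /imset2P[a b Ha Hb ->]]|].
    rewrite -(cat_take_drop i w').
    have lti := ltn_ord i.
    by apply: bval2; apply/IH => //; rewrite ?size_takel ?size_drop; lia.
  move=> H; case: H le1 n1 => [x //|u v a b Hu Hv] le1 n1.
  have u0 := bval_size Hu; have v0 := bval_size Hv; rewrite size_cat in le1.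
  have ltu : size u < size (u ++ v) by rewrite size_cat; lia.
  apply/bigcupP; exists (Ordinal ltu) => //=; apply/imset2P; exists a b => //=.
    by rewrite take_size_cat //; apply/IH => //; lia.
  by rewrite drop_size_cat //; apply/IH => //; lia.
case: w lef => [|x [|y w]] lef; [exact: bigE | | exact: bigE].
rewrite /= inE; split=> [/eqP ->|H]; first exact: bval1.
move: {-2}[:: x] (erefl [:: x]) H => l eql H; case: H eql => [y [->]|u v a b Hu Hv eqx] //.
have := bval_size Hu; have := bval_size Hv; have := congr1 size eqx.
by rewrite size_cat /=; lia.
Qed.

Lemma bval_catP (T : Type) (op : T -> T -> T) w g : bval op w g <->
  w = [:: g] \/ exists u v a b, [/\ w = u ++ v, bval op u a, bval op v b & op a b = g].
Proof.
split=> [[x|u v a b Hu Hv]|[->|[u [v [a [b [-> Hu Hv <-]]]]]]]; [by left | | exact: bval1 | exact: bval2].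
by right; exists u, v, a, b.
Qed.

Section FiniteChoice.
Variables (s K : nat) (T : finType).

Lemma FOdef_fin (D : T -> forall A : str s, sets A -> Prop) :
  (forall i, FOdef K (D i)) -> FOdef K (fun A so => exists i, D i A so).
Proof.
move=> dD; suff H (l : seq T) : FOdef K (fun (A : str s) (so : sets A) => exists2 i, i \in l & D i A so).
  by apply: FOdef_ext (H (enum T)) => A so; split=> [[i _ Di]|[i Di]]; exists i; rewrite ?mem_enum.
elim: l => [|i l IH].
  by apply: FOdef_ext (FOdef_cst s K false) => A so; split=> // -[].
apply: FOdef_ext (FOdef_or (dD i) IH) => A so; split=> [[Di|[j jl Dj]]|[j]].
- by exists i; rewrite ?mem_head.
- by exists j; rewrite // in_cons jl orbT.
- by rewrite in_cons => /orP[/eqP ->|jl] Dj; [left | right; exists j].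
Qed.

Lemma Gdef_fin (D : T -> forall A : str s, sets A -> Prop) :
  (forall i, Gdef K (D i)) -> Gdef K (fun A so => exists i, D i A so).
Proof.
move=> dD; suff H (l : seq T) : Gdef K (fun (A : str s) (so : sets A) => exists2 i, i \in l & D i A so).
  by apply: Gdef_ext (H (enum T)) => A so; split=> [[i _ Di]|[i Di]]; exists i; rewrite ?mem_enum.
elim: l => [|i l IH].
  by apply: Gdef_ext (FO_Gdef (FOdef_cst s K false)) => A so; split=> // -[].
apply: Gdef_ext (Gdef_or (dD i) IH) => A so; split=> [[Di|[j jl Dj]]|[j]].
- by exists i; rewrite ?mem_head.
- by exists j; rewrite // in_cons jl orbT.
- by rewrite in_cons => /orP[/eqP ->|jl] Dj; [left | right; exists j].
Qed.

End FiniteChoice.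

Section WordProblem.
Variables (s K k m : nat) (G : gquant m).
Variable u : forall A : str s, sets A -> nat -> 'I_m.+1.
Hypothesis udep : forall A so so', agree K so so' -> @u A so = u so'.
Hypothesis du : forall g, Gdef (K + k) (fun A so => u so (num K k so) = g).

(* An item number is split into fields [j], [i'] (of width [k]) and an element [a] of the groupoid (coded by the first nonempty one of [m] sets);
   it says that the letters of positions [cap - 1 - i'], ..., [j] can be bracketed to give [a]. Complementing the left end makes subintervals smaller items. *)
Let r := k + k + m.

Definition elt b (A : str s) (so : sets A) : 'I_m.+1 :=
  inord (find (fun a => so (b + a) != set0) (iota 0 m)).

Definition item (A : str s) (x : nat) : sets A := setnum 0 r x (fun _ => set0).
Definition fJ (A : str s) (x : nat) := num 0 k (item A x).
Definition fI (A : str s) (x : nat) := num k k (item A x).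
Definition fG (A : str s) (x : nat) := elt (k + k) (item A x).

Lemma elt_eq b b' A (so so' : sets A) : (forall a, a < m -> so (b + a) = so' (b' + a)) ->
  elt b so = elt b' so'.
Proof.
move=> eqs; rewrite /elt; congr inord; apply: eq_in_find => a.
by rewrite mem_iota => /andP[_ lta]; rewrite eqs.
Qed.

Lemma item_num b A (so : sets A) a : a < r -> item A (num b r so) a = so (b + a).
Proof.
move=> lta; rewrite -[a in LHS]add0n /item; apply/setP=> j.
by rewrite in_setnum // -num_bit.
Qed.

Lemma fJE b A (so : sets A) : fJ A (num b r so) = num b k so.
Proof. by apply: num_eq => a lta; rewrite add0n item_num //; lia. Qed.

Lemma fIE b A (so : sets A) : fI A (num b r so) = num (b + k) k so.
Proof. by apply: num_eq => a lta; rewrite item_num ?addnA //; lia. Qed.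

Lemma fGE b A (so : sets A) : fG A (num b r so) = elt (b + (k + k)) so.
Proof. by apply: elt_eq => a lta; rewrite item_num ?addnA //; lia. Qed.

Lemma itemP (A : str s) j i g : j < cap A k -> i < cap A k -> exists x,
  [/\ x < cap A r, fJ A x = j, fI A x = i & fG A x = g].
Proof.
move=> ltj lti.
(* Only the [g]-th set is nonempty; for [g = m] it lies beyond the [m] sets read by [elt], which are
   then all empty and code the last element. *)
pose so0 : sets A := fun X => if X == k + k + g then setT else set0.
exists (num 0 r (setnum 0 k j (setnum k k i so0))).
split; first exact: num_lt.
- by rewrite fJE num_setnum.
- by rewrite fIE add0n num_setnum_out ?num_setnum //; right.
- rewrite fGE add0n; have -> : elt (k + k) (setnum 0 k j (setnum k k i so0)) = elt (k + k) so0.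
    by apply: elt_eq => a _; rewrite !setnum_out //; lia.
  apply: val_inj; rewrite /elt /=; have leg : g <= m by rewrite -ltnS.
  have neT : [set: 'I_(sn A).+1] != set0 by apply/set0Pn; exists ord0.
  have -> : find (fun a => so0 (k + k + a) != set0) (iota 0 m) = g; last by rewrite inordK.
  have -> : iota 0 m = iota 0 g ++ iota (0 + g) (m - g) by rewrite -iotaD subnKC.
  rewrite find_cat size_iota.
  have -> : has (fun a => so0 (k + k + a) != set0) (iota 0 g) = false.
    apply/negbTE/hasPn => a; rewrite mem_iota => /andP[_ lta].
    by rewrite /so0 ifF ?eqxx //; lia.
  case: (m - g) => [|d] /=; first by rewrite addn0.
  by rewrite /so0 add0n eqxx neT addn0.
Qed.

Definition word (A : str s) (so : sets A) := [seq u so i | i <- iota 0 (cap A k)].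

(* The value [cap - 1 - i'] never underflows, as [i' < cap]. *)
Definition seg (A : str s) (so : sets A) i' j := drop ((cap A k).-1 - i') (take j.+1 (word so)).

Definition item_true (A : str s) (so : sets A) (x : nat) : bool :=
  ((cap A k).-1 <= fI A x + fJ A x) && (fG A x \in bvals (@gop m G) (seg so (fI A x) (fJ A x))).

Definition item_axiom (A : str s) (so : sets A) (x : nat) : bool :=
  (fI A x + fJ A x == (cap A k).-1) && (u so (fJ A x) == fG A x).

(** [y] keeps the left end of [x] and [z] its right end; the equation says that [z] starts just
    after [y] stops. *)
Definition item_rule (A : str s) (so : sets A) (x y z : nat) : bool :=
  [&& fI A y == fI A x, fJ A z == fJ A x, (fJ A y + fI A z).+1 == (cap A k).-1,
      fJ A y < fJ A x, fI A z < fI A x & gop G (fG A y) (fG A z) == fG A x].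

Lemma fJ_lt A x : fJ A x < cap A k. Proof. exact: num_lt. Qed.
Lemma fI_lt A x : fI A x < cap A k. Proof. exact: num_lt. Qed.

Lemma size_word A (so : sets A) : size (word so) = cap A k.
Proof. by rewrite size_map size_iota. Qed.

Lemma size_seg A (so : sets A) i j : i < cap A k -> j < cap A k -> (cap A k).-1 <= i + j ->
  size (seg so i j) = (i + j - (cap A k).-1).+1.
Proof. by move=> lti ltj le; rewrite /seg size_drop size_takel ?size_word; lia. Qed.

Lemma seg1 A (so : sets A) i j : i < cap A k -> j < cap A k -> i + j = (cap A k).-1 ->
  seg so i j = [:: u so j].
Proof.
move=> lti ltj eqij; have := @size_seg _ so _ _ lti ltj; rewrite eqij leqnn subnn => /(_ isT).
have -> : seg so i j = drop j (take j.+1 (word so)) by rewrite /seg; congr drop; lia.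
rewrite (take_nth (u so 0)) ?size_word // -cats1 drop_size_cat ?size_takel ?size_word //; last exact: ltnW.
by rewrite (nth_map 0) ?size_iota // nth_iota.
Qed.

Lemma seg_cat A (so : sets A) i j j1 i2 : i < cap A k -> j < cap A k ->
  (j1 + i2).+1 = (cap A k).-1 -> (cap A k).-1 <= i + j1 -> j1 < j -> i2 < i ->
  seg so i j = seg so i j1 ++ seg so i2 j.
Proof.
move=> lti ltj eqm le1 ltj1 lti2; rewrite /seg; set w := word so.
have -> : (cap A k).-1 - i2 = j1.+1 by lia.
have szw : size w = cap A k := size_word so.
rewrite -{1}[take j.+1 w](cat_take_drop j1.+1) take_takel; last by lia.
rewrite drop_cat size_takel; last by rewrite szw; lia.
by rewrite ifT //; lia.
Qed.

Lemma item_trueE A so x : x < cap A r -> @item_true A so x <-> item_axiom so x \/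
  exists y z, [/\ y < cap A r, z < cap A r, item_rule so x y z, item_true so y & item_true so z].
Proof.
move=> ltx; have ltI := fI_lt A x; have ltJ := fJ_lt A x.
split=> [/andP[le /bvalsP/bval_catP[eqs|[v1 [v2 [a [b [eqs Ha Hb eqg]]]]]]]|].
- left; have := size_seg so ltI ltJ le; rewrite eqs /= => eqsz.
  have eqij : fI A x + fJ A x = (cap A k).-1 by lia.
  by rewrite /item_axiom eqij eqxx /=; move: eqs; rewrite seg1 // => -[->].
- right; have := size_seg so ltI ltJ le; rewrite eqs size_cat => eqsz.
  pose n1 := @size 'I_m.+1 v1; pose n2 := @size 'I_m.+1 v2.
  have n1_gt0 : 0 < n1 := bval_size Ha; have n2_gt0 : 0 < n2 := bval_size Hb.
  rewrite -/n1 -/n2 in eqsz.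
  set P := (cap A k).-1 in le eqsz *; have PE : P = (cap A k).-1 by [].
  (* [v1] starts at position [P - fI A x] and has [n1] letters, so it ends at [j1]; [i2] is the
     complement of the start [j1.+1] of [v2]. *)
  pose j1 := P - fI A x + n1 - 1; pose i2 := P - j1.+1.
  have ltj1 : j1 < cap A k by rewrite /j1; lia.
  have lti2 : i2 < cap A k by rewrite /i2; lia.
  have [y [lty Jy Iy Gy]] := @itemP A j1 (fI A x) a ltj1 ltI.
  have [z [ltz Jz Iz Gz]] := @itemP A (fJ A x) i2 b ltJ lti2.
  have eqm : (j1 + i2).+1 = P by rewrite /i2 /j1; lia.
  have lej : P <= fI A x + j1 by rewrite /j1; lia.
  have ltj : j1 < fJ A x by rewrite /j1; lia.
  have lti : i2 < fI A x by rewrite /i2 /j1; lia.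
  exists y, z; rewrite /item_rule /item_true Jy Iy Gy Jz Iz Gz eqg !eqxx eqm !eqxx ltj lti -/P lej.
  have eqc := seg_cat so ltI ltJ eqm lej ltj lti.
  have sz1 := size_seg so ltI (ltn_trans ltj ltJ) lej.
  have [eq1 eq2] : v1 = seg so (fI A x) j1 /\ v2 = seg so i2 (fJ A x).
    have /eqP := etrans (esym eqs) eqc.
    by rewrite eqseq_cat; [move=> /andP[/eqP -> /eqP ->] | rewrite sz1 -[size _]/n1 -/P /j1; lia].
  rewrite eq1 in Ha; rewrite eq2 in Hb; split=> //; first exact/bvalsP.
  by apply/andP; split; [lia | apply/bvalsP].
case=> [/andP[/eqP eqij /eqP eqg]|[y [z [lty ltz /and5P[/eqP Iy /eqP Jz /eqP eqm ltj /andP[lti /eqP eqg]]]]]].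
  by rewrite /item_true eqij leqnn seg1 //; apply/bvalsP; rewrite -eqg; apply: bval1.
move=> /andP[ley /bvalsP Hy] /andP[lez /bvalsP Hz].
rewrite Iy in ley Hy; rewrite Jz in lez Hz.
apply/andP; split; first by lia.
by apply/bvalsP; rewrite (seg_cat so ltI ltJ eqm ley ltj lti) -eqg; apply: bval2.
Qed.

Lemma numJIG A x : x < cap A r -> x = (fJ A x * cap A k + fI A x) * cap A m + num (k + k) m (item A x).
Proof.
move=> ltx; rewrite -{1}(@num_setnum (sn A) 0 r x (fun _ => set0)) // -/(item A x) /r num_cat num_cat add0n.
by [].
Qed.

(** Item numbers are lexicographic in right end and complemented left end: [y] ends earlier, while
    [z] has the same end but starts later. *)
Lemma item_rule_lt A so x y z : x < cap A r -> y < cap A r -> z < cap A r ->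
  @item_rule A so x y z -> y < x /\ z < x.
Proof.
move=> ltx lty ltz /and5P[_ /eqP eqJ _ ltJ /andP[ltI _]].
have lt_lex a b c d : a < b -> c < cap A m -> a * cap A m + c < b * cap A m + d.
  move=> ltab ltc; apply: (@leq_trans (a.+1 * cap A m)); first by rewrite [_.+1 * _]mulSn; lia.
  by apply: (@leq_trans (b * cap A m)); rewrite ?leq_addr // leq_mul2r ltab orbT.
rewrite (numJIG ltx) (numJIG lty) (numJIG ltz); split; apply: lt_lex (num_lt _ _ _).
  apply: (@leq_trans ((fJ A y).+1 * cap A k)).
    by rewrite [_.+1 * _]mulSn; have := fI_lt A y; lia.
  by apply: (@leq_trans (fJ A x * cap A k)); rewrite ?leq_addr // leq_mul2r ltJ orbT.
by rewrite eqJ; lia.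
Qed.

Notation nv := (nv K r).

Lemma FOdef_find b L (l : seq nat) c : (forall a, a \in l -> b + a < L) ->
  FOdef L (fun (A : str s) (so : sets A) => find (fun a => so (b + a) != set0) l = c).
Proof.
elim: l c => [|a l IH] c lel.
  by apply: FOdef_ext (FOdef_cst s L (c == 0)) => A so; split=> [/eqP|<-].
have de : FOdef L (fun (A : str s) (so : sets A) => so (b + a) = set0).
  by apply: FOdef_empty; apply: lel; rewrite mem_head.
have {}IH c := IH c (fun a' ina => lel a' (mem_behead (s := a :: l) ina)).
case: c => [|c].
  by apply: FOdef_ext (FOdef_not de) => A so /=; case: eqP.
apply: FOdef_ext (FOdef_and de (IH c)) => A so /=; case: eqP => e /=.
  by split=> [[_ ->]|[->]].
by split=> // -[].
Qed.

Lemma FOdef_elt b L g : b + m <= L ->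
  FOdef L (fun (A : str s) (so : sets A) => elt b so = g).
Proof.
move=> leL; apply: FOdef_ext (@FOdef_find b L (iota 0 m) g _) => [A so|a]; last first.
  by rewrite mem_iota => /andP[_ lta]; apply: leq_trans leL; rewrite ltn_add2l.
have lef : find (fun a => so (b + a) != set0) (iota 0 m) <= m.
  by rewrite -{2}(size_iota 0 m) find_size.
by rewrite /elt; split=> [eqf|<-]; [apply: val_inj; rewrite /= inordK ?eqf // -ltnS | rewrite inordK].
Qed.

Lemma block_field q a b w : a < q -> b + w <= r -> K + a * r + b + w <= K + q * r.
Proof.
move=> lta lew; apply: leq_trans (block_le K r lta).
by rewrite -addnA leq_add2l.
Qed.

Lemma FOnum_fG q a g : a < q -> FOnum K r q (fun A so v => fG A (v a) = g).
Proof.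
move=> lta; apply: FOdef_ext (@FOdef_elt (K + a * r + (k + k)) (K + q * r) g _) => [A so|].
  by rewrite nvE // fGE.
by apply: block_field => //; rewrite /r.
Qed.

Lemma FOnum_fin q (T : finType) (P : T -> forall A : str s, sets A -> (nat -> nat) -> Prop) :
  (forall i, FOnum K r q (P i)) -> FOnum K r q (fun A so v => exists i, P i A so v).
Proof. exact: FOdef_fin. Qed.

Lemma Gnum_fin q (T : finType) (P : T -> forall A : str s, sets A -> (nat -> nat) -> Prop) :
  (forall i, Gnum K r q (P i)) -> Gnum K r q (fun A so v => exists i, P i A so v).
Proof. exact: Gdef_fin. Qed.

Lemma leJ : 0 + k <= r. Proof. by rewrite /r; lia. Qed.
Lemma leI : k + k <= r. Proof. by rewrite /r; lia. Qed.

Lemma FOnum_item_rule : FOnum K r 3 (fun A so v => item_rule so (v 0) (v 1) (v 2)).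
Proof.
have bJ a : a < 3 -> K + a * r + k <= K + 3 * r.
  by move=> lta; have := block_field lta leJ; rewrite addn0.
have bI a : a < 3 -> K + a * r + k + k <= K + 3 * r by move=> lta; apply: block_field leI.
have d1 : FOnum K r 3 (fun A so v => fI A (v 1) == fI A (v 0)).
  by apply: FOdef_ext (FOdef_eq s (bI 1 isT) (bI 0 isT)) => A so; rewrite !nvE // !fIE.
have d2 : FOnum K r 3 (fun A so v => fJ A (v 2) == fJ A (v 0)).
  by apply: FOdef_ext (FOdef_eq s (bJ 2 isT) (bJ 0 isT)) => A so; rewrite !nvE // !fJE.
have d3 : FOnum K r 3 (fun A so v => (fJ A (v 1) + fI A (v 2)).+1 == (cap A k).-1).
  by apply: FOdef_ext (FOdef_compl2 s (bJ 1 isT) (bI 2 isT)) => A so; rewrite !nvE // fJE fIE.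
have d4 : FOnum K r 3 (fun A so v => fJ A (v 1) < fJ A (v 0)).
  by apply: FOdef_ext (FOdef_lt s (bJ 1 isT) (bJ 0 isT)) => A so; rewrite !nvE // !fJE.
have d5 : FOnum K r 3 (fun A so v => fI A (v 2) < fI A (v 0)).
  by apply: FOdef_ext (FOdef_lt s (bI 2 isT) (bI 0 isT)) => A so; rewrite !nvE // !fIE.
have d6 : FOnum K r 3 (fun A so v => exists g : 'I_m.+1 * 'I_m.+1,
    fG A (v 1) = g.1 /\ (fG A (v 2) = g.2 /\ fG A (v 0) = gop G g.1 g.2)).
  by apply: FOnum_fin => g; apply: FOnum_and; [|apply: FOnum_and]; apply: FOnum_fG.
apply: FOnum_ext (FOnum_and d1 (FOnum_and d2 (FOnum_and d3 (FOnum_and d4 (FOnum_and d5 d6))))) => A so v _.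
rewrite /item_rule; split=> [[-> [-> [-> [-> [-> [g [-> [-> ->]]]]]]]]|].
  by rewrite eqxx.
move=> /and5P[-> -> -> -> /andP[-> /eqP <-]]; do 5!split=> //.
by exists (fG A (v 1), fG A (v 2)).
Qed.

Lemma trunc_dep (A : str s) (so : sets A) : u (trunc K so) = u so.
Proof. by apply: udep => X ltX; rewrite /trunc ltX. Qed.

Lemma FOnum_ends : FOnum K r 1 (fun A so v => fI A (v 0) + fJ A (v 0) == (cap A k).-1).
Proof.
have bJ := block_field (ltnSn 0) leJ; rewrite addn0 in bJ.
have bI := block_field (ltnSn 0) leI.
by apply: FOdef_ext (FOdef_compl s bI bJ) => A so; rewrite !nvE // fJE fIE.
Qed.

Lemma Gnum_u g : Gnum K r 1 (fun A so v => u so (fJ A (v 0)) = g).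
Proof.
have leK : K + k <= K + 1 * r by rewrite mul1n leq_add2l leJ.
apply: Gdef_ext (Gdef_leq leK (du g)) => A so.
by rewrite trunc_dep nvE // fJE mul0n addn0.
Qed.

Lemma Gnum_item_axiom : Gnum K r 1 (fun A so v => item_axiom so (v 0)).
Proof.
have d g : Gnum K r 1 (fun A so v => fG A (v 0) = g /\ u so (fJ A (v 0)) = g).
  by apply: Gnum_and (Gnum_u g); apply/FOnum_Gnum/FOnum_fG.
apply: Gnum_ext (Gnum_and (FOnum_Gnum FOnum_ends) (Gnum_fin d)) => A so v _.
rewrite /item_axiom; split=> [[-> [g [-> ->]]]|/andP[-> /eqP ->]]; first by rewrite eqxx.
by split=> //; exists (fG A (v 0)).
Qed.

(** A position has exactly one letter, so not having [g] there means having one of the finitely many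
    others, which is a positive condition. *)
Lemma Gnum_item_Naxiom : Gnum K r 1 (fun A so v => ~~ item_axiom so (v 0)).
Proof.
have d (g : 'I_m.+1 * 'I_m.+1) : Gnum K r 1 (fun A so v => g.1 != g.2 /\
     (fG A (v 0) = g.1 /\ u so (fJ A (v 0)) = g.2)).
  apply: Gnum_and; first exact/FO_Gdef/FOdef_cst.
  by apply: Gnum_and (Gnum_u g.2); apply/FOnum_Gnum/FOnum_fG.
apply: Gnum_ext (Gnum_or (FOnum_Gnum (FOnum_not FOnum_ends)) (Gnum_fin d)) => A so v _.
rewrite /item_axiom negb_and; split=> [[/negP ->//|[g [ne [-> ->]]]]|/orP[/negP|ne]]; [|by left|].
  by rewrite [g.2 == _]eq_sym ne orbT.
by right; exists (fG A (v 0), u so (fJ A (v 0))); rewrite /= eq_sym.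
Qed.

(** With [l] the length of the interval this is [2 * l - 1], the number of nodes of a binary tree
    with [l] leaves. The factor 2 costs one more set variable in the bound [cap A (k + 1)]. *)
Definition wt (A : str s) (x : nat) : nat := (fI A x + fJ A x - (cap A k).-1).*2.+1.

Lemma wt_cap A x : x < cap A r -> 0 < wt A x <= cap A (k + 1).
Proof.
move=> _; have ltI := fI_lt A x; have ltJ := fJ_lt A x.
rewrite /wt /= capD; have : 2 <= cap A 1 by rewrite cap1 expnS leq_pmulr // expn_gt0.
by move=> le2; apply: (@leq_trans (cap A k * 2)); [lia | rewrite leq_mul2l le2 orbT].
Qed.

Lemma wt_rule A so x y z : x < cap A r -> y < cap A r -> z < cap A r ->
  @item_rule A so x y z -> item_true so y -> item_true so z -> wt A y + wt A z < wt A x.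
Proof.
move=> _ _ _ /and5P[/eqP Iy /eqP Jz /eqP eqm ltj /andP[lti _]] /andP[ley _] /andP[lez _].
by rewrite /wt Iy Jz in ley lez *; lia.
Qed.

Lemma Gnum_item_true : Gnum K r 1 (fun A so v => item_true so (v 0)).
Proof. exact: Gnum_true Gnum_item_axiom FOnum_item_rule item_trueE wt_cap wt_rule. Qed.

Lemma Gnum_item_false : Gnum K r 1 (fun A so v => ~~ item_true so (v 0)).
Proof. exact: Gnum_compl Gnum_item_true Gnum_item_Naxiom FOnum_item_rule item_rule_lt item_trueE. Qed.

Definition goalF (A : str s) (x : nat) : Prop :=
  fI A x = (cap A k).-1 /\ (fJ A x = (cap A k).-1 /\ exists g, g \in gS G /\ fG A x = g).

Lemma FOnum_goal : FOnum K r 1 (fun A so v => goalF A (v 0)).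
Proof.
have bJ := block_field (ltnSn 0) leJ; rewrite addn0 in bJ.
have bI := block_field (ltnSn 0) leI.
apply: FOnum_and.
  by apply: FOdef_ext (FOdef_max s bI) => A so; rewrite !nvE // fIE; split=> /eqP.
apply: FOnum_and.
  by apply: FOdef_ext (FOdef_max s bJ) => A so; rewrite !nvE // fJE; split=> /eqP.
by apply: FOnum_fin => g; apply: FOnum_and; [apply: FOdef_cst | apply: FOnum_fG].
Qed.

Lemma word_goal A (so : sets A) : in_word_problem G (word so) <->
  exists2 x, x < cap A r & goalF A x /\ item_true so x.
Proof.
have P_lt : (cap A k).-1 < cap A k by have := cap_gt0 A k; lia.
have segE : seg so (cap A k).-1 (cap A k).-1 = word so.
  by rewrite /seg subnn drop0 take_oversize // size_word; lia.
split=> [/existsP[g /andP[gS Hg]]|[x ltx [[Ix [Jx [g [gS Gx]]]] /andP[_]]]].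
  have [x [ltx Jx Ix Gx]] := itemP g P_lt P_lt.
  exists x => //; rewrite /goalF /item_true Ix Jx Gx segE Hg; split; last by lia.
  by do 2!split=> //; exists g.
rewrite Ix Jx Gx segE => Hg; apply/existsP; exists g.
by rewrite gS.
Qed.

Lemma word_trunc A (so : sets A) : word (trunc K so) = word so.
Proof. by rewrite /word trunc_dep. Qed.

Lemma Gdef_word : Gdef K (fun A so => in_word_problem G (word so)).
Proof.
have := Gnum_ex (Gnum_and (FOnum_Gnum FOnum_goal) Gnum_item_true); rewrite /Gnum mul0n addn0.
by apply: Gdef_ext => A so; rewrite -word_trunc word_goal.
Qed.

(** Every item claiming that the whole word evaluates into the accepting set is false; this needs
    both the falsity of items and the universal quantifier. *)
Lemma Gdef_Nword : Gdef K (fun A so => ~~ in_word_problem G (word so)).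
Proof.
have := Gnum_all (Gnum_or (FOnum_Gnum (FOnum_not FOnum_goal)) Gnum_item_false); rewrite /Gnum mul0n addn0.
apply: Gdef_ext => A so; rewrite -word_trunc; split=> [H|/negP nw x ltx].
  by apply/negP => /word_goal[x ltx [gx Tx]]; have [//|/negP] := H x ltx.
case: (boolP (item_true (trunc K so) x)) => Tx; last by right.
by left=> gx; apply/nw/word_goal; exists x.
Qed.

End WordProblem.

(** * Induction on formulas *)

Section FormulaInduction.
Variable s : nat.
Variable P : formula s -> Prop.
Hypothesis PP : forall a t, P (FP a t).
Hypothesis PEq : forall t1 t2, P (FEq s t1 t2).
Hypothesis PLt : forall t1 t2, P (FLt s t1 t2).
Hypothesis PIn : forall X t, P (FIn s X t).
Hypothesis PNot : forall p, P p -> P (FNot p).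
Hypothesis PAnd : forall p q, P p -> P q -> P (FAnd p q).
Hypothesis POr : forall p q, P p -> P q -> P (FOr p q).
Hypothesis PEx : forall x p, P p -> P (FEx x p).
Hypothesis PAll : forall x p, P p -> P (FAll x p).
Hypothesis PExS : forall X p, P p -> P (FExS X p).
Hypothesis PAllS : forall X p, P p -> P (FAllS X p).
Hypothesis PQ : forall m (G : gquant m) Xs ps, (forall p, List.In p ps -> P p) -> P (FQ G Xs ps).

Fixpoint formula_nested_ind (p : formula s) : P p :=
  match p with
  | FP a t => PP a t
  | @FEq _ t1 t2 => PEq t1 t2
  | @FLt _ t1 t2 => PLt t1 t2
  | @FIn _ X t => PIn X t
  | FNot p => PNot (formula_nested_ind p)
  | FAnd p q => PAnd (formula_nested_ind p) (formula_nested_ind q)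
  | FOr p q => POr (formula_nested_ind p) (formula_nested_ind q)
  | FEx x p => PEx x (formula_nested_ind p)
  | FAll x p => PAll x (formula_nested_ind p)
  | FExS X p => PExS X (formula_nested_ind p)
  | FAllS X p => PAllS X (formula_nested_ind p)
  | @FQ _ m G Xs ps => PQ G Xs
      ((fix all_In (l : seq (formula s)) : forall p, List.In p l -> P p :=
         match l return forall p, List.In p l -> P p with
         | [::] => fun p (inp : False) => match inp with end
         | q :: l' => fun p inp => match inp with
             | or_introl eqp => let: erefl := eqp in formula_nested_ind q
             | or_intror inl' => all_In l' p inl' end
         end) ps)
  end.

End FormulaInduction.

(** * Every formula and its negation are grammar-definable *)

Section Collapse.
Variable s : nat.
Implicit Types (D : forall A : str s, sets A -> Prop) (C : forall A : str s, sets A -> bool).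
Implicit Types (K : nat) (p : formula s).

(** Bound set variables are bounded too: the body of a quantifier is treated as a relation with its
    variable among the parameters. *)
Fixpoint svlt (K : nat) (p : formula s) : bool :=
  match p with
  | FIn X _ => X < K
  | FNot p | FEx _ p | FAll _ p => svlt K p
  | FAnd p q | FOr p q => svlt K p && svlt K q
  | FExS X p | FAllS X p => (X < K) && svlt K p
  | FQ _ _ Xs ps => all (fun X => X < K) Xs && all (svlt K) ps
  | _ => true
  end.

Lemma all_InP (T : Type) (a : pred T) (l : seq T) : (forall x, List.In x l -> a x) -> all a l.
Proof.
elim: l => //= x l IH al; rewrite al /=; last by left.
by apply: IH => y inl'; apply: al; right.
Qed.

Lemma svlt_leq K K' p : K <= K' -> svlt K p -> svlt K' p.
Proof.
move=> leK; elim/formula_nested_ind: p => //=.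
- by move=> X _; lia.
- by move=> p q IHp IHq /andP[/IHp -> /IHq ->].
- by move=> p q IHp IHq /andP[/IHp -> /IHq ->].
- by move=> X p IH /andP[ltX /IH ->]; rewrite andbT; lia.
- by move=> X p IH /andP[ltX /IH ->]; rewrite andbT; lia.
- move=> m G Xs ps IH /andP[aX aps]; apply/andP; split; first by apply: sub_all aX => X; lia.
  by apply: all_InP => p inp; apply: IH (all_In aps inp).
Qed.

Lemma svlt_ex p : exists K, svlt K p.
Proof.
elim/formula_nested_ind: p => /=; try by exists 0.
- by move=> X _; exists X.+1.
- by move=> p.
- move=> p q [K1 l1] [K2 l2]; exists (maxn K1 K2).
  by rewrite (svlt_leq (leq_maxl _ _) l1) (svlt_leq (leq_maxr _ _) l2).
- move=> p q [K1 l1] [K2 l2]; exists (maxn K1 K2).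
  by rewrite (svlt_leq (leq_maxl _ _) l1) (svlt_leq (leq_maxr _ _) l2).
- by move=> x p.
- by move=> x p.
- move=> X p [K l]; exists (maxn K X.+1).
  by rewrite (svlt_leq (leq_maxl _ _) l) andbT leq_max ltnSn orbT.
- move=> X p [K l]; exists (maxn K X.+1).
  by rewrite (svlt_leq (leq_maxl _ _) l) andbT leq_max ltnSn orbT.
- move=> m G Xs ps IH.
  have [K1 l1] : exists K, all (fun X => X < K) Xs.
    elim: Xs {IH} => [|X Xs [K l]]; first by exists 0.
    exists (maxn K X.+1) => /=; rewrite leq_max ltnSn orbT /=.
    by apply: sub_all l => Y; lia.
  have [K2 l2] : exists K, all (svlt K) ps.
    elim: ps IH => [|p ps IHps] IH; first by exists 0.
    have [K l] := IHps (fun q inq => IH q (or_intror inq)).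
    have [K' l'] := IH p (or_introl erefl).
    exists (maxn K' K); rewrite /= (svlt_leq (leq_maxl _ _) l') /=.
    by apply: sub_all l => q; apply/svlt_leq/leq_maxr.
  exists (maxn K1 K2); apply/andP; split.
    by apply: sub_all l1 => X; lia.
  by apply: sub_all l2 => q; apply/svlt_leq/leq_maxr.
Qed.

Lemma Gdef_all K r D : Gdef (K + r) D ->
  Gdef K (fun A so => forall i, i < cap A r -> D A (setnum K r i so)).
Proof.
move=> dD.
have trunc_agree (A : str s) (so : sets A) : agree K (trunc K so) so.
  by move=> X ltX; rewrite /trunc ltX.
have Dtrunc (A : str s) (so : sets A) i : D A (setnum K r i (trunc K so)) <-> D A (setnum K r i so).
  have ag : agree (K + r) (setnum K r i (trunc K so)) (setnum K r i so) by apply: agree_setnum.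
  split; apply: (Gdef_dep dD); first exact: ag.
  by move=> X ltX; rewrite ag.
have d1 : Gnum K r 1 (fun A so v => D A (setnum K r (v 0) so)).
  rewrite /Gnum mul1n; apply: Gdef_ext dD => A so.
  by rewrite Dtrunc nvE // mul0n addn0 setnum_num.
have := Gnum_all d1; rewrite /Gnum mul0n addn0; apply: Gdef_ext => A so.
by split=> H i lti; have := H i lti; rewrite Dtrunc.
Qed.

(** Index [c] is the least one iff formula [c] holds and all earlier ones fail; here the complements
    of the subformulas are consumed. *)
Lemma Gdef_fin_find K (bs : seq (forall A : str s, sets A -> bool)) c :
  (forall b, List.In b bs -> Gdef K (fun A so => b A so) /\ Gdef K (fun A so => ~~ b A so)) ->
  Gdef K (fun A so => find id [seq b A so | b <- bs] = c).
Proof.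
elim: bs c => [|b bs IH] c db.
  by apply: Gdef_ext (FO_Gdef (FOdef_cst s K (c == 0))) => A so; split=> [/eqP|<-].
have [d1 d2] := db b (or_introl erefl).
have {}IH c' := IH c' (fun b' inb => db b' (or_intror inb)).
case: c => [|c].
  by apply: Gdef_ext d1 => A so /=; case: (b A so).
apply: Gdef_ext (Gdef_and d2 (IH c)) => A so /=; case: (b A so) => /=.
  by split=> // -[].
by split=> [[_ ->]|[->]].
Qed.

Definition foset (A : str s) (x : nat) (v : 'I_(sn A).+1) : str s := Str (@sw s A) (fupd (@sfo s A) x v).

Definition least n (B : {set 'I_n.+1}) (v : 'I_n.+1) : bool :=
  (v \in B) && [forall u : 'I_n.+1, ~~ (u < v) || (u \notin B)].

(** Words loop over set variables only, so an element is represented by a set: its least element, or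
    [ord0] if it is empty. Every set then codes an element, and singletons reach all of them. *)
Definition pickv n (B : {set 'I_n.+1}) : 'I_n.+1 := odflt ord0 [pick v | least B v].

Lemma pickvP n (B : {set 'I_n.+1}) v :
  (v == pickv B) = (B == set0) && (v == ord0) || least B v.
Proof.
have least_uniq v1 v2 : least B v1 -> least B v2 -> v1 = v2.
  move=> /andP[in1 /forallP l1] /andP[in2 /forallP l2]; apply: val_inj.
  by have := l1 v2; have := l2 v1; rewrite in1 in2 !orbF /=; lia.
rewrite /pickv; case: pickP => [v0 lv0|nol] /=.
  have -> : (B == set0) = false by apply/eqP => B0; move: lv0; rewrite /least B0 inE.
  by apply/eqP/idP => [->//|lv]; apply: least_uniq lv lv0.
rewrite nol orbF; case: (set_0Vmem B) => [->|[v1 in1]]; first by rewrite eqxx.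
have [v2 in2 min2] := arg_minnP (fun v : 'I_n.+1 => val v) in1.
have : least B v2.
  rewrite /least (in2 : v2 \in B); apply/forallP => u0; case: (boolP (u0 \in B)) => inu; last by rewrite orbT.
  by rewrite orbF -leqNgt; apply: min2.
by rewrite nol.
Qed.

Lemma pickv1 n (v : 'I_n.+1) : pickv [set v] = v.
Proof.
apply/esym/eqP; rewrite pickvP; apply/orP; right; rewrite /least set11.
by apply/forallP => u0; rewrite inE; case: eqP => [->|]; rewrite ?ltnn ?orbT.
Qed.

(** The auxiliary variable [x.+1] is bound inside the test only, away from [p], so nothing in [p] is
    captured. *)
Definition Fpick (K x : nat) (p : formula s) : formula s :=
  FEx x (FAnd (FOr (FAnd (Fempty s K) (FEq s (TVar x) TMin))
    (FAnd (FIn s K (TVar x))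
      (FAll x.+1 (FOr (FNot (FLt s (TVar x.+1) (TVar x))) (FNot (FIn s K (TVar x.+1)))))) ) p).

Lemma sat_Fpick K x p (A : str s) (so : sets A) :
  ssat so (Fpick K x p) = @ssat s (foset x (pickv (so K))) so p.
Proof.
have cond v : @ssat s (foset x v) so (FOr (FAnd (Fempty s K) (FEq s (TVar x) TMin))
    (FAnd (FIn s K (TVar x))
      (FAll x.+1 (FOr (FNot (FLt s (TVar x.+1) (TVar x))) (FNot (FIn s K (TVar x.+1))))))) = (v == pickv (so K)).
  rewrite pickvP; rewrite /ssat [LHS]/=; congr (_ || _); congr (_ && _).
  - exact: (sat_Fempty (A := foset x v)).
  - by rewrite /fupd eqxx.
  - by rewrite /fupd eqxx.
  - by apply: eq_forallb => u0; rewrite /fupd !eqxx ltn_eqF.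
apply/existsP/idP => [[v /andP[cv pv]]|pv].
  have /eqP eqv : v == pickv (so K) by rewrite -cond; exact: cv.
  by move: pv; rewrite {1}eqv.
exists (pickv (so K)); apply/andP; split; last exact: pv.
by have := cond (pickv (so K)); rewrite eqxx.
Qed.

Lemma defw_fo (L : Type) K x (W : forall A : str s, sets A -> seq L) : defw K W ->
  defw (K + 1) (fun A so => W (foset x (pickv (so K))) so).
Proof.
move=> dW; have [k [lf [FOl dl eqW]]] := defw_leq (leq_addr 1 K) dW.
have eql (A : str s) (so : sets A) : letter [seq (y.1, Fpick K x y.2) | y <- lf] so
    = @letter s L lf (foset x (pickv (so K))) so.
  rewrite /letter filter_map -!map_comp; congr (take 1 _).
  by rewrite -(eq_filter (a1 := preim (fun y => (y.1, Fpick K x y.2)) (fun y : L * formula s => ssat so y.2))) // => y /=; rewrite sat_Fpick.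
exists k, [seq (y.1, Fpick K x y.2) | y <- lf]; split.
- by rewrite all_map; apply: sub_all FOl => y /= ->.
- move=> A so so' eqs; rewrite !eql eqs; last by lia.
  exact: (dl (foset x (pickv (so' K)))).
move=> A so; rewrite eqW /wordf; congr flatten; apply: eq_map => i.
by rewrite eql setnum_out //; lia.
Qed.

Lemma Gdef_fo K x D : Gdef K D -> Gdef (K + 1) (fun A so => D (foset x (pickv (so K))) so).
Proof.
move=> [g [W dW WE]]; exists g, (fun A (so : sets A) => W (foset x (pickv (so K))) so) => [|A so]; last exact: WE.
exact: defw_fo.
Qed.

Lemma setnum1_surj K (A : str s) (so : sets A) (B : {set 'I_(sn A).+1}) :
  exists2 i, i < cap A 1 & setnum K 1 i so K = B.
Proof.
exists (num K 1 (fun _ => B)); first exact: num_lt.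
have := congr1 (fun f => f K) (setnum_num K 1 (fun _ => B)); rewrite !setnumE.
by rewrite leqnn addn1 ltnSn.
Qed.

Definition both K (C : forall A : str s, sets A -> bool) : Prop :=
  Gdef K (fun A so => C A so) /\ Gdef K (fun A so => ~~ C A so).

Lemma both_ext K C C' : (forall A so, C A so = C' A so) -> both K C -> both K C'.
Proof.
by move=> eqC [d1 d2]; split; [apply: Gdef_ext d1 | apply: Gdef_ext d2] => A so; rewrite eqC.
Qed.

Lemma both_not K C : both K C -> both K (fun A so => ~~ C A so).
Proof. by move=> [d1 d2]; split=> //; apply: Gdef_ext d1 => A so; rewrite negbK. Qed.

Lemma both_and K C C' : both K C -> both K C' -> both K (fun A so => C A so && C' A so).
Proof.
move=> [d1 d2] [d1' d2']; split.
  by apply: Gdef_ext (Gdef_and d1 d1') => A so; split=> /andP.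
by apply: Gdef_ext (Gdef_or d2 d2') => A so; rewrite negb_and; split=> /orP.
Qed.

Lemma both_or K C C' : both K C -> both K C' -> both K (fun A so => C A so || C' A so).
Proof.
move=> d d'; apply: both_ext (both_not (both_and (both_not d) (both_not d'))) => A so.
by rewrite negb_and !negbK.
Qed.

Lemma both_FO K C : FOdef K (fun A so => C A so) -> both K C.
Proof.
move=> d; split; first exact: FO_Gdef.
by apply/FO_Gdef/(FOdef_ext _ (FOdef_not d)) => A so; split=> /negP.
Qed.

Lemma both_dep K C A (so so' : sets A) : both K C -> agree K so so' -> C A so = C A so'.
Proof.
move=> [d1 d2] ag; apply/idP/idP; first exact: (Gdef_dep d1).
by apply: (Gdef_dep d1) => X ltX; rewrite ag.
Qed.

(* [E] ranges over the values of the quantified variable; [val] reads it off the extra set variable [K]. *)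
Lemma both_ex K C (E : str s -> finType) (val : forall A, {set 'I_(sn A).+1} -> E A)
    (F : forall A : str s, sets A -> E A -> bool) :
  both (K + 1) C ->
  (forall A (so : sets A) i, C A (setnum K 1 i so) = F A so (val A (setnum K 1 i so K))) ->
  (forall A (e : E A), exists B, val A B = e) ->
  both K (fun A so => [exists e, F A so e]).
Proof.
move=> [d1 d2] CF surj; split.
  apply: Gdef_ext (Gdef_ex d1) => A so; split=> [[i lti]|/existsP[e Fe]].
    by rewrite CF => Fi; apply/existsP; exists (val A (setnum K 1 i so K)).
  have [B eqB] := surj A e; have [i lti eqi] := setnum1_surj K so B.
  by exists i => //; rewrite CF eqi eqB.
apply: Gdef_ext (Gdef_all d2) => A so; split=> [H|/existsPn nF i lti]; last by rewrite CF; apply: nF.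
apply/existsPn => e; have [B eqB] := surj A e; have [i lti eqi] := setnum1_surj K so B.
by have := H i lti; rewrite CF eqi eqB.
Qed.

Lemma both_exfo K x p : both K (fun A so => ssat so p) -> both K (fun A so => ssat so (FEx x p)).
Proof.
move=> [d1 d2].
have dfo : both (K + 1) (fun A so => @ssat s (foset x (pickv (so K))) so p).
  by split; [exact: (Gdef_fo x d1) | exact: (Gdef_fo x d2)].
apply: (both_ex (E := fun A => 'I_(sn A).+1) (val := fun A B => pickv B)
  (F := fun A so v => @ssat s (foset x v) so p) dfo) => [A so i|A v]; last by exists [set v]; apply: pickv1.
by apply: (both_dep (A := foset x _) (conj d1 d2)); apply: agree_setnumr.
Qed.

Lemma both_exso K X p : X < K -> both K (fun A so => ssat so p) -> both K (fun A so => ssat so (FExS X p)).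
Proof.
(* The bound variable [X] is moved to the fresh variable [K], over which a loop block can range. *)
move=> ltX d; pose f Y := if Y == X then K else Y.
have fK Y : Y < K -> f Y < K + 1 by rewrite /f; case: ifP; lia.
have dren : both (K + 1) (fun A so => ssat (so \o f : sets A) p).
  by case: d => d1 d2; split; [exact: (Gdef_ren fK d1) | exact: (Gdef_ren fK d2)].
apply: (both_ex (E := fun A => {set 'I_(sn A).+1} : finType) (val := fun A B => B)
  (F := fun A so B => @ssat s A (fupd so X B) p) dren) => [A so i|A B]; last by exists B.
apply: (both_dep d) => Y ltY /=; rewrite /f /fupd; case: eqP => // _.
by rewrite setnum_out //; lia.
Qed.

(** Moving the quantified variables to a fresh block at [K], in the order of [Xs], turns the [i]-th
    assignment into the block with number [i]. The letters then form a word to which the CYK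
    analysis applies. *)
Lemma both_Q K m (G : gquant m) Xs (ps : seq (formula s)) : size ps = m ->
  (forall p, List.In p ps -> both K (fun A so => ssat so p)) ->
  all (fun X => X < K) Xs -> both K (fun A so => ssat so (FQ G Xs ps)).
Proof.
move=> szps dps ltXs; set k := size Xs.
pose u (A : str s) (so : sets A) i := qletter m [seq ssat (qassign Xs so i) p | p <- ps].
pose f Y := if Y \in Xs then K + index Y Xs else Y.
have fK Y : Y < K -> f Y < K + k by rewrite /f; case: ifP => [inY|]; rewrite ?ltn_add2l ?index_mem //; lia.
have fE (A : str s) (so : sets A) : so \o f = qassign Xs so (num K k so).
  apply: functional_extensionality => Y; rewrite /f /qassign /=; case: ifP => // inY.
  by apply/setP=> j; rewrite inE (@num_bit _ K k) // /k index_mem.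
have dren p : List.In p ps -> both (K + k) (fun A so => ssat (qassign Xs so (num K k so)) p).
  case/dps => d1 d2; split.
    by apply: Gdef_ext (Gdef_ren fK d1) => A so; rewrite fE.
  by apply: Gdef_ext (Gdef_ren fK d2) => A so; rewrite fE.
have udep A (so so' : sets A) : agree K so so' -> u A so = u A so'.
  move=> ag; apply: functional_extensionality => i; rewrite /u; congr qletter.
  have : forall p, List.In p ps -> both K (fun A so => ssat so p) by [].
  elim: (ps) => //= p l IH dl; rewrite IH; last by move=> q inq; apply: dl; right.
  congr (_ :: _); apply: (both_dep (dl p (or_introl erefl))) => Y ltY.
  by rewrite /qassign; case: ifP => // _; apply: ag.
have du g : Gdef (K + k) (fun A so => u A so (num K k so) = g).
  have dfind := @Gdef_fin_find (K + k)
    [seq (fun A so => ssat (qassign Xs so (num K k so)) p) | p <- ps] g.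
  apply: Gdef_ext (dfind _) => [A so|b /In_map[p inp ->]]; last exact: dren.
  rewrite -map_comp /u /qletter; set bs := [seq _ | p <- ps].
  have lef : find id bs <= m by rewrite -szps -(size_map (fun p => ssat (qassign Xs so (num K k so)) p) ps) find_size.
  split=> [eqf|<-].
    apply: val_inj; case: ifP => [ltf|]; first by rewrite /= inordK // ltnW.
    by rewrite /=; have := ltn_ord g; lia.
  by case: ifP => [ltf|]; [rewrite inordK // ltnW | rewrite /=; lia].
by split; [exact: (Gdef_word G udep du) | exact: (Gdef_Nword G udep du)].
Qed.

Lemma FOdef_atom K p : is_FO p -> dep K (fun A so => @ssat s A so p) -> both K (fun A so => ssat so p).
Proof. by move=> FOp dp; apply: both_FO; exists p. Qed.

Lemma both_formula p K : wf p -> svlt K p -> both K (fun A so => ssat so p).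
Proof.
elim/formula_nested_ind: p => /=.
- by move=> a t _ _; apply: FOdef_atom.
- by move=> t1 t2 _ _; apply: FOdef_atom.
- by move=> t1 t2 _ _; apply: FOdef_atom.
- move=> X t _ ltX; apply: FOdef_atom => // A so so' eqs.
  by rewrite /ssat /= eqs.
- by move=> p IH wp lp; apply: (both_not (IH wp lp)).
- by move=> p q IHp IHq /andP[wp wq] /andP[lp lq]; apply: (both_and (IHp wp lp) (IHq wq lq)).
- by move=> p q IHp IHq /andP[wp wq] /andP[lp lq]; apply: (both_or (IHp wp lp) (IHq wq lq)).
- by move=> x p IH wp lp; apply: (both_exfo x (IH wp lp)).
- move=> x p IH wp lp; have := both_not (@both_exfo _ x (FNot p) (both_not (IH wp lp))).
  apply: both_ext => A so; rewrite /ssat /= negb_exists.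
  by apply: eq_forallb => v; rewrite negbK.
- by move=> X p IH wp /andP[ltX lp]; apply: (both_exso ltX (IH wp lp)).
- move=> X p IH wp /andP[ltX lp]; have := both_not (@both_exso _ X (FNot p) ltX (both_not (IH wp lp))).
  apply: both_ext => A so; rewrite /ssat /= negb_exists.
  by apply: eq_forallb => v; rewrite negbK.
- move=> m G Xs ps IH /andP[/andP[/eqP szps _] wps] /andP[lX lps].
  by apply: both_Q => // p inp; apply: IH; rewrite ?(all_In wps inp) ?(all_In lps inp).
Qed.

End Collapse.

(** * From grammars back to groupoidal quantifiers *)

Section GroupoidOfGrammar.
Variable g : cfg.
Let T := {set gV g}.
Let m := #|{: T}|.

(** [None] is the blank. It gets the last code, which is the letter assigned by the quantifier where
    none of its formulas holds. *)
Definition gdec (x : 'I_m.+1) : option T := if x < m then Some (nth set0 (enum {: T}) x) else None.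
Definition genc (o : option T) : 'I_m.+1 := if o is Some U then inord (index U (enum {: T})) else ord_max.

Lemma gencK : cancel genc gdec.
Proof.
case=> [U|]; rewrite /genc /gdec; last by rewrite /= ltnn.
have ltU : index U (enum {: T}) < m by rewrite /m cardE index_mem mem_enum.
by rewrite inordK ?ltU ?nth_index ?mem_enum // ltnW.
Qed.

Lemma gdecK : cancel gdec genc.
Proof.
move=> x; apply: val_inj; rewrite /genc /gdec; case: ifP => [ltx|] /=; last by have := ltn_ord x; lia.
by rewrite index_uniq ?enum_uniq -?cardE // inordK.
Qed.

(** The CYK product: all left-hand sides of binary rules with right-hand sides in the two sets, with
    an identity adjoined for blanks. *)
Definition ogmul (a b : option T) : option T :=
  match a, b with
  | None, _ => b
  | _, None => a
  | Some U, Some V => Some [set X | [exists Y in U, [exists Z in V, grule X Y Z]]]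
  end.

Definition ggrp : gquant m.
Proof.
refine (@GQuant m (fun x y => genc (ogmul (gdec x) (gdec y))) (genc None) _ _
  [set x | if gdec x is Some U then [exists X in U, gst X] else false]).
- by move=> x; rewrite gencK /= gdecK.
- by move=> x; rewrite gencK; rewrite (_ : ogmul (gdec x) None = gdec x) ?gdecK //; case: (gdec x).
Defined.

Definition lexset (a : gL g) : T := [set X | glex X a].
Definition gletter (o : option (gL g)) : 'I_m.+1 := genc (omap lexset o).

(** Every nonterminal in the value of a bracketing derives the word without its blanks, the
    bracketing being the shape of the derivation tree. *)
Lemma bval_der w x : bval (gop ggrp) w x -> forall wd, w = map gletter wd ->
  if gdec x is Some U then forall X, X \in U -> der X (pmap id wd) else pmap id wd = [::].
Proof.
elim=> {w x} [x|u v a b _ IHu _ IHv] wd.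
  case: wd => [|o [|? ?]] //= [->]; rewrite gencK; case: o => [c|] //= X.
  by rewrite inE => lexX; apply: der_lex.
move=> eqw; have eqwd := cat_take_drop (size u) wd.
have equ : u = map gletter (take (size u) wd) by rewrite map_take -eqw take_size_cat.
have eqv : v = map gletter (drop (size u) wd) by rewrite map_drop -eqw drop_size_cat.
have pcat : pmap id wd = pmap id (take (size u) wd) ++ pmap id (drop (size u) wd).
  by rewrite -{1}eqwd; elim: (take _ _) => //= -[c|] l -> //.
have := IHu _ equ; have := IHv _ eqv; rewrite pcat /= gencK.
case: (gdec a) => [U|]; case: (gdec b) => [V|] /= dv du.
- move=> X; rewrite inE => /exists_inP[Y YU /exists_inP[Z ZV rXYZ]].
  by apply: der_rule rXYZ (du _ YU) (dv _ ZV).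
- by rewrite dv cats0.
- by rewrite du.
- by rewrite du dv.
Qed.

Lemma gop_idl x : gop ggrp (gletter None) x = x. Proof. exact: gidl ggrp x. Qed.
Lemma gop_idr x : gop ggrp x (gletter None) = x. Proof. exact: gidr ggrp x. Qed.

Lemma pmap_cat_inv (U : Type) (wd : seq (option U)) u v : pmap id wd = u ++ v ->
  exists wd1 wd2, [/\ wd = wd1 ++ wd2, pmap id wd1 = u & pmap id wd2 = v].
Proof.
elim: wd u => [|[c|] wd IH] u /=.
- by case: u => //= <-; exists [::], [::].
- case: u => [|c' u] /=; first by move=> <-; exists [::], (Some c :: wd).
  by case=> -> /IH[wd1 [wd2 [-> <- <-]]]; exists (Some c' :: wd1), wd2.
- by case/IH=> wd1 [wd2 [-> <- <-]]; exists (None :: wd1), wd2.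
Qed.

(** The derivation tree prescribes the bracketing, and blanks are multiplied into neighbouring
    leaves. The value may contain nonterminals besides [X]. *)
Lemma der_bval X v : der X v -> forall wd, pmap id wd = v ->
  exists x, bval (gop ggrp) (map gletter wd) x /\ exists2 U, gdec x = Some U & X \in U.
Proof.
elim=> {X v} [X a lexX|X Y Z u v rXYZ _ IHY _ IHZ] wd.
  elim: wd => [|[c|] wd IH] //=; last first.
    move=> /IH[x [bx [U Ux XU]]]; exists x; split; last by exists U.
    by rewrite -[x]gop_idl -cat1s; apply: bval2 bx; apply: bval1.
  case=> -> pnil; exists (gletter (Some a)); split; last by exists (lexset a); rewrite ?gencK // inE.
  (* Leading blanks have been absorbed; only blanks follow the letter, and they are multiplied in
     from the right one at a time. *)
  have -> : wd = nseq (size wd) None by elim: wd pnil {IH} => //= -[d|] wd IH // /IH <-.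
  have base : bval (gop ggrp) [:: gletter (Some a)] (gletter (Some a)) by apply: bval1.
  rewrite map_nseq -cat1s; elim: (size wd) [:: gletter (Some a)] base => [|n IHn] l bl.
    by rewrite cats0.
  rewrite /= -cat_rcons; apply: IHn; rewrite -cats1 -[X in bval _ _ X]gop_idr.
  by apply: bval2 bl _; apply: bval1.
move=> /pmap_cat_inv[wd1 [wd2 [-> /IHY[y [by_ [U Uy YU]]] /IHZ[z [bz [V Vz ZV]]]]]].
exists (gop ggrp y z); split; first by rewrite map_cat; apply: bval2.
rewrite /= gencK Uy Vz /=; eexists; first by [].
by rewrite inE; apply/exists_inP; exists Y => //; apply/exists_inP; exists Z.
Qed.

Lemma ggrpP wd : in_word_problem ggrp (map gletter wd) <-> lang (pmap id wd).
Proof.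
split=> [/existsP[x /andP[]]|[X stX /der_bval/(_ wd erefl)[x [bx [U Ux XU]]]]].
  rewrite inE => + /bvalsP/bval_der/(_ wd erefl).
  case: (gdec x) => // U /exists_inP[X XU stX] dX.
  by exists X => //; apply: dX.
apply/existsP; exists x; rewrite inE Ux; apply/andP; split; last exact/bvalsP.
by apply/exists_inP; exists X.
Qed.

Variable s : nat.

(** Says that the first true formula of the list carries a letter with terminal set [U]. Letters
    with equal sets are merged, and for different [U] these formulas exclude each other. *)
Fixpoint lexF (lf : seq (gL g * formula s)) (U : T) : formula s :=
  if lf is (a, p) :: lf' then
    if lexset a == U then FOr p (lexF lf' U) else FAnd (FNot p) (lexF lf' U)
  else FNot (FEq s TMin TMin).

Lemma lexF_FO lf U : all (fun x => is_FO x.2) lf -> is_FO (lexF lf U).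
Proof.
by elim: lf => //= -[a p] lf IH /= /andP[FOp /IH FOl]; case: ifP => _ /=; rewrite FOp.
Qed.

Lemma sat_lexF lf U (A : str s) (so : sets A) :
  ssat so (lexF lf U) = (if letter lf so is a :: _ then lexset a == U else false).
Proof.
rewrite /letter; elim: lf => [|[a p] lf IH]; first by rewrite /ssat /= ?eqxx.
rewrite [lexF _ _]/=; case: eqP => [eqU|ne].
  rewrite -[ssat so (FOr _ _)]/(ssat so p || ssat so (lexF lf U)) IH /=.
  by case: (ssat so p) => //=; rewrite eqU eqxx.
rewrite -[ssat so (FAnd _ _)]/(~~ ssat so p && ssat so (lexF lf U)) IH /=.
by case: (ssat so p) => //=; apply/esym/eqP.
Qed.

(** One formula per set of nonterminals. At most one holds at an assignment, so the quantifier reads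
    the code of its set, or the identity at a blank. *)
Lemma Gdef_QFO K D : @Gdef_in s g K D -> exists Xs (ps : seq (formula s)),
  [/\ wf (FQ ggrp Xs ps), all (@is_FO s) ps & forall A so, @ssat s A so (FQ ggrp Xs ps) <-> D A so].
Proof.
move=> [W [k [lf [FOl dl eqW]]] WE].
exists (iota K k), [seq lexF lf U | U <- enum {: T}]; split.
- rewrite /= size_map -cardE eqxx iota_uniq /= all_map; apply/allP => U _ /=.
  have : is_FO (lexF lf U) by apply: lexF_FO.
  by elim: (lexF lf U) => //= p IHp q IHq /andP[/IHp -> /IHq].
- by rewrite all_map; apply/allP => U _ /=; apply: lexF_FO.
move=> A so; rewrite WE eqW /ssat /= size_iota -/(setnum K k _ so).
pose wd := [seq ohead (letter lf (setnum K k i so)) | i <- iota 0 (cap A k)].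
have -> : wordf K k lf so = pmap id wd.
  rewrite /wordf /wd; elim: (iota 0 _) => //= i l <-.
  by rewrite /letter; case: [seq x.1 | x <- lf & _] => //= c l'; rewrite take0.
rewrite -ggrpP; apply: (fun e => eq_ind_r (fun l => in_word_problem ggrp l <-> _) (iff_refl _) e).
rewrite /wd -map_comp; apply: eq_map => i /=.
rewrite -map_comp; set so1 := qassign _ _ _.
rewrite (eq_map (g := fun U => if letter lf (so1 : sets A) is a :: _ then lexset a == U else false)) => [|U]; last first.
  exact: sat_lexF.
rewrite /qletter /gletter; have -> : setnum K k i so = so1 by [].
case: (letter lf so1) => [|a l] /=.
  have -> : find id [seq false | U <- enum {: T}] = m.
    by rewrite find_map /m cardE; elim: (enum _) => //= x l ->.
  by rewrite ltnn.
have -> : find id [seq lexset a == U | U <- enum {: T}] = index (lexset a) (enum {: T}).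
  by rewrite find_map; apply: eq_find => U /=; rewrite eq_sym.
by rewrite ifT // /m cardE index_mem mem_enum.
Qed.

End GroupoidOfGrammar.

(** * Elimination of free variables *)

Section Closing.
Variable s : nat.
Implicit Types (p : formula s).

Definition close_term (bf : seq nat) (t : term) : term :=
  if t is TVar x then if x \in bf then t else TMin else t.

(** The quantifier built from a grammar may mention parameters. Variables outside the lists get the
    values that [models] gives them, the first position and the empty set, so truth is unchanged. *)
Fixpoint close (bf bs : seq nat) p : formula s :=
  match p with
  | FP a t => FP a (close_term bf t)
  | @FEq _ t1 t2 => FEq s (close_term bf t1) (close_term bf t2)
  | @FLt _ t1 t2 => FLt s (close_term bf t1) (close_term bf t2)
  | @FIn _ X t => if X \in bs then FIn s X (close_term bf t) else FNot (FEq s TMin TMin)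
  | FNot p => FNot (close bf bs p)
  | FAnd p q => FAnd (close bf bs p) (close bf bs q)
  | FOr p q => FOr (close bf bs p) (close bf bs q)
  | FEx x p => FEx x (close (x :: bf) bs p)
  | FAll x p => FAll x (close (x :: bf) bs p)
  | _ => p
  end.

Lemma close_FO bf bs p : is_FO p -> is_FO (close bf bs p).
Proof.
elim: p bf => //=.
- by move=> X t bf _; case: ifP.
- by move=> p IHp q IHq bf /andP[/IHp -> /IHq ->].
- by move=> p IHp q IHq bf /andP[/IHp -> /IHq ->].
- by move=> x p IH bf /IH.
- by move=> x p IH bf /IH.
Qed.

Lemma FO_wf p : is_FO p -> wf p.
Proof. by elim: p => //= p IHp q IHq /andP[/IHp -> /IHq ->]. Qed.

Lemma tvars_close bf t : {subset tvars (close_term bf t) <= bf}.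
Proof. by case: t => //= x; case: ifP => //= xin y; rewrite inE => /eqP ->. Qed.

Lemma fov_close bf bs p : is_FO p -> {subset fov (close bf bs p) <= bf}.
Proof.
have sub_cat (l1 l2 : seq nat) bf0 : {subset l1 <= bf0} -> {subset l2 <= bf0} -> {subset l1 ++ l2 <= bf0}.
  by move=> s1 s2 y; rewrite mem_cat => /orP[/s1|/s2].
elim: p bf => //=.
- by move=> a t bf _; apply: tvars_close.
- by move=> t1 t2 bf _; apply: sub_cat; apply: tvars_close.
- by move=> t1 t2 bf _; apply: sub_cat; apply: tvars_close.
- by move=> X t bf _; case: ifP => // _; apply: tvars_close.
- by move=> p IHp q IHq bf /andP[FOp FOq]; apply: sub_cat; [apply: IHp | apply: IHq].
- by move=> p IHp q IHq bf /andP[FOp FOq]; apply: sub_cat; [apply: IHp | apply: IHq].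
- by move=> x p IH bf FOp y; rewrite mem_filter => /andP[/negbTE ne /IH]; rewrite inE ne /=; apply.
- by move=> x p IH bf FOp y; rewrite mem_filter => /andP[/negbTE ne /IH]; rewrite inE ne /=; apply.
Qed.

Lemma sov_close bf bs p : is_FO p -> {subset sov (close bf bs p) <= bs}.
Proof.
have sub_cat (l1 l2 : seq nat) bf0 : {subset l1 <= bf0} -> {subset l2 <= bf0} -> {subset l1 ++ l2 <= bf0}.
  by move=> s1 s2 y; rewrite mem_cat => /orP[/s1|/s2].
elim: p bf => //=.
- by move=> X t bf _; case: ifP => //= Xin y; rewrite inE => /eqP ->.
- by move=> p IHp q IHq bf /andP[FOp FOq]; apply: sub_cat; [apply: IHp | apply: IHq].
- by move=> p IHp q IHq bf /andP[FOp FOq]; apply: sub_cat; [apply: IHp | apply: IHq].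
- by move=> x p IH bf FOp; apply: IH.
- by move=> x p IH bf FOp; apply: IH.
Qed.

Lemma teval_close n bf t (fo fo' : nat -> 'I_n.+1) :
  (forall x, fo' x = if x \in bf then fo x else ord0) ->
  teval fo (close_term bf t) = teval fo' t.
Proof. by move=> fE; case: t => //= x; rewrite fE; case: ifP. Qed.

Lemma sat_close n (w : 'I_n.+1 -> 'I_s) bf bs p fo fo' so so' : is_FO p ->
  (forall x, fo' x = if x \in bf then fo x else ord0) ->
  (forall X, so' X = if X \in bs then so X else set0) ->
  sat w (close bf bs p) fo so = sat w p fo' so'.
Proof.
move=> + + sE; have updE x v bf0 fo0 fo0' : (forall y, fo0' y = if y \in bf0 then fo0 y else ord0) ->
    forall y, fupd fo0' x v y = if y \in x :: bf0 then fupd fo0 x v y else ord0 :> 'I_n.+1.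
  by move=> fE y; rewrite /fupd in_cons; case: eqP => //= _; apply: fE.
elim: p bf fo fo' => //=.
- by move=> a t bf fo fo' _ fE; rewrite (teval_close _ fE).
- by move=> t1 t2 bf fo fo' _ fE; rewrite !(teval_close _ fE).
- by move=> t1 t2 bf fo fo' _ fE; rewrite !(teval_close _ fE).
- move=> X t bf fo fo' _ fE; rewrite sE; case: ifP => _ /=; first by rewrite (teval_close _ fE).
  by rewrite ?eqxx inE.
- by move=> p IH bf fo fo' FOp fE; rewrite (IH _ _ _ FOp fE).
- by move=> p IHp q IHq bf fo fo' /andP[FOp FOq] fE; rewrite (IHp _ _ _ FOp fE) (IHq _ _ _ FOq fE).
- by move=> p IHp q IHq bf fo fo' /andP[FOp FOq] fE; rewrite (IHp _ _ _ FOp fE) (IHq _ _ _ FOq fE).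
- by move=> x p IH bf fo fo' FOp fE; apply: eq_existsb => v; apply: IH => //; apply: updE.
- by move=> x p IH bf fo fo' FOp fE; apply: eq_forallb => v; apply: IH => //; apply: updE.
Qed.

Lemma close_QFO m (G : gquant m) Xs (ps : seq (formula s)) :
  wf (FQ G Xs ps) -> all (@is_FO s) ps ->
  exists psi, [/\ wf psi, is_sentence psi, is_QGrpFO psi & equiv_sent (FQ G Xs ps) psi].
Proof.
move=> /andP[/andP[/eqP szps uXs] _] FOps.
exists (FQ G Xs [seq close [::] Xs p | p <- ps]); split.
- rewrite /= size_map szps eqxx uXs /= all_map.
  by apply: sub_all FOps => p FOp /=; apply/FO_wf/close_FO.
- apply/andP; split; rewrite /= -map_comp.
    apply/eqP; elim: ps FOps {szps} => //= p ps IH /andP[FOp /IH ->]; rewrite cats0.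
    by have := @fov_close [::] Xs p FOp; case: (fov _) => // x l /(_ x); rewrite mem_head => /(_ isT).
  apply/eqP; elim: ps FOps {szps} => //= p ps IH /andP[FOp /IH]; rewrite filter_cat => ->; rewrite cats0.
  apply/eqP; rewrite -[_ == _]negbK -has_filter; apply/hasPn => Y /(sov_close FOp) Yin.
  by rewrite negbK.
- by rewrite /= all_map; apply: sub_all FOps => p; apply: close_FO.
move=> n w; rewrite /models /=; congr (in_word_problem G _); apply: eq_map => i.
congr (qletter m _); rewrite -map_comp.
elim: ps FOps {szps} => //= p ps IH /andP[FOp /IH ->]; congr (_ :: _).
by apply/esym/sat_close => // X; rewrite /qassign; case: ifP.
Qed.

End Closing.

Theorem theorem3p3 : forall s : nat,
  (forall phi : formula s, wf phi -> is_sentence phi ->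
     exists psi : formula s,
       [/\ wf psi, is_sentence psi, is_QGrpFO psi & equiv_sent phi psi]) /\
  (forall psi : formula s, wf psi -> is_sentence psi -> is_QGrpFO psi ->
     exists phi : formula s,
       [/\ wf phi, is_sentence phi & equiv_sent psi phi]).
Proof.
(* The converse is the inclusion of a fragment: [psi] itself serves. *)
move=> s; split=> [phi wphi _|psi wpsi spsi _]; last by exists psi; split.
have [K ltK] := svlt_ex phi.
(* Only here, after the induction, is the complement dropped. *)
have [[g dphi] _] := both_formula wphi ltK.
have [Xs [ps [wQ FOps QE]]] := Gdef_QFO dphi.
have [psi [wpsi spsi Qpsi eqpsi]] := close_QFO wQ FOps.
exists psi; split=> // n w; rewrite -eqpsi.
by have := QE (Str w (fun _ => ord0)) (fun _ => set0); rewrite /ssat /models => H; apply/idP/idP => /H.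
Qed.
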